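(* Consider the task-based flow-time-plus-energy problem described in the context with power function $P(s)=s^\alpha$, $\alpha>1$, under online (arbitrary release times) job arrivals and the many-tasks scaling assumption. Then the online algorithm described in the context has competitive ratio at most $$P\!\left(2-\tfrac1K\right)\bigl(2\beta+2+2(\alpha-1)\bigr)+o(1),\qquad \beta=\frac{w^t_{\max}}{w_{\text{reduce},\min}},$$ where $w^t_{\max}$ is the maximum size of any (map or reduce) task and $w_{\text{reduce},\min}$ is the minimum size of any reduce task, and the $o(1)$ term vanishes under the many-tasks scaling.
   Context: Model: there are $K$ identical servers. Server $k$ runs at time $t$ at a chosen speed $s_k(t)\ge0$ (work per unit time) and consumes power $P(s_k(t))$. A finite set $\mathcal J$ of $\mathsf J$ jobs is given; job $i$ is released at time $a_i$ and consists of $m_i$ map tasks with sizes $\mathsf m_{i1},\dots,\mathsf m_{im_i}$ and $r_i$ reduce tasks with sizes $\mathsf r_{i1},\dots,\mathsf r_{ir_i}$. MapReduce constraint: a reduce task of job $i$ may be processed only after all map tasks of job $i$ are completed. Preemption and migration are allowed; a task cannot run on two servers at once. A task is free at time $t$ if it may be processed at $t$ (map tasks are always free; a reduce task is free once all map tasks of its job are done); a non-free reduce task is caged. The flow time of a task of job $i$ completed at time $c$ is $c-a_i$. The task-based cost is $C_{\text{task}}=\int (n_f(t)+n_c(t))\,dt+\int\sum_{k=1}^K P(s_k(t))\,dt$, where $n_f(t),n_c(t)$ are the numbers of unfinished free and caged tasks. An online algorithm learns about job $i$ only at time $a_i$. The competitive ratio of $A$ is $\sup_\sigma C^A(\sigma)/C^{\mathsf{OPT}}(\sigma)$,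 where $\mathsf{OPT}$ is the minimum cost of any feasible schedule (tasks and speeds) chosen with full knowledge of the input. Many-tasks scaling assumption: the total number of map plus reduce tasks is large and $\mathsf J\,w^t_{\max}\,K^2\,r_{\max}^{1-1/\alpha}=o\bigl(\sum(\text{sizes of all map and reduce tasks of all jobs})\bigr)$, where $r_{\max}=\max_i r_i$. Algorithm: for a map task $j$ of job $i$, its load is $\ell_j=r_i+1$; $b_j(t)$ is the number of unfinished map tasks of job $i$ at time $t$, and $\hat b_j(t)=\min\{b_j(t),K\}$. Let $n(t)$ be the number of unfinished tasks and $n_f(t)$ the number of free unfinished tasks. At each time the algorithm processes the $\min\{n_f(t),K\}$ free tasks with smallest remaining size on $\min\{n_f(t),K\}$ distinct servers. If $n_f(t)\ge K$, all servers run at speed $P^{-1}\!\left(\frac{n(t)+1}{K}\right)$. Otherwise, a server processing map task $j$ runs at speed $P^{-1}\!\left(\frac{\ell_j+\hat b_j(t)+1}{\hat b_j(t)}\right)$ and a server processing a free reduce task runs at speed $P^{-1}(1)$. *)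

(* Defs.v *)
From HB Require Import structures.
From mathcomp Require Import all_boot all_order all_algebra.
From mathcomp Require Import all_classical all_reals all_analysis.
Set Implicit Arguments. Unset Strict Implicit. Unset Printing Implicit Defensive.
Import Order.TTheory GRing.Theory Num.Theory.
Local Open Scope ring_scope.
Local Open Scope classical_set_scope.

(* An instance: nT tasks (map and reduce tasks of all jobs, flattened), nJ jobs.
   Task j belongs to job [job j], is a map task iff [ismap j], has size [wsz j];
   job i is released at time [rel i]. *)
Record instance (R : realType) := Instance {
  nT : nat; nJ : nat;
  job : 'I_nT -> 'I_nJ;
  ismap : 'I_nT -> bool;
  wsz : 'I_nT -> R;
  rel : 'I_nJ -> R }.

Section Model.
Variables (R : realType) (I : instance R).
Local Notation job := (@job R I).
Local Notation ismap := (@ismap R I).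
Local Notation wsz := (@wsz R I).
Local Notation rel := (@rel R I).

Definition wf_instance : Prop :=
  (forall j, 0 < wsz j) /\
  (forall i, exists j, job j = i /\ ismap j) /\
  (forall i, exists j, job j = i /\ ~~ ismap j).

Definition nreduce (i : 'I_(nJ I)) : nat := \sum_(j < nT I) ((job j == i) && ~~ ismap j).
Definition rmax : nat := \max_(i < nJ I) nreduce i.
Definition wmax : R := \big[Num.max/0]_(j < nT I) wsz j.
Definition wredmin : R := \big[Num.min/wmax]_(j < nT I | ~~ ismap j) wsz j.
Definition beta : R := wmax / wredmin.
Definition total_size : R := \sum_(j < nT I) wsz j.

(* A schedule on K servers: at time t server k runs task [assign t k] (or idles)
   at speed [speed t k]. *)
Record schedule (K : nat) := Schedule {
  assign : R -> 'I_K -> option 'I_(nT I);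
  speed : R -> 'I_K -> R }.

Variables (K : nat) (S : schedule K).

Definition released (j : 'I_(nT I)) (t : R) : Prop := rel (job j) <= t.

Definition work (j : 'I_(nT I)) (t : R) : \bar R :=
  (\int[@lebesgue_measure R]_(x in `[rel (job j), t])
     (\sum_(k < K) (if assign S x k == Some j then speed S x k else 0))%:E)%E.

Definition finished (j : 'I_(nT I)) (t : R) : Prop := ((wsz j)%:E <= work j t)%E.

Definition remaining (j : 'I_(nT I)) (t : R) : \bar R := ((wsz j)%:E - work j t)%E.

Definition unfinished (j : 'I_(nT I)) (t : R) : bool :=
  `[< released j t /\ ~ finished j t >].

Definition free (j : 'I_(nT I)) (t : R) : Prop :=
  ismap j \/ (forall j', job j' = job j -> ismap j' -> finished j' t).

Definition n_unf (t : R) : nat := \sum_(j < nT I) unfinished j t.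
Definition n_free (t : R) : nat := \sum_(j < nT I) (unfinished j t && `[< free j t >]).

Definition processed (j : 'I_(nT I)) (t : R) : Prop := exists k, assign S t k = Some j.

Definition feasible : Prop :=
  (forall t k, 0 <= speed S t k) /\
  (forall k, measurable_fun setT (fun t => speed S t k)) /\
  (forall k j, measurable [set t | assign S t k = Some j]) /\
  (forall t k1 k2 j, assign S t k1 = Some j -> assign S t k2 = Some j -> k1 = k2) /\
  (forall t k j, assign S t k = Some j -> released j t /\ free j t).

Definition cost (alpha : R) : \bar R :=
  (\int[@lebesgue_measure R]_(t in setT) ((n_unf t)%:R)%:E +
   \int[@lebesgue_measure R]_(t in setT)
      (\sum_(k < K) powR (speed S t k) alpha)%:E)%E.

Definition bmap (j : 'I_(nT I)) (t : R) : nat :=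
  \sum_(j' < nT I) [&& job j' == job j, ismap j' & unfinished j' t].

Definition alg_rule (alpha : R) (t : R) : Prop :=
  (forall j, processed j t -> unfinished j t /\ free j t) /\
  (\sum_(j < nT I) `[< processed j t >] = minn (n_free t) K)%N /\
  (forall j j', processed j t -> unfinished j' t -> free j' t -> ~ processed j' t ->
     (remaining j t <= remaining j' t)%E) /\
  ((K <= n_free t)%N ->
     forall k, speed S t k = powR ((n_unf t + 1)%:R / K%:R) alpha^-1) /\
  ((n_free t < K)%N ->
     (forall k, assign S t k = None -> speed S t k = 0) /\
     (forall k j, assign S t k = Some j ->
        speed S t k =
          if ismap j then
            let bh := minn (bmap j t) K in
            powR (((nreduce (job j)).+1 + bh + 1)%:R / bh%:R) alpha^-1
          else powR 1 alpha^-1)).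

Definition follows_alg (alpha : R) : Prop :=
  {ae @lebesgue_measure R, forall t, alg_rule alpha t}.

End Model.

Definition OPT (R : realType) (I : instance R) (K : nat) (alpha : R) : \bar R :=
  ereal_inf [set c | exists S : schedule I K, feasible S /\ c = cost S alpha].

Definition scaleQ (R : realType) (I : instance R) (K : nat) (alpha : R) : R :=
  (nJ I)%:R * wmax I * (K%:R) ^+ 2 * powR (rmax I)%:R (1 - alpha^-1).

Definition ratio_bound (R : realType) (I : instance R) (K : nat) (alpha : R) : R :=
  powR (2 - (K%:R)^-1) alpha * (2 * beta I + 2 + 2 * (alpha - 1)).

(* Main.v *)
(** The proof is an amortized analysis against an arbitrary feasible schedule
    of finite cost. Let [y] and [x] be the remaining works of the tasks under
    the algorithm and under that schedule. Every level [q] in [`]0, w]], where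
    [w] is the smallest size of a reduce task, carries the number of tasks of
    remaining work at least [q] under the algorithm minus the same number for
    the competitor; the work of a task in excess of [w] is spread uniformly over
    all levels. Caged reduce tasks have remaining work at least [w], so on these
    levels processing the shortest free tasks is as good as processing the
    shortest tasks. The potential integrates over [q] the price of this
    difference, where the [k]-th task costs [k^(1 - 1/alpha)]; by Young's
    inequality its drift pays for the algorithm as long as all servers are busy.
    When a server idles, a multiple of the total remaining work pays for the
    free reduce tasks, and a multiple of the largest remaining map task of each
    job pays for its map tasks and caged tasks. Initially these two terms amount
    to a multiple of the total size of the tasks, for the second one by the
    scaling assumption, and the total size is at most the cost of any schedule;
    for [K >= 2] the factor [(2 - 1/K)^alpha >= (3/2)^alpha] absorbs this
    multiple, for [K = 1] the second term vanishes. *)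
Require Import Defs.
From HB Require Import structures.
From mathcomp Require Import all_boot all_order all_algebra.
From mathcomp Require Import all_classical all_reals all_analysis.
From mathcomp Require Import measurable_realfun lra ring zify.
Set Implicit Arguments. Unset Strict Implicit. Unset Printing Implicit Defensive.
Import Order.TTheory GRing.Theory Num.Theory.
Import numFieldNormedType.Exports.
Local Open Scope ring_scope.
Local Open Scope classical_set_scope.

(** * Absolutely continuous functions *)

(** Releases cost nothing: every task enters the work vectors with its full size from a start time
    before all releases, so an unreleased task cancels in the profile and the potential has no jump
    to control. The obstacle is regularity. Speeds are merely integrable and [alg_rule] holds only
    almost everywhere, so the potential is only absolutely continuous in time. Its drift is
    therefore computed for the linear extrapolation of both vectors from one good time, transferred
    to the true trajectories by a Lipschitz bound in the vectors, and integrated through a one-sided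
    derivative criterion. Convexity of the price in the profile allows the moves of the algorithm
    and of the competitor to be priced separately. The price carries a factor 2 because with all
    servers busy the algorithm pays [n + PA = 2 * n + 1]: the energy matches the task count. Levels
    measure work exactly, since the level function of a task integrates over the levels to its
    remaining work. *)

Section absolutely_continuous.
Variable R : realType.
Local Notation mu := (@lebesgue_measure R).
Implicit Types (A B a b t d e : R) (f g h r Phi : R -> R).

(** Induction along the reals: the second condition forbids an upward jump, so the supremum of the
    times with [Phi t <= Phi A] is such a time itself; the first condition then moves past it unless
    it is [B]. *)
Lemma le_of_locally_nonincreasing A B Phi : A <= B ->
  (forall t, A <= t < B ->
     exists2 eta, 0 < eta & forall d, 0 < d < eta -> Phi (t + d) <= Phi t) ->
  (forall t, A < t <= B -> forall e, 0 < e ->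
     exists2 eta, 0 < eta &
       forall s, A <= s -> t - eta < s < t -> Phi t <= Phi s + e) ->
  Phi B <= Phi A.
Proof.
move=> AB right left.
pose E := [set t | A <= t <= B /\ Phi t <= Phi A].
have EA : E A by split; rewrite ?lexx ?AB.
have supE : has_sup E by split; [exists A|exists B => t [/andP[]]].
have supA : A <= sup E by apply: sup_upper_bound.
have supB : sup E <= B by apply: ge_sup; [exists A|move=> t [/andP[]]].
have Esup : Phi (sup E) <= Phi A.
  have [<-//|neqA] := eqVneq A (sup E).
  have ltA : A < sup E by rewrite lt_neqAle neqA.
  apply/ler_addgt0Pr => e e0.
  have [|eta eta0 Heta] := left (sup E) _ e e0; first by rewrite ltA.
  have [s Es /= lts] := sup_adherent eta0 supE.
  have [/andP[As sB] Phis] := Es.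
  have := sup_upper_bound supE Es; rewrite le_eqVlt => /orP[/eqP<-|ssup].
    by rewrite (le_trans Phis)// lerDl ltW.
  by apply: le_trans (Heta s As _) _; rewrite ?lts// lerD2r.
have [<-//|neqB] := eqVneq (sup E) B.
have ltB : sup E < B by rewrite lt_neqAle neqB.
have [|eta eta0 Heta] := right (sup E); first by rewrite supA.
pose d := Num.min (eta / 2) (B - sup E).
have d0 : 0 < d by rewrite lt_min divr_gt0//= subr_gt0.
have dB : sup E + d <= B by rewrite -lerBrDl ge_min lexx orbT.
have deta : d < eta by apply: (@le_lt_trans _ _ (eta / 2)); [rewrite ge_min lexx|lra].
have Ed : E (sup E + d).
  split; first by rewrite dB andbT (le_trans supA)// lerDl ltW.
  by rewrite (le_trans _ Esup)//; apply: Heta; rewrite d0.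
have := sup_upper_bound supE Ed.
by rewrite gerDl leNgt d0.
Qed.

Lemma integrable_EFinD (D : set R) f g : measurable D ->
  mu.-integrable D (EFin \o f) -> mu.-integrable D (EFin \o g) ->
  mu.-integrable D (EFin \o (fun x => f x + g x)).
Proof.
move=> mD intf intg; rewrite (_ : _ \o _ = (EFin \o f) \+ (EFin \o g))%E//.
exact: integrableD.
Qed.

Lemma integrable_EFinZ (D : set R) c f : measurable D ->
  mu.-integrable D (EFin \o f) -> mu.-integrable D (EFin \o (fun x => c * f x)).
Proof.
move=> mD intf.
by rewrite (_ : _ \o _ = fun x => (c%:E * (EFin \o f) x)%E)//; exact: integrableZl.
Qed.

Lemma integrable_EFin_norm (D : set R) f : measurable D ->
  mu.-integrable D (EFin \o f) -> mu.-integrable D (EFin \o (fun x => `|f x|)).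
Proof.
by move=> mD intf; rewrite (_ : _ \o _ = abse \o (EFin \o f))//; exact: integrable_abse.
Qed.

Lemma integrable_EFin_sum (D : set R) (J : Type) (s : seq J) (P : pred J)
    (F : J -> R -> R) : measurable D ->
  (forall i, mu.-integrable D (EFin \o F i)) ->
  mu.-integrable D (EFin \o (fun x => \sum_(i <- s | P i) F i x)).
Proof.
move=> mD intF; elim: s => [|i s IH].
  rewrite (_ : _ \o _ = cst 0%E); first exact: integrable0.
  by apply/funext => x /=; rewrite big_nil.
rewrite (_ : _ \o _ = EFin \o (fun x => (if P i then F i x else 0) +
   \sum_(i <- s | P i) F i x)).
  by apply: integrable_EFinD => //; case: (P i) => //; exact: integrable0.
by apply/funext => x /=; rewrite big_cons; case: ifP => //; rewrite add0r.
Qed.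

Lemma lebesgue_measure_itvcc A B : (mu `[A, B] < +oo)%E.
Proof. by rewrite lebesgue_measure_itv/=; case: ifP => // _; rewrite -EFinD ltry. Qed.

Lemma integrable_bounded f A B c : measurable_fun setT f -> (forall x, `|f x| <= c) ->
  mu.-integrable `[A, B] (EFin \o f).
Proof.
move=> mf fc; apply: measurable_bounded_integrable => //=.
- exact: lebesgue_measure_itvcc.
- exact: measurable_funTS.
- exists c; split; first by rewrite num_real.
  by move=> x cx y _ /=; exact: le_trans (fc y) (ltW cx).
Qed.

Lemma Rintegral_cst_oc a b c : a <= b -> \int[mu]_(x in `]a, b]) c = c * (b - a).
Proof.
move=> ab; have -> : b - a = fine (mu `]a, b]); last exact: Rintegral_cst.
rewrite lebesgue_measure_itv/= lte_fin; case: ifPn => //.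
by rewrite -leNgt => ba; rewrite (le_anti (introT andP (conj ab ba))) subrr.
Qed.

Lemma Rintegral_cst_cc a b c : a <= b -> \int[mu]_(x in `[a, b]) c = c * (b - a).
Proof.
move=> ab; rewrite -Rintegral_cst_oc// Rintegral_itv_obnd_cbnd//.
have H : mu.-integrable `[a, b] (EFin \o cst c).
  exact: (@integrable_bounded _ a b `|c|).
by apply: integrableS H => //; apply: subset_itv; rewrite bnd_simp.
Qed.

Lemma Rintegral_oc f A B a b : mu.-integrable `[A, B] (EFin \o f) ->
  A <= a -> a <= b -> b <= B ->
  \int[mu]_(x in `[A, b]) f x - \int[mu]_(x in `[A, a]) f x =
  \int[mu]_(x in `]a, b]) f x.
Proof.
move=> intf Aa ab bB; apply: Rintegral_itvB; rewrite ?bnd_simp//.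
apply: integrableS intf => //.
by apply: subset_itvl; rewrite bnd_simp.
Qed.

Lemma ae_mp (P Q : R -> Prop) : {ae mu, forall x, P x} ->
  (forall x, P x -> Q x) -> {ae mu, forall x, Q x}.
Proof.
by move=> aeP PQ; move: aeP; apply: filterS => //; exact: (ae_filter_ringOfSetsType mu).
Qed.

Lemma ae_and (P Q : R -> Prop) : {ae mu, forall x, P x} ->
  {ae mu, forall x, Q x} -> {ae mu, forall x, P x /\ Q x}.
Proof.
by move=> aeP aeQ; apply: filterI => //; exact: (ae_filter_ringOfSetsType mu).
Qed.

Lemma ae_forall n (P : 'I_n -> R -> Prop) :
  (forall i, {ae mu, forall x, P i x}) -> {ae mu, forall x, forall i, P i x}.
Proof.
move=> aeP.
have /ae_mp : {ae mu, forall x, forall i, i \in enum 'I_n -> P i x}.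
  elim: (enum 'I_n) => [|i s IH]; first by apply: (ae_mp (aeW _ (fun=> I))).
  apply: (ae_mp (ae_and (aeP i) IH)) => x [Pi Ps] k.
  by rewrite inE => /orP[/eqP->//|/Ps].
by apply=> x H i; apply: H; rewrite mem_enum.
Qed.

Lemma ae_right_derivative f A B : mu.-integrable `[A, B] (EFin \o f) ->
  {ae mu, forall t, A < t < B -> forall e, 0 < e ->
    exists2 eta, 0 < eta & forall d, 0 < d < eta ->
      `|\int[mu]_(x in `]t, t + d]) f x - f t * d| <= e * d}.
Proof.
move=> intf; have mAB : measurable (`[A, B] : set R) by [].
have ptae := lebesgue_differentiation (integrable_locally mAB intf).
apply: (ae_mp ptae) => t pt /andP[At tB] e e0.
(* Extension by zero gives a function that is integrable over every interval ending on the right, as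
   the fundamental theorem at a Lebesgue point requires. *)
set fr := f \_ `[A, B] in pt.
have frt : fr t = f t.
  by rewrite /fr patchE mem_set//= in_itv/= !ltW.
have intfr y : mu.-integrable `[A, y] (EFin \o fr).
  apply: (@integrableS _ _ _ _ setT) => //.
  rewrite -restrict_EFin; apply/integrable_restrict => //=; rewrite setTI//.
have [] := FTC1_lebesgue_pt (a := BLeft A) tB (intfr B) _ pt.
  by rewrite lte_fin.
set F := (fun y => _) => dF; rewrite derive1E frt => dFt.
have : h^-1 *: ((F \o shift t) (h *: 1) - F t) @[h --> 0^'] --> f t.
  by rewrite -dFt; exact: dF.
move=> /cvgrPdist_le /(_ e e0) /nbhs_ballP[eta /= eta0 Heta].
exists (Num.min eta (B - t)); first by rewrite lt_min eta0 subr_gt0.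
move=> d /andP[d0]; rewrite lt_min => /andP[deta dB].
have tdB : t + d <= B by lra.
have -> : \int[mu]_(x in `]t, t + d]) f x = F (t + d) - F t.
  rewrite /F (Rintegral_oc (intfr (t + d)) (ltW At))//; last by lra.
  apply: eq_Rintegral => x; rewrite inE/= in_itv/= => /andP[tx xtd].
  by rewrite /fr patchE mem_set//= in_itv/= (ltW (lt_trans At tx)) (le_trans xtd).
have := Heta d; rewrite /ball/= sub0r normrN gtr0_norm// => /(_ deta).
have d0' : d != 0 by rewrite gt_eqF.
move=> /(_ d0'); rewrite [d%:A]mulr1 (addrC d t) => H.
have -> : F (t + d) - F t - f t * d = - (f t - d^-1 *: (F (t + d) - F t)) * d.
  by rewrite /GRing.scale/=; field.
by rewrite normrM normrN (gtr0_norm d0) ler_pM2r.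
Qed.

(* Absolute continuity controls the increments across an open set of small
   measure that covers the exceptional null set; elsewhere the derivative bound
   applies, so the comparison function below dominates everywhere. *)
Lemma le_integral_of_ae_dini A B Phi h r : A <= B ->
  (forall t, 0 <= h t) ->
  mu.-integrable `[A, B] (EFin \o h) -> mu.-integrable `[A, B] (EFin \o r) ->
  (forall a b, A <= a -> a <= b -> b <= B ->
     Phi b - Phi a <= \int[mu]_(x in `]a, b]) h x) ->
  {ae mu, forall t, A < t < B -> forall e, 0 < e ->
    exists2 eta, 0 < eta & forall d, 0 < d < eta ->
      Phi (t + d) - Phi t <= (r t + e) * d} ->
  Phi B - Phi A <= \int[mu]_(x in `[A, B]) r x.
Proof.
move=> AB h0 inth intr Phih aePhi.
have mAB : measurable (`[A, B] : set R) by [].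
apply/ler_addgt0Pr => e0 e0_gt0.
(* The error has two parts: [e * (B - A)] from the derivative bound and [e] from the integral over
   the open set [U]. *)
pose e := e0 / (B - A + 1).
have BA1 : 0 < B - A + 1 by lra.
have e_gt0 : 0 < e by rewrite divr_gt0.
pose hr x := h x + `|r x|.
have inthr : mu.-integrable `[A, B] (EFin \o hr).
  by apply: integrable_EFinD => //; exact: integrable_EFin_norm.
have inthrT : mu.-integrable setT (EFin \o (hr \_ `[A, B])).
  by rewrite -restrict_EFin; apply/integrable_restrict => //=; rewrite setTI.
have [d1 [d1_gt0 Hd1]] := integral_normr_continuous inthrT e_gt0.
have [Z [mZ muZ subZ]] := ae_and (ae_right_derivative intr) aePhi.
(* The left end point joins the null set because the derivative bound is assumed only for
   [A < t]. *)
have [U [oU ZU muU]] : exists U, [/\ open U, Z `|` [set A] `<=` U & (mu U < d1%:E)%E].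
  have mZA : measurable (Z `|` [set A]) by exact: measurableU.
  have muZA : mu (Z `|` [set A]) = 0%E.
    apply/eqP; rewrite eq_le measure_ge0 andbT.
    have : (mu (Z `|` [set A]) <= mu Z + mu [set A])%E by exact: measureU2.
    by rewrite muZ add0e lebesgue_measure_set1.
  have [|U [oU ZU UZ]] := @lebesgue_regularity_outer R _ _ mZA _ d1_gt0.
    exact: (eq_ind_r (fun z => z < +oo)%E (ltry 0) muZA).
  exists U; split=> //; apply: le_lt_trans UZ.
  have mU := measurable_realfun.open_measurable oU.
  have : (mu ((U `\` (Z `|` [set A])) `|` (Z `|` [set A])) <=
          mu (U `\` (Z `|` [set A])) + mu (Z `|` [set A]))%E.
    by apply: measureU2 => //; exact: measurableD.
  by rewrite muZA adde0 setDKU.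
have mU := measurable_realfun.open_measurable oU.
have inthrU : mu.-integrable `[A, B] (EFin \o (hr \_ U)).
  rewrite -restrict_EFin; apply/integrable_restrict => //=.
  by apply: integrableS inthr => //; exact: measurableI.
(* Inside [U] the summand [|r x|] of [hr] cancels a negative [r x], so [g] dominates [h] there;
   outside [U] the term [r x + e] dominates the derivative of [Phi]. *)
pose g x := r x + e + (hr \_ U) x.
have hr0 x : 0 <= hr x by rewrite addr_ge0.
have hrU0 x : 0 <= (hr \_ U) x by rewrite patchE; case: ifP.
have intcst c : mu.-integrable `[A, B] (EFin \o cst c).
  exact: (@integrable_bounded _ A B `|c|).
have intre : mu.-integrable `[A, B] (EFin \o (fun x => r x + e)).
  exact: integrable_EFinD intr (intcst e).
have intg : mu.-integrable `[A, B] (EFin \o g) by exact: integrable_EFinD.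
have intsub f a b : mu.-integrable `[A, B] (EFin \o f) -> A <= a -> b <= B ->
    mu.-integrable `]a, b] (EFin \o f).
  move=> intf Aa bB; apply: integrableS intf => //.
  by apply: subset_itv; rewrite bnd_simp.
pose G t := \int[mu]_(x in `[A, t]) g x.
have GE a b : A <= a -> a <= b -> b <= B -> G b - G a = \int[mu]_(x in `]a, b]) g x.
  exact: Rintegral_oc.
suff : Phi B - G B <= Phi A - G A.
  have -> : G A = 0 by rewrite /G set_itv1 Rintegral_set1.
  have -> : G B = \int[mu]_(x in `[A, B]) r x + e * (B - A)
                  + \int[mu]_(x in `[A, B]) (hr \_ U) x.
    have -> : G B = \int[mu]_(x in `[A, B]) (r x + e)
                  + \int[mu]_(x in `[A, B]) (hr \_ U) x by exact: RintegralD.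
    congr (_ + _); have -> : \int[mu]_(x in `[A, B]) (r x + e) =
        \int[mu]_(x in `[A, B]) r x + \int[mu]_(x in `[A, B]) e.
      by apply: RintegralD => //; exact: (intcst e).
    by rewrite Rintegral_cst_cc.
  have : \int[mu]_(x in `[A, B]) (hr \_ U) x < e.
    have := Hd1 _ mU muU; congr (_ < _).
    rewrite -Rintegral_mkcondr setIC Rintegral_mkcondr.
    by apply: eq_Rintegral => x _; rewrite ger0_norm// patchE; case: ifP.
  have eE : e * (B - A) + e = e0 by rewrite /e; field; rewrite gt_eqF.
  lra.
apply: (@le_of_locally_nonincreasing A B (fun t => Phi t - G t)) => //.
- move=> t /andP[At tB].
  suff [eta eta0 Heta] : exists2 eta, 0 < eta & forall d, 0 < d < eta ->
      t + d <= B -> Phi (t + d) - Phi t <= \int[mu]_(x in `]t, t + d]) g x.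
    exists (Num.min eta (B - t)); first by rewrite lt_min eta0 subr_gt0.
    move=> d /andP[d0]; rewrite lt_min => /andP[deta dB].
    have tdB : t + d <= B by lra.
    have := Heta d; rewrite d0 deta => /(_ isT tdB); rewrite -GE//; last by lra.
    lra.
  have [Ut|Ut] := pselect (U t).
    have /nbhs_ballP[eta /= eta0 Heta] := oU _ Ut.
    exists eta => // d /andP[d0 deta] tdB.
    apply: le_trans (Phih _ _ At _ tdB) _; first by lra.
    apply: le_Rintegral => //; [exact: intsub|exact: intsub|].
    move=> x; rewrite /= in_itv/= => /andP[tx xd].
    rewrite /g patchE mem_set; last first.
      by apply: Heta; rewrite /ball/= ltr0_norm; lra.
    by rewrite /hr; have := ler_norm (- r x); rewrite normrN; lra.
  have Zt : ~ Z t by move=> Zt; apply: Ut; apply: ZU; left.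
  have At' : A < t.
    rewrite lt_neqAle At andbT; apply/eqP => At'.
    by apply: Ut; apply: ZU; right; rewrite /= At'.
  have /contrapT[der dini] : ~ ~ _ := fun H => Zt (subZ t H).
  have At'B : A < t < B by rewrite At'.
  have e2 : 0 < e / 2 by rewrite divr_gt0.
  have [eta1 eta1_gt0 Heta1] := der At'B _ e2.
  have [eta2 eta2_gt0 Heta2] := dini At'B _ e2.
  exists (Num.min eta1 eta2); first by rewrite lt_min eta1_gt0.
  move=> d /andP[d0]; rewrite lt_min => /andP[d1' d2] tdB.
  apply: (@le_trans _ _ (\int[mu]_(x in `]t, t + d]) (r x + e))).
    have -> : \int[mu]_(x in `]t, t + d]) (r x + e) =
        \int[mu]_(x in `]t, t + d]) r x + \int[mu]_(x in `]t, t + d]) e.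
      by apply: RintegralD => //; [exact: intsub|exact: (intsub _ _ _ (intcst e))].
    rewrite Rintegral_cst_oc; last by lra.
    have := Heta1 d; rewrite d0 d1' => /(_ isT); rewrite ler_norml => /andP[H1 _].
    have := Heta2 d; rewrite d0 d2 => /(_ isT); lra.
  apply: le_Rintegral => //; [exact: intsub|exact: intsub|].
  by move=> x _; rewrite /g lerDl.
- move=> t /andP[At tB] e' e'0.
  (* Absolute continuity of the integral of [gh] bounds the increments of [Phi] and of [G] over a
     short interval at once, which excludes an upward jump of [Phi - G]. *)
  pose gh x := `|g x| + h x.
  have intgh : mu.-integrable `[A, B] (EFin \o gh).
    by apply: integrable_EFinD => //; exact: integrable_EFin_norm.
  have intghT : mu.-integrable setT (EFin \o (gh \_ `[A, B])).
    by rewrite -restrict_EFin; apply/integrable_restrict => //=; rewrite setTI.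
  have [d2 [d2_gt0 Hd2]] := integral_normr_continuous intghT e'0.
  exists d2 => // s As /andP[ts st].
  have ltd2 : (mu `]s, t] < d2%:E)%E.
    by rewrite lebesgue_measure_itv/= lte_fin st -EFinD lte_fin; lra.
  have := Hd2 _ (measurable_itv _) ltd2.
  have -> : \int[mu]_(x in `]s, t]) `|(gh \_ `[A, B]) x| = \int[mu]_(x in `]s, t]) (`|g x| + h x).
    apply: eq_Rintegral => x; rewrite inE/= in_itv/= => /andP[sx xt].
    rewrite patchE mem_set; last first.
      by rewrite /= in_itv/= (le_trans As (ltW sx)) (le_trans xt).
    by rewrite [LHS]ger0_norm// /gh addr_ge0.
  have intg' := intsub _ _ _ intg As tB.
  have inth' := intsub _ _ _ inth As tB.
  rewrite RintegralD//; last exact: integrable_EFin_norm.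
  have : `|\int[mu]_(x in `]s, t]) g x| <= \int[mu]_(x in `]s, t]) `|g x|.
    exact: le_normr_Rintegral.
  have := Phih _ _ As (ltW st) tB.
  have := GE _ _ As (ltW st) tB.
  have := ler_norm (- \int[mu]_(x in `]s, t]) g x); rewrite normrN.
  lra.
Qed.

End absolutely_continuous.

(** * Piecewise linear prices *)

Definition pos (R : realType) (z : R) : R := Num.max 0 z.

Section pospart.
Variable R : realType.
Implicit Types z u : R.

Lemma pos_of_ge0 z : 0 <= z -> pos z = z. Proof. by move/max_idPr. Qed.
Lemma pos_of_le0 z : z <= 0 -> pos z = 0. Proof. by move/max_idPl. Qed.
Lemma pos_ge0 z : 0 <= pos z. Proof. by rewrite le_max lexx. Qed.
Lemma pos_gez z : z <= pos z. Proof. by rewrite le_max lexx orbT. Qed.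

Lemma pos_incr_le z u : 0 <= u -> 0 <= pos (z + u) - pos z <= u.
Proof.
move=> u0; have [z0|z0] := leP 0 z; first by rewrite !pos_of_ge0; lra.
rewrite (pos_of_le0 (ltW z0)); have [zu|zu] := leP 0 (z + u); first by rewrite pos_of_ge0//; lra.
by rewrite pos_of_le0//; lra.
Qed.

Lemma le_pos z u : z <= u -> pos z <= pos u.
Proof.
move=> zu; have /(pos_incr_le z) : 0 <= u - z by lra.
by rewrite (_ : z + (u - z) = u); [lra|ring].
Qed.

End pospart.

Section hinge.
Variables (R : realType) (N : nat) (f : nat -> R).
Hypothesis f_homo : forall k, f k <= f k.+1.
Implicit Types x y z u : R.

(** If [f 0 = 0], the value at an integer [n <= N] is [f 1 + ... + f n], the total price of [n]
    ranks, and [dhinge] there is the price [f n] of the last rank. Real arguments occur because the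
    excess part of a profile is fractional. *)
Definition hinge x : R := \sum_(k < N) (f k.+1 - f k) * pos (x - k%:R).
Definition dhinge x : R := hinge x - hinge (x - 1).

Let slope_ge0 k : 0 <= f k.+1 - f k. Proof. by rewrite subr_ge0. Qed.

Lemma hinge_ge0 x : 0 <= hinge x.
Proof. by apply: sumr_ge0 => k _; rewrite mulr_ge0// pos_ge0. Qed.

Lemma hinge0 : hinge 0 = 0.
Proof.
by rewrite /hinge big1// => k _; rewrite pos_of_le0 ?mulr0// sub0r oppr_le0.
Qed.

Lemma dhingeE x : dhinge x =
  \sum_(k < N) (f k.+1 - f k) * (pos (x - k%:R) - pos (x - k%:R - 1)).
Proof.
rewrite /dhinge /hinge -sumrB; apply: eq_bigr => k _.
by rewrite -mulrBr (addrAC x (-1)).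
Qed.

(** The difference [pos z - pos (z - 1)] is [z] clamped to the interval from 0 to 1; the next lemmas
    are its cases. *)
Let clamp_le1 z : pos z - pos (z - 1) <= 1.
Proof.
have [z0|z0] := leP z 0; first by rewrite (pos_of_le0 z0) sub0r; have := pos_ge0 (z - 1); lra.
by rewrite (pos_of_ge0 (ltW z0)); have := pos_gez (z - 1); lra.
Qed.

Let clamp_ge0 z : 0 <= pos z - pos (z - 1).
Proof.
have [z0|z0] := leP (z - 1) 0; first by rewrite (pos_of_le0 z0) subr0 pos_ge0.
by rewrite !pos_of_ge0; lra.
Qed.

Let clamp0 z : z <= 0 -> pos z - pos (z - 1) = 0.
Proof. by move=> z0; rewrite !pos_of_le0 ?subrr//; lra. Qed.

Let clamp1 z : 1 <= z -> pos z - pos (z - 1) = 1.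
Proof. by move=> z0; rewrite !pos_of_ge0; lra. Qed.

Let pos_decr z u : 0 <= u ->
  u * (pos (z - u) - pos (z - u - 1)) <= pos z - pos (z - u).
Proof.
move=> u0; have [zu|zu] := leP (z - u) 0.
  by rewrite clamp0// mulr0 (pos_of_le0 zu) subr0 pos_ge0.
by have := clamp_le1 (z - u); rewrite (pos_of_ge0 (ltW zu)) (pos_of_ge0 (z := z)); nra.
Qed.

Let pos_incr z u : 0 <= u ->
  pos (z + u) - pos z <= u * (pos (z + u + 1) - pos (z + u + 1 - 1)).
Proof.
move=> u0; have [zu|zu] := leP (z + u) 0.
  by rewrite (pos_of_le0 zu) sub0r (@le_trans _ _ 0)// ?oppr_le0 ?pos_ge0// mulr_ge0.
by rewrite clamp1; [have := pos_incr_le z u0; lra|lra].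
Qed.

Let pos_decrn z p : 1 <= p ->
  p * (pos (z - p + 1) - pos (z - p + 1 - 1)) <= pos z - pos (z - p).
Proof.
move=> p1; have [zp|zp] := leP (z - p + 1) 0.
  by rewrite clamp0// mulr0 (pos_of_le0 (z := z - p)) ?subr0 ?pos_ge0//; lra.
rewrite (pos_of_ge0 (ltW zp)) addrK (pos_of_ge0 (z := z)); last by lra.
by have [zp'|zp'] := leP 0 (z - p); [rewrite pos_of_ge0|rewrite pos_of_le0 ?(ltW zp')//]; nra.
Qed.

Let pos_incrn z p : 1 <= p ->
  pos (z + p) - pos z <= p * (pos (z + p) - pos (z + p - 1)).
Proof.
move=> p1; have [zp|zp] := leP (z + p) 0.
  by rewrite clamp0// mulr0 (pos_of_le0 zp) sub0r oppr_le0 pos_ge0.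
have [zp'|zp'] := leP 1 (z + p).
  have p0 : 0 <= p by lra.
  by rewrite clamp1// mulr1; have := pos_incr_le z p0; lra.
rewrite (pos_of_ge0 (ltW zp)) (pos_of_le0 (z := z)) ?(pos_of_le0 (z := z + p - 1)); nra.
Qed.

Lemma le_hinge x y : x <= y -> hinge x <= hinge y.
Proof.
move=> xy; apply: ler_sum => k _; apply: ler_wpM2l => //.
have /(pos_incr_le (x - k%:R)) : 0 <= y - x by lra.
by rewrite (_ : x - k%:R + (y - x) = y - k%:R); [lra|ring].
Qed.

Lemma le_dhinge x y : x <= y -> dhinge x <= dhinge y.
Proof.
move=> xy; rewrite !dhingeE; apply: ler_sum => k _; apply: ler_wpM2l => //.
have [x0|x0] := leP (x - k%:R) 0; first by rewrite clamp0.
have [y1|y1] := leP 1 (y - k%:R); first by rewrite (clamp1 y1).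
by rewrite !(pos_of_le0 (z := _ - 1)) ?(pos_of_ge0 (ltW x0)) ?pos_of_ge0; lra.
Qed.

Lemma dhinge_ge0 x : 0 <= dhinge x.
Proof. by rewrite subr_ge0 le_hinge// gerBl. Qed.

Lemma dhinge_le0 x : x <= 0 -> dhinge x = 0.
Proof.
move=> x0; rewrite dhingeE big1// => k _.
by have : 0 <= k%:R :> R; [by []|move=> k0; rewrite clamp0 ?mulr0//; lra].
Qed.

Definition slopes : R := \sum_(k < N) (f k.+1 - f k).

Lemma slopes_ge0 : 0 <= slopes. Proof. exact: sumr_ge0. Qed.

Lemma hinge_lipschitz x y : `|hinge x - hinge y| <= slopes * `|x - y|.
Proof.
wlog xy : x y / y <= x => [H|].
  by have [|/ltW] := leP y x; [exact: H|rewrite distrC (distrC x); exact: H].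
rewrite ger0_norm ?subr_ge0 ?le_hinge// ger0_norm ?subr_ge0// /hinge -sumrB mulr_suml.
apply: ler_sum => k _; rewrite -mulrBr; apply: ler_wpM2l => //.
have /(pos_incr_le (y - k%:R)) : 0 <= x - y by lra.
by rewrite (_ : y - k%:R + (x - y) = x - k%:R); [lra|ring].
Qed.

Lemma dhinge_lipschitz x u : 0 <= u -> dhinge (x + u) <= dhinge x + slopes * u.
Proof.
move=> u0; rewrite !dhingeE mulr_suml -big_split/=; apply: ler_sum => k _.
rewrite -mulrDr; apply: ler_wpM2l => //.
have := pos_incr_le (x - k%:R) u0; have := pos_incr_le (x - k%:R - 1) u0.
rewrite (_ : x - k%:R + u = x + u - k%:R); last by ring.
by rewrite (_ : x - k%:R - 1 + u = x + u - k%:R - 1); [lra|ring].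
Qed.

(** A nonnegative combination of positive parts is convex, so equal steps cost more further to the
    right; checked summand by summand. *)
Lemma hinge_convex x y u : x <= y -> 0 <= u ->
  hinge (x + u) - hinge x <= hinge (y + u) - hinge y.
Proof.
move=> xy u0; rewrite /hinge -!sumrB; apply: ler_sum => k _; rewrite -!mulrBr.
apply: ler_wpM2l => //; rewrite !(addrAC _ u).
have [yk|yk] := leP 0 (y - k%:R).
  by have := pos_incr_le (x - k%:R) u0; rewrite !(pos_of_ge0 (z := y - _)) ?(pos_of_ge0 (z := y - _ + u)); lra.
rewrite (pos_of_le0 (ltW yk)) (pos_of_le0 (z := x - _)) ?subr0; last by lra.
have /(pos_incr_le (x - k%:R + u)) : 0 <= y - x by lra.
by rewrite (_ : x - k%:R + u + (y - x) = y - k%:R + u); [lra|ring].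
Qed.

(** By convexity the unit interval just below [x - u] is no steeper than the interval from [x - u]
    to [x]. [hinge_incr] compares with the unit interval just above instead. *)
Lemma hinge_decr x u : 0 <= u -> u * dhinge (x - u) <= hinge x - hinge (x - u).
Proof.
move=> u0; rewrite dhingeE mulr_sumr /hinge -!sumrB; apply: ler_sum => k _.
rewrite mulrCA -!mulrBr; apply: ler_wpM2l => //; rewrite (addrAC x (- u)).
exact: pos_decr.
Qed.

Lemma hinge_incr x u : 0 <= u -> hinge (x + u) - hinge x <= u * dhinge (x + u + 1).
Proof.
move=> u0; rewrite dhingeE mulr_sumr /hinge -!sumrB; apply: ler_sum => k _.
rewrite [leRHS]mulrCA -!mulrBr; apply: ler_wpM2l => //.
rewrite (_ : x + u + 1 - k%:R = x - k%:R + u + 1); last by ring.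
rewrite (_ : x + u - k%:R = x - k%:R + u); last by ring.
exact: pos_incr.
Qed.

(** An integer step consists of [p] unit intervals, the lowest being the least steep. The price is
    thus read one rank higher than in [hinge_decr]; this unit is what makes the lower bound [m] lose
    [K - 1] and not [K]. *)
Lemma hinge_decrn x (p : nat) : p%:R * dhinge (x - p%:R + 1) <= hinge x - hinge (x - p%:R).
Proof.
case: p => [|p]; first by rewrite mul0r subr0 subrr.
have p1 : 1 <= p.+1%:R :> R by rewrite ler1n.
rewrite dhingeE mulr_sumr /hinge -!sumrB; apply: ler_sum => k _.
rewrite mulrCA -!mulrBr; apply: ler_wpM2l => //.
rewrite (_ : x - p.+1%:R + 1 - k%:R = x - k%:R - p.+1%:R + 1); last by ring.
rewrite (_ : x - p.+1%:R - k%:R = x - k%:R - p.+1%:R); last by ring.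
exact: pos_decrn.
Qed.

Lemma hinge_incrn x (p : nat) : hinge (x + p%:R) - hinge x <= p%:R * dhinge (x + p%:R).
Proof.
case: p => [|p]; first by rewrite mul0r addr0 subrr.
have p1 : 1 <= p.+1%:R :> R by rewrite ler1n.
rewrite dhingeE mulr_sumr /hinge -!sumrB; apply: ler_sum => k _.
rewrite [leRHS]mulrCA -!mulrBr; apply: ler_wpM2l => //.
rewrite (_ : x + p.+1%:R - k%:R = x - k%:R + p.+1%:R); last by ring.
exact: pos_incrn.
Qed.

(** In [dhingeE] the summands below [k] have weight 1 and telescope to [f k], those above [k]
    vanish, and the summand at [k] has weight [x - k]. *)
Lemma dhinge_interpolate x (k : nat) : f 0%N = 0 -> (k < N)%N -> k%:R <= x <= k.+1%:R ->
  dhinge x = (k.+1%:R - x) * f k + (x - k%:R) * f k.+1.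
Proof.
move=> f0 kN /andP[kx xk]; rewrite dhingeE.
rewrite -(big_mkord xpredT (fun i => (f i.+1 - f i) *
  (pos (x - i%:R) - pos (x - i%:R - 1)))).
rewrite (big_cat_nat _ (n := k))//=; last exact: ltnW.
rewrite (big_ltn kN) [X in _ + (_ + X)]big_nat_cond [X in _ + (_ + X)]big1 ?addr0; last first.
  move=> i /andP[/andP[ki _] _].
  have ki' : k.+1%:R <= i%:R :> R by rewrite ler_nat.
  by rewrite clamp0 ?mulr0//; lra.
under eq_big_nat => i /andP[_ ik].
  rewrite clamp1 ?mulr1; last first.
    have : i.+1%:R <= k%:R :> R by rewrite ler_nat.
    by rewrite -natr1; lra.
  over.
rewrite telescope_sumr// f0 subr0 (pos_of_ge0 (z := x - k%:R)); last by lra.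
move: xk; rewrite -natr1 => xk.
by rewrite pos_of_le0; [ring|lra].
Qed.

Lemma dhinge_le_affine (a b c x : R) : f 0%N = 0 -> (forall k, c * f k <= a + b * k%:R) ->
  0 <= x < N%:R -> c * dhinge x <= a + b * x.
Proof.
move=> f0 fab /andP[x0 xN].
have /andP[kx xk] := truncn_itv x0; set k := Num.trunc x in kx xk.
have kN : (k < N)%N by rewrite -(ltr_nat R) (le_lt_trans kx).
rewrite (@dhinge_interpolate _ k)//; last by rewrite kx ltW.
have := fab k; have := fab k.+1; move: xk; rewrite -natr1.
move=> xk H1 H2.
have : (x - k%:R) * (c * f k.+1) <= (x - k%:R) * (a + b * (k%:R + 1)) by apply: ler_wpM2l; lra.
have : (k%:R + 1 - x) * (c * f k) <= (k%:R + 1 - x) * (a + b * k%:R) by apply: ler_wpM2l; lra.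
lra.
Qed.

(** The cap [n] is an integer, so [Num.min x n%:R] is affine between neighbouring integers and the
    bound interpolates. The upper neighbour of [x] is used too, hence [x + 1 <= B]. *)
Lemma dhinge_ge_capped (b c B x : R) (n : nat) : f 0%N = 0 ->
  (forall k : nat, k%:R <= B -> Num.min k%:R n%:R + b * k%:R <= c * f k) ->
  0 <= x < N%:R -> x + 1 <= B -> Num.min x n%:R + b * x <= c * dhinge x.
Proof.
move=> f0 fab /andP[x0 xN] xB.
have /andP[kx xk] := truncn_itv x0; set k := Num.trunc x in kx xk.
have kN : (k < N)%N by rewrite -(ltr_nat R) (le_lt_trans kx).
rewrite (@dhinge_interpolate _ k)//; last by rewrite kx ltW.
move: xk; rewrite -natr1 => xk.
have H1 : Num.min k%:R n%:R + b * k%:R <= c * f k by apply: fab; lra.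
have H2 : Num.min (k%:R + 1) n%:R + b * (k%:R + 1) <= c * f k.+1.
  by rewrite natr1; apply: fab; rewrite -natr1; lra.
have H3 : Num.min x n%:R <= (k%:R + 1 - x) * Num.min k%:R n%:R + (x - k%:R) * Num.min (k%:R + 1) n%:R.
  have [nk|kn] := leqP n k.
    have nk' : n%:R <= k%:R :> R by rewrite ler_nat.
    by rewrite !(min_idPr _); lra.
  have nk' : k%:R + 1 <= n%:R :> R by rewrite natr1 ler_nat.
  by rewrite !(min_idPl _); lra.
have : (x - k%:R) * (Num.min (k%:R + 1) n%:R + b * (k%:R + 1)) <= (x - k%:R) * (c * f k.+1).
  by apply: ler_wpM2l; lra.
have : (k%:R + 1 - x) * (Num.min k%:R n%:R + b * k%:R) <= (k%:R + 1 - x) * (c * f k).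
  by apply: ler_wpM2l; lra.
lra.
Qed.

End hinge.

(** * Power inequalities behind the prices *)

Section power.
Variable R : realType.
Implicit Types alpha beta lam s z : R.

Lemma powR_young alpha s z : 1 < alpha -> 0 <= s -> 0 <= z ->
  alpha * s * z `^ (1 - alpha^-1) <= s `^ alpha + (alpha - 1) * z.
Proof.
move=> a1 s0 z0.
have a0 : 0 < alpha by lra.
have am0 : 0 < alpha - 1 by lra.
have := @conjugate_powR R s (z `^ (1 - alpha^-1)) alpha (alpha / (alpha - 1)) s0 (powR_ge0 _ _).
move=> /(_ a0); rewrite divr_gt0// => /(_ isT).
have -> : alpha^-1 + (alpha / (alpha - 1))^-1 = 1 by field; lra.
move=> /(_ erefl); rewrite -powRrM.
have -> : (1 - alpha^-1) * (alpha / (alpha - 1)) = 1 by field; lra.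
rewrite powRr1// => H.
have -> : s `^ alpha + (alpha - 1) * z = alpha * (s `^ alpha / alpha + z / (alpha / (alpha - 1))).
  by field; lra.
by rewrite -mulrA ler_pM2l.
Qed.

Lemma powR_bernoulli alpha s : 1 < alpha -> 0 <= s -> 1 + alpha * (s - 1) <= s `^ alpha.
Proof.
move=> a1 s0; have := powR_young a1 s0 ler01.
by rewrite powR1; lra.
Qed.

(** Bernoulli's inequality suffices up to 2; beyond, it is applied to the exponent [alpha / 2] and
    squared, and [(1 + alpha / 4) ^ 2 >= alpha]. *)
Lemma powR_three_halves alpha : 1 < alpha -> alpha <= (3 / 2) `^ alpha.
Proof.
move=> a1; have [a2|a2] := leP alpha 2.
  have := @powR_bernoulli alpha (3 / 2) a1; rewrite divr_ge0// => /(_ isT); lra.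
have -> : alpha = (alpha / 2) * 2 by field.
rewrite powRrM -[X in _ <= _ `^ X]/(2%:R) powR_mulrn ?powR_ge0//.
have a21 : 1 < alpha / 2 by lra.
have := @powR_bernoulli (alpha / 2) (3 / 2) a21; rewrite divr_ge0// => /(_ isT).
set X := _ `^ _ => H.
have HX : (1 + alpha / 4) * (1 + alpha / 4) <= X * X by apply: ler_pM; lra.
by have := sqr_ge0 (1 - alpha / 4); rewrite !expr2; lra.
Qed.

(* The price bounds for the optimum and for the algorithm are both affine in the
   rank [k] with the same slope, so the two contributions of a rank cancel. *)
Lemma opt_price alpha beta (K k : nat) s : 1 < alpha -> 1 <= beta -> (0 < K)%N -> 0 <= s ->
  alpha * K%:R `^ (- (1 - alpha^-1)) * s * k%:R `^ (1 - alpha^-1) <=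
  beta * s `^ alpha + (alpha - 1) * beta `^ (- alpha^-1) / K%:R * k%:R.
Proof.
move=> a1 b1 K0 s0.
have a0 : 0 < alpha by lra.
have b0 : 0 < beta by lra.
have K0' : 0 < K%:R :> R by rewrite ltr0n.
set lam := beta `^ (- alpha^-1).
have lam0 : 0 < lam by exact: powR_gt0.
have lam1 : lam <= 1.
  rewrite -(powRr0 beta); apply: ler_powR => //; rewrite oppr_le0 invr_ge0; lra.
have lamE : lam `^ alpha = beta^-1.
  by rewrite -powRrM mulNr mulVf ?gt_eqF// powR_inv1// ltW.
(* Young's inequality is used at [s / lam] and multiplied by [lam]: since [lam ^ alpha] is the
   inverse of [beta], the power term receives [lam * beta <= beta] and the rank term the small
   factor [lam]. *)
have sl : 0 <= s / lam by rewrite divr_ge0// ltW.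
have kK : 0 <= k%:R / K%:R :> R by rewrite divr_ge0.
have := powR_young a1 sl kK.
have -> : (s / lam) `^ alpha = s `^ alpha * beta.
  by rewrite powRM ?invr_ge0 ?(ltW lam0)// -(powR_inv1 (ltW lam0)) powRAC lamE powR_inv1 ?invrK// invr_ge0 ltW.
have -> : (k%:R / K%:R) `^ (1 - alpha^-1) =
    k%:R `^ (1 - alpha^-1) * K%:R `^ (- (1 - alpha^-1)) :> R.
  by rewrite powRM ?invr_ge0// -(powR_inv1 (ltW K0')) -powRrM mulN1r.
move=> H.
set X := K%:R `^ _ in H *; set Y := k%:R `^ _ in H *.
have : lam * (alpha * (s / lam) * (Y * X)) <= lam * (s `^ alpha * beta + (alpha - 1) * (k%:R / K%:R)).
  by rewrite ler_pM2l.
have -> : lam * (alpha * (s / lam) * (Y * X)) = alpha * X * s * Y by field; rewrite gt_eqF.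
move=> /le_trans; apply.
have : lam * (s `^ alpha * beta) <= s `^ alpha * beta.
  by apply: ler_piMl => //; rewrite mulr_ge0 ?powR_ge0// ltW.
rewrite mulrDr; set Z := s `^ alpha * beta; rewrite (_ : beta * _ = Z) 1?mulrC//.
rewrite (_ : lam * ((alpha - 1) * _) = (alpha - 1) * lam / K%:R * k%:R) ?lerD2r//.
by field; rewrite gt_eqF.
Qed.

(** The right side is [alpha] copies of a weighted geometric mean of [n + 1] and [k]. One copy is at
    least their minimum; the other [alpha - 1] copies are each at least [lam * k], because
    [n + 1 >= k / beta]. *)
Lemma alg_price alpha beta (n k : nat) : 1 < alpha -> 1 <= beta ->
  k%:R <= beta * n.+1%:R ->
  Num.min k%:R n.+1%:R + (alpha - 1) * beta `^ (- alpha^-1) * k%:R <=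
  alpha * n.+1%:R `^ alpha^-1 * k%:R `^ (1 - alpha^-1) :> R.
Proof.
move=> a1 b1 kn.
have a0 : 0 < alpha by lra.
have ai0 : 0 < alpha^-1 by rewrite invr_gt0.
have ai1 : alpha^-1 < 1 by rewrite invf_lt1.
have b0 : 0 < beta by lra.
set lam := beta `^ (- alpha^-1).
have [->|k0] := posnP k.
  by rewrite (min_idPl _)// mulr0 add0r powR0 ?mulr0// subr_eq0 gt_eqF.
have k0' : 0 < k%:R :> R by rewrite ltr0n.
have split_pow (x : R) : 0 < x -> x = x `^ alpha^-1 * x `^ (1 - alpha^-1).
  move=> x0; rewrite -powRD; first by rewrite subrKC powRr1// ltW.
  by rewrite (gt_eqF x0) implybT.
set X := n.+1%:R `^ alpha^-1 * k%:R `^ (1 - alpha^-1).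
suff : Num.min k%:R n.+1%:R <= X /\ lam * k%:R <= X.
  move=> [H1 H2]; rewrite -!mulrA -/X.
  have : (alpha - 1) * (lam * k%:R) <= (alpha - 1) * X by apply: ler_wpM2l => //; lra.
  by lra.
split; last first.
  rewrite {1}(split_pow _ k0') mulrA; apply: ler_wpM2r; first exact: powR_ge0.
  have -> : lam = beta^-1 `^ alpha^-1 by rewrite -(powR_inv1 (ltW b0)) -powRrM mulN1r.
  rewrite -powRM ?invr_ge0 ?(ltW b0)//; apply: ge0_ler_powR; rewrite ?nnegrE ?(ltW ai0)//.
    by rewrite mulr_ge0 ?invr_ge0 ?(ltW b0).
  by rewrite mulrC ler_pdivrMr// mulrC.
have [nk|nk] := leP k%:R (n.+1%:R : R).
  rewrite {1}(split_pow _ k0'); apply: ler_wpM2r; first exact: powR_ge0.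
  by apply: ge0_ler_powR; rewrite ?nnegrE ?(ltW ai0).
rewrite {1}(split_pow n.+1%:R)//; apply: ler_wpM2l; first exact: powR_ge0.
by apply: ge0_ler_powR; rewrite ?nnegrE ?subr_ge0 ?(ltW ai1) ?(ltW nk).
Qed.

End power.

Section Rintegral_sum.
Variable R : realType.
Local Notation mu := (@lebesgue_measure R).

Lemma Rintegral_sum (D : set R) (J : Type) (s : seq J) (F : J -> R -> R) : measurable D ->
  (forall i, mu.-integrable D (EFin \o F i)) ->
  \int[mu]_(x in D) (\sum_(i <- s) F i x) = \sum_(i <- s) \int[mu]_(x in D) F i x.
Proof.
move=> mD intF; elim: s => [|i s IH].
  rewrite big_nil; under eq_Rintegral do rewrite big_nil.
  by rewrite /Rintegral integral0.
rewrite big_cons; under eq_Rintegral do rewrite big_cons.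
by rewrite RintegralD// ?IH//; exact: integrable_EFin_sum.
Qed.

End Rintegral_sum.

(** * The potential of two work vectors *)

Section potential.
Variables (R : realType) (n N : nat) (f : nat -> R) (wr : R).
Hypothesis f_homo : forall k, f k <= f k.+1.
Hypothesis wr_gt0 : 0 < wr.
Local Notation mu := (@lebesgue_measure R).
Implicit Types (q z : R) (x y : 'I_n -> R).

(* A task with remaining work [z] counts fully at each level [q <= z], and its
   excess over [wr] is spread uniformly over all the levels of [`]0, wr]]. *)
Definition level q z : R := (q <= z)%R%:R + pos (z - wr) / wr.

Definition profile y x q : R := \sum_j (level q (y j) - level q (x j)).

Definition Psi y x : R := \int[mu]_(q in `]0, wr]) hinge N f (profile y x q).

Lemma measurable_level z : measurable_fun setT (level ^~ z).
Proof.
apply: measurable_funD => //.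
have -> : (fun q => (q <= z)%R%:R : R) = \1_(`]-oo, z]).
  by apply/funext => q; rewrite indicE mem_setE in_itv.
exact: measurable_indic.
Qed.

Lemma level_bounded q z : `|level q z| <= 1 + pos (z - wr) / wr.
Proof.
have p0 : 0 <= pos (z - wr) / wr by rewrite divr_ge0 ?pos_ge0// ltW.
rewrite ger0_norm; last by rewrite addr_ge0.
by rewrite lerD2r; case: (q <= z).
Qed.

Lemma integrable_oc_bounded (g : R -> R) c : measurable_fun setT g -> (forall q, `|g q| <= c) ->
  mu.-integrable `]0, wr] (EFin \o g).
Proof.
move=> mg gc; have H := integrable_bounded 0 wr mg gc.
by apply: integrableS H => //; apply: subset_itv; rewrite bnd_simp.
Qed.

Lemma integrable_level z : mu.-integrable `]0, wr] (EFin \o (level ^~ z)).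
Proof. exact: integrable_oc_bounded (measurable_level z) (level_bounded ^~ z). Qed.

Lemma measurable_profile y x : measurable_fun setT (profile y x).
Proof.
apply: measurable_sum => j.
by apply: measurable_funB; exact: measurable_level.
Qed.

Lemma measurable_hinge : measurable_fun setT (hinge N f : R -> R).
Proof.
apply: measurable_sum => k; apply: measurable_funM => //.
by apply: measurable_maxr => //; apply: measurable_funB.
Qed.

Lemma integrable_hinge_profile y x :
  mu.-integrable `]0, wr] (EFin \o (fun q => hinge N f (profile y x q))).
Proof.
apply: (@integrable_oc_bounded _ (slopes N f *
   \sum_j ((1 + pos (y j - wr) / wr) + (1 + pos (x j - wr) / wr)))).
  exact: measurableT_comp measurable_hinge (measurable_profile y x).
move=> q; have := hinge_lipschitz N f_homo (profile y x q) 0.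
rewrite hinge0 !subr0 => /le_trans; apply; apply: ler_wpM2l; first exact: slopes_ge0.
apply: le_trans (ler_norm_sum _ _ _) _; apply: ler_sum => j _.
by apply: le_trans (ler_normB _ _) _; apply: lerD; exact: level_bounded.
Qed.

(** The indicator integrates to [Num.min z wr] and the constant part to [pos (z - wr)]. Hence
    differences of levels integrate to the amount of work done. *)
Lemma Rintegral_level z : 0 <= z -> \int[mu]_(q in `]0, wr]) level q z = z.
Proof.
move=> z0.
have int1 : mu.-integrable `]0, wr] (EFin \o (fun q => (q <= z)%R%:R : R)).
  apply: (@integrable_oc_bounded _ 1).
    have -> : (fun q => (q <= z)%R%:R : R) = \1_(`]-oo, z]).
      by apply/funext => q; rewrite indicE mem_setE in_itv.
    exact: measurable_indic.
  by move=> q; case: (q <= z); rewrite ?normr1 ?normr0.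
have intc : mu.-integrable `]0, wr] (EFin \o (fun q => pos (z - wr) / wr)).
  exact: (@integrable_oc_bounded _ `|pos (z - wr) / wr|).
rewrite RintegralD// Rintegral_cst_oc ?(ltW wr_gt0)// subr0 divfK ?gt_eqF//.
have -> : \int[mu]_(q in `]0, wr]) (q <= z)%R%:R = Num.min z wr.
  have -> : \int[mu]_(q in `]0, wr]) (q <= z)%R%:R =
            \int[mu]_(q in `]0, Num.min z wr]) (1 : R).
    have -> : `]0, Num.min z wr] = `]0, wr] `&` `]-oo, z] :> set R.
      apply/seteqP; split => q /=; rewrite !in_itv/= le_min.
        by move=> /andP[-> /andP[-> ->]].
      by move=> [/andP[-> ->] ->].
    rewrite Rintegral_mkcondr; apply: eq_Rintegral => q _.
    by rewrite patchE mem_setE in_itv/=; case: (q <= z).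
  rewrite Rintegral_cst_oc; first by rewrite mul1r subr0.
  by rewrite le_min z0 ltW.
have [zw|zw] := leP z wr; [rewrite pos_of_le0; lra|rewrite pos_of_ge0; lra].
Qed.

Lemma le_level q z z' : z <= z' -> level q z <= level q z'.
Proof.
move=> zz'; apply: lerD.
  by have [/le_trans->|] := leP q z.
by rewrite ler_pM2r ?invr_gt0// le_pos// lerD2r.
Qed.

Lemma le_profile y y' x x' q : (forall j, y' j <= y j) -> (forall j, x j <= x' j) ->
  profile y' x' q <= profile y x q.
Proof. by move=> yy' xx'; apply: ler_sum => j _; apply: lerB; exact: le_level. Qed.

Lemma Psi_ge0 y x : 0 <= Psi y x.
Proof. by apply: Rintegral_ge0 => q _; exact: hinge_ge0. Qed.

Lemma le_Psi y y' x : (forall j, y' j <= y j) -> Psi y' x <= Psi y x.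
Proof.
move=> yy'; apply: le_Rintegral => //; try exact: integrable_hinge_profile.
by move=> q _; apply: le_hinge => //; exact: le_profile.
Qed.

Lemma Psi_diag y : Psi y y = 0.
Proof.
rewrite /Psi (_ : (fun q => _) = cst 0); first by rewrite /Rintegral integral0.
apply/funext => q; rewrite /profile big1 ?hinge0// => j _.
by rewrite subrr.
Qed.

(** Moving [x] to [x'] shifts both profiles by the same nonnegative amount, and by convexity the
    shift is cheaper at the lower profile. So the competitor's move may be priced as if the
    algorithm had not moved. *)
Lemma Psi_submodular y y' x x' :
  (forall j, y' j <= y j) -> (forall j, x' j <= x j) ->
  Psi y' x' - Psi y' x <= Psi y x' - Psi y x.
Proof.
move=> yy' xx'; have int := integrable_hinge_profile.
rewrite /Psi -!RintegralB//; apply: le_Rintegral => //.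
- rewrite (_ : _ \o _ = EFin \o (fun q => hinge N f (profile y' x' q) + (-1) * hinge N f (profile y' x q))).
    by apply: integrable_EFinD => //; exact: integrable_EFinZ.
  by apply/funext => q /=; rewrite mulN1r.
- rewrite (_ : _ \o _ = EFin \o (fun q => hinge N f (profile y x' q) + (-1) * hinge N f (profile y x q))).
    by apply: integrable_EFinD => //; exact: integrable_EFinZ.
  by apply/funext => q /=; rewrite mulN1r.
move=> q _.
pose h := \sum_j (level q (x j) - level q (x' j)).
have E (z : 'I_n -> R) : profile z x' q = profile z x q + h.
  by rewrite /profile /h -big_split; apply: eq_bigr => j _ /=; ring.
rewrite !E; apply: hinge_convex => //; first exact: le_profile.
by apply: sumr_ge0 => j _; rewrite subr_ge0 le_level.
Qed.

Let sum_level y y' : (forall j, 0 <= y j) -> (forall j, 0 <= y' j) ->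
  \int[mu]_(q in `]0, wr]) (\sum_j (level q (y j) - level q (y' j))) = \sum_j (y j - y' j).
Proof.
move=> y0 y'0; rewrite Rintegral_sum//.
  apply: eq_bigr => j _; rewrite RintegralB//; try exact: integrable_level.
  by rewrite !Rintegral_level.
move=> j; rewrite (_ : _ \o _ = EFin \o (fun q => level q (y j) + (-1) * level q (y' j))).
  apply: integrable_EFinD => //; first exact: integrable_level.
  by apply: integrable_EFinZ => //; exact: integrable_level.
by apply/funext => q /=; rewrite mulN1r.
Qed.

Let integrable_sum_level y y' :
  mu.-integrable `]0, wr] (EFin \o (fun q => \sum_j (level q (y j) - level q (y' j)))).
Proof.
apply: integrable_EFin_sum => // j.
rewrite (_ : _ \o _ = EFin \o (fun q => level q (y j) + (-1) * level q (y' j))).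
  apply: integrable_EFinD => //; first exact: integrable_level.
  by apply: integrable_EFinZ => //; exact: integrable_level.
by apply/funext => q /=; rewrite mulN1r.
Qed.

(** A single price [c] valid on all levels turns the integral over the levels into [c] times the
    work between [z'] and [z]. *)
Let Psi_bound y x y' x' (z z' : 'I_n -> R) c : (forall j, 0 <= z j) -> (forall j, 0 <= z' j) ->
  (forall q, 0 < q <= wr -> hinge N f (profile y x q) - hinge N f (profile y' x' q) <=
     c * \sum_j (level q (z j) - level q (z' j))) ->
  Psi y x - Psi y' x' <= c * \sum_j (z j - z' j).
Proof.
move=> z0 z'0 H; rewrite -sum_level// -RintegralZl// -RintegralB//; try exact: integrable_hinge_profile.
apply: le_Rintegral => //.
- rewrite (_ : _ \o _ = EFin \o (fun q => hinge N f (profile y x q) + (-1) * hinge N f (profile y' x' q))).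
    apply: integrable_EFinD => //; first exact: integrable_hinge_profile.
    by apply: integrable_EFinZ => //; exact: integrable_hinge_profile.
  by apply/funext => q /=; rewrite mulN1r.
- by apply: integrable_EFinZ => //; exact: integrable_sum_level.
Qed.

(** The drop of a level splits into the integer [crossings], the tasks passing [q], and [excess],
    which is the same on all levels. [excess] is also applied to the algorithm against the
    competitor, where it may be negative. *)
Definition crossings y y' q : nat := \sum_j ((y' j < q) && (q <= y j))%R.
Definition excess y y' : R := \sum_j (pos (y j - wr) - pos (y' j - wr)) / wr.

Lemma excess_ge0 y y' : (forall j, y' j <= y j) -> 0 <= excess y y'.
Proof.
move=> yy'; apply: sumr_ge0 => j _.
by rewrite mulr_ge0 ?invr_ge0 ?(ltW wr_gt0)// subr_ge0 le_pos// lerD2r.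
Qed.

Lemma sum_level_split y y' q : (forall j, y' j <= y j) ->
  \sum_j (level q (y j) - level q (y' j)) = (crossings y y' q)%:R + excess y y'.
Proof.
move=> yy'; rewrite /crossings /excess natr_sum -big_split/=; apply: eq_bigr => j _.
rewrite /level mulrBl.
have -> : (q <= y j)%R%:R = ((y' j < q) && (q <= y j))%R%:R + (q <= y' j)%R%:R :> R.
  have [qy'|qy'] := leP q (y' j); first by rewrite (le_trans qy')//= add0r.
  by rewrite addr0.
by ring.
Qed.

(** The profile falls by the real excess and then by the integer number of crossings, priced by
    [hinge_decr] and [hinge_decrn]. The bound [m] is demanded only where the corresponding part of
    the fall is nonzero, that is, where a task that loses work is at hand. *)
Lemma Psi_alg_step y y' x m : (forall j, 0 <= y' j <= y j) ->
  (forall q, 0 < q <= wr -> (0 < crossings y y' q)%N ->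
     m <= profile y x q - (crossings y y' q)%:R + 1) ->
  (0 < excess y y' -> forall q, 0 < q <= wr -> m <= profile y x q) ->
  Psi y' x - Psi y x <= - dhinge N f (m - excess y y') * \sum_j (y j - y' j).
Proof.
move=> yy' mcross mexc.
have y'0 j : 0 <= y' j by have /andP[] := yy' j.
have y'y j : y' j <= y j by have /andP[] := yy' j.
have y0 j : 0 <= y j by exact: le_trans (y'y j).
apply: Psi_bound => // q qwr; rewrite sum_level_split//.
set u := excess y y'; set p := crossings y y' q; set D := profile y x q.
have u0 : 0 <= u by exact: excess_ge0.
have -> : profile y' x q = D - u - p%:R.
  rewrite -addrA -opprD (addrC u) -sum_level_split// /D /profile -sumrB.
  by apply: eq_bigr => j _; ring.
have H1 : u * dhinge N f (m - u) <= hinge N f D - hinge N f (D - u).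
  have [->|u_gt0] := eqVneq u 0; first by rewrite mul0r !subr0 subrr.
  apply: le_trans (hinge_decr N f_homo D u0); apply: ler_wpM2l => //.
  apply: le_dhinge => //; rewrite lerD2r; apply: mexc => //.
  by rewrite lt_neqAle eq_sym u_gt0.
have H2 : p%:R * dhinge N f (m - u) <= hinge N f (D - u) - hinge N f (D - u - p%:R).
  have [->|p_gt0] := posnP p; first by rewrite mul0r !subr0 subrr.
  apply: le_trans (hinge_decrn N f_homo (D - u) p); apply: ler_wpM2l => //.
  apply: le_dhinge => //; have := mcross q qwr p_gt0; rewrite -/D -/p; lra.
by lra.
Qed.

(** The mirror image for a rising profile. The fractional part is priced one rank above its end, so
    it needs room for a unit below [M]. *)
Lemma Psi_opt_step y x x' M : (forall j, 0 <= x' j <= x j) ->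
  (forall q, 0 < q <= wr -> profile y x q + (crossings x x' q)%:R <= M) ->
  (0 < excess x x' -> forall q, 0 < q <= wr -> profile y x q + 1 <= M) ->
  Psi y x' - Psi y x <= dhinge N f (M + excess x x') * \sum_j (x j - x' j).
Proof.
move=> xx' Mcross Mexc.
have x'0 j : 0 <= x' j by have /andP[] := xx' j.
have x'x j : x' j <= x j by have /andP[] := xx' j.
have x0 j : 0 <= x j by exact: le_trans (x'x j).
apply: Psi_bound => // q qwr; rewrite sum_level_split//.
set u := excess x x'; set p := crossings x x' q; set D := profile y x q.
have u0 : 0 <= u by exact: excess_ge0.
have -> : profile y x' q = D + u + p%:R.
  rewrite -addrA (addrC u) -sum_level_split// /D /profile -big_split.
  by apply: eq_bigr => j _ /=; ring.
have H1 : hinge N f (D + u) - hinge N f D <= u * dhinge N f (M + u).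
  have [->|u_gt0] := eqVneq u 0; first by rewrite mul0r !addr0 subrr.
  apply: le_trans (hinge_incr N f_homo D u0) _; apply: ler_wpM2l => //.
  apply: le_dhinge => //; rewrite addrAC lerD2r; apply: Mexc => //.
  by rewrite lt_neqAle eq_sym u_gt0.
have H2 : hinge N f (D + u + p%:R) - hinge N f (D + u) <= p%:R * dhinge N f (M + u).
  apply: le_trans (hinge_incrn N f_homo (D + u) p) _; apply: ler_wpM2l => //.
  by apply: le_dhinge => //; have := Mcross q qwr; rewrite -/D -/p; lra.
by lra.
Qed.

(** Levels are monotone, so the distance of two levels is the level of the maximum minus that of the
    minimum and integrates to the distance of the works; [hinge] itself is Lipschitz. *)
Lemma Psi_lipschitz y x y' x' :
  (forall j, 0 <= y j) -> (forall j, 0 <= y' j) -> (forall j, 0 <= x j) -> (forall j, 0 <= x' j) ->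
  Psi y x - Psi y' x' <= slopes N f * \sum_j (`|y j - y' j| + `|x j - x' j|).
Proof.
move=> y0 y'0 x0 x'0.
pose hi (a b : 'I_n -> R) j := Num.max (a j) (b j).
pose lo (a b : 'I_n -> R) j := Num.min (a j) (b j).
have hi0 (a b : 'I_n -> R) : (forall j, 0 <= a j) -> (forall j, 0 <= b j) -> forall j, 0 <= hi a b j.
  by move=> a0 b0 j; rewrite le_max a0.
have lo0 (a b : 'I_n -> R) : (forall j, 0 <= a j) -> (forall j, 0 <= b j) -> forall j, 0 <= lo a b j.
  by move=> a0 b0 j; rewrite le_min a0 b0.
have hilo (a b : 'I_n -> R) j : hi a b j - lo a b j = `|a j - b j|.
  rewrite /hi /lo; have [ab|ab] := leP (a j) (b j).
    by rewrite ler0_norm ?opprB// subr_le0.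
  by rewrite ger0_norm// subr_ge0 ltW.
have levhilo (a b : 'I_n -> R) q j :
    `|level q (a j) - level q (b j)| = level q (hi a b j) - level q (lo a b j).
  rewrite /hi /lo; have [ab|ab] := leP (a j) (b j).
    by rewrite ler0_norm ?opprB// subr_le0 le_level.
  by rewrite ger0_norm// subr_ge0 le_level// ltW.
have -> : \sum_j (`|y j - y' j| + `|x j - x' j|) =
    \sum_j (hi y y' j - lo y y' j) + \sum_j (hi x x' j - lo x x' j).
  by rewrite -big_split; apply: eq_bigr => j _ /=; rewrite !hilo.
rewrite -!sum_level//; try exact: hi0; try exact: lo0.
rewrite -RintegralD//; try exact: integrable_sum_level.
rewrite -RintegralZl//; last by apply: integrable_EFinD => //; exact: integrable_sum_level.
rewrite -RintegralB//; try exact: integrable_hinge_profile.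
apply: le_Rintegral => //.
- rewrite (_ : _ \o _ = EFin \o (fun q => hinge N f (profile y x q) + (-1) * hinge N f (profile y' x' q))).
    apply: integrable_EFinD => //; first exact: integrable_hinge_profile.
    by apply: integrable_EFinZ => //; exact: integrable_hinge_profile.
  by apply/funext => q /=; rewrite mulN1r.
- by apply: integrable_EFinZ => //; apply: integrable_EFinD => //; exact: integrable_sum_level.
move=> q _; apply: le_trans (ler_norm _) _.
apply: le_trans (hinge_lipschitz N f_homo _ _) _.
apply: ler_wpM2l; first exact: slopes_ge0.
rewrite /profile -sumrB -big_split/=.
apply: le_trans (ler_norm_sum _ _ _) _; apply: ler_sum => j _; rewrite -!levhilo.
rewrite [leRHS]addrC (distrC (level q (x j))).
rewrite (_ : _ - _ - _ = (level q (x' j) - level q (x j)) + (level q (y j) - level q (y' j))).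
  exact: ler_normD.
by ring.
Qed.

End potential.

(** * Remaining work under a feasible schedule *)

Lemma ex_common_eta (R : realType) n (P : 'I_n -> R -> Prop) :
  (forall j, exists2 eta : R, 0 < eta & forall d, 0 < d < eta -> P j d) ->
  exists2 eta : R, 0 < eta & forall d, 0 < d < eta -> forall j, P j d.
Proof.
move=> H.
have [eta eta0 Heta] : exists2 eta : R, 0 < eta & forall d, 0 < d < eta ->
    forall j, j \in enum 'I_n -> P j d.
  elim: (enum 'I_n) => [|j s [eta eta0 IH]]; first by exists 1.
  have [eta' eta'0 H'] := H j.
  exists (Num.min eta eta'); first by rewrite lt_min eta0.
  move=> d; rewrite lt_min => /and3P[d0 d1 d2] i.
  rewrite inE => /orP[/eqP->|]; first by apply: H'; rewrite d0.
  by apply: IH; rewrite d0.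
by exists eta => // d /Heta Hd j; apply: Hd; rewrite mem_enum.
Qed.

Section schedule.
Variables (R : realType) (I : instance R) (K : nat) (S : schedule I K) (A : R).
Local Notation mu := (@lebesgue_measure R).
Local Notation task := 'I_(nT I).
Implicit Types (j : task) (t : R).

Definition rate j t : R := \sum_(k < K) (if assign S t k == Some j then speed S t k else 0).
Definition done j t : R := \int[mu]_(x in `[A, t]) rate j x.
(** Truncated at 0 because a feasible schedule may go on serving a finished task. *)
Definition remw j t : R := pos (wsz j - done j t).

Hypothesis feasS : feasible S.
Hypothesis A_le_rel : forall i : 'I_(nJ I), A <= Defs.rel i.
Hypothesis int_rate : forall j T, mu.-integrable `[A, T] (EFin \o rate j).

Lemma rate_ge0 j t : 0 <= rate j t.
Proof. by apply: sumr_ge0 => k _; case: ifP => // _; case: feasS. Qed.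

Lemma rate_gt0_processed j t : rate j t != 0 -> processed S j t.
Proof.
apply: contraNP => np; apply/eqP; apply: big1 => k _; case: ifP => // /eqP Hk.
by case: np; exists k.
Qed.

Lemma processed_released j t : processed S j t -> released j t.
Proof. by move=> [k Hk]; case: feasS => _ [_ [_ [_ /(_ _ _ _ Hk)[]]]]. Qed.

(** A feasible schedule does not serve a task before its release, so the integral may start at the
    common time [A]. *)
Lemma workE j t : work S j t = (done j t)%:E.
Proof.
rewrite /work /done /Rintegral fineK; last by apply: integrable_fin_num => //; exact: int_rate.
have -> : `[Defs.rel (job j), t] = `[A, t] `&` `[Defs.rel (job j), +oo[ :> set R.
  apply/seteqP; split=> x /=; rewrite !in_itv/= ?andbT.
    by move=> /andP[rx ->]; rewrite rx (le_trans _ rx).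
  by move=> [/andP[_ ->] ->].
rewrite integral_mkcondr; apply: eq_integral => x _; rewrite patchE.
case: ifPn => // xr; congr EFin; apply/esym/eqP; apply: contraNT xr => /rate_gt0_processed.
by move=> /processed_released; rewrite mem_setE in_itv/= andbT.
Qed.

Lemma finishedE j t : finished S j t <-> remw j t = 0.
Proof.
rewrite /finished workE lee_fin /remw; split=> [wd|H]; first by rewrite pos_of_le0// subr_le0.
by have := pos_gez (wsz j - done j t); rewrite H subr_le0.
Qed.

Lemma remw_ge0 j t : 0 <= remw j t. Proof. exact: pos_ge0. Qed.

Lemma unfinishedE j t : unfinished S j t = (Defs.rel (job j) <= t) && (0 < remw j t).
Proof.
apply/asboolP/andP => [[r nf]|[r nf]]; split=> //.
  by rewrite lt_neqAle remw_ge0 andbT eq_sym; apply/eqP => /finishedE.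
by move=> /finishedE H; rewrite H ltxx in nf.
Qed.

Lemma remainingE j t : unfinished S j t -> remaining S j t = (remw j t)%:E.
Proof.
rewrite unfinishedE => /andP[_ r0]; rewrite /remaining workE -EFinB /remw pos_of_ge0//.
by rewrite leNgt; apply/negP => H; move: r0; rewrite /remw pos_of_le0 ?ltxx// ltW.
Qed.

Lemma doneB j a b : A <= a -> a <= b -> done j b - done j a = \int[mu]_(x in `]a, b]) rate j x.
Proof. by move=> Aa ab; apply: (Rintegral_oc (int_rate j b)). Qed.

Lemma done0 j t : (forall x, A <= x <= t -> rate j x = 0) -> done j t = 0.
Proof.
move=> H; rewrite /done (@eq_Rintegral _ _ _ _ _ (cst 0)); first by rewrite /Rintegral integral0.
by move=> x; rewrite inE/= in_itv/= => /H.
Qed.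

Lemma le_done j a b : A <= a -> a <= b -> done j a <= done j b.
Proof.
by move=> Aa ab; rewrite -subr_ge0 doneB//; apply: Rintegral_ge0 => x _; exact: rate_ge0.
Qed.

Lemma le_remw j a b : A <= a -> a <= b -> remw j b <= remw j a.
Proof. by move=> Aa ab; apply: le_pos; rewrite lerD2l lerN2 le_done. Qed.

Lemma remw_unreleased j t : 0 < wsz j -> t < Defs.rel (job j) -> remw j t = wsz j.
Proof.
move=> w0 tr; rewrite /remw done0 ?subr0 ?pos_of_ge0 ?(ltW w0)// => x /andP[_ xt].
apply/eqP; apply/negPn/negP => /rate_gt0_processed/processed_released.
by rewrite /released leNgt (le_lt_trans xt).
Qed.

Lemma remw_le j t : 0 < wsz j -> remw j t <= wsz j.
Proof.
move=> w0; have H : pos (wsz j) = wsz j by rewrite pos_of_ge0// ltW.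
rewrite -[leRHS]H; apply: le_pos; rewrite gerBl.
by apply: Rintegral_ge0 => x _; exact: rate_ge0.
Qed.

Lemma finished_le j a b : A <= a -> a <= b -> finished S j a -> finished S j b.
Proof.
move=> Aa ab /finishedE H; apply/finishedE/eqP.
by rewrite eq_le remw_ge0 andbT -H le_remw.
Qed.

(** Any earlier service would have required the task to be free, and freedom persists because
    finished map tasks stay finished. So a caged task is untouched. *)
Lemma remw_caged j t : 0 < wsz j -> A <= t -> ~ Defs.free S j t -> remw j t = wsz j.
Proof.
move=> w0 At nf; rewrite /remw done0 ?subr0 ?pos_of_ge0 ?(ltW w0)// => x /andP[Ax xt].
apply/eqP; apply/negPn/negP => /rate_gt0_processed[k Hk].
case: feasS => _ [_ [_ [_ /(_ _ _ _ Hk)[_ fr]]]]; apply: nf.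
by case: fr => [|H]; [left|right => j' jj' mj'; apply: finished_le (H j' jj' mj')].
Qed.

Lemma dist_remw_le j a b : A <= a -> a <= b ->
  `|remw j b - remw j a| <= \int[mu]_(x in `]a, b]) rate j x.
Proof.
move=> Aa ab; rewrite distrC ger0_norm ?subr_ge0 ?le_remw//.
have d0 : 0 <= done j b - done j a by rewrite subr_ge0 le_done.
have := pos_incr_le (wsz j - done j b) d0; rewrite -doneB//.
by rewrite (_ : wsz j - done j b + (done j b - done j a) = wsz j - done j a); [rewrite /remw; lra|ring].
Qed.

(** The truncation is 1-Lipschitz and the rate is nonnegative, so the error of the linear
    extrapolation is at most that of the work integral, which is [o(d)] at almost every [t]. *)
Lemma dist_remw_linear j t d : A <= t -> 0 <= d ->
  `|remw j (t + d) - pos (remw j t - rate j t * d)| <=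
  `|\int[mu]_(x in `]t, t + d]) rate j x - rate j t * d|.
Proof.
move=> At d0; have r0 : 0 <= rate j t * d by rewrite mulr_ge0 ?rate_ge0.
have dist_pos (a b : R) : `|pos a - pos b| <= `|a - b|.
  wlog ab : a b / b <= a => [H|].
    by have [|/ltW] := leP b a; [exact: H|rewrite distrC (distrC a); exact: H].
  have ab0 : 0 <= a - b by rewrite subr_ge0.
  have := pos_incr_le b ab0; rewrite subrKC => /andP[H1 H2].
  by rewrite (ger0_norm H1) (ger0_norm ab0).
have -> : pos (remw j t - rate j t * d) = pos (wsz j - done j t - rate j t * d).
  rewrite /remw; have [H|H] := leP 0 (wsz j - done j t); first by rewrite (pos_of_ge0 H).
  by rewrite (pos_of_le0 (ltW H)) !pos_of_le0//; lra.
apply: le_trans (dist_pos _ _) _.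
rewrite -doneB ?lerDl// -normrN le_eqVlt; apply/orP; left; apply/eqP; congr `|_|.
by ring.
Qed.

End schedule.

(** * Profiles as counts of tasks *)

Section profile_counts.
Variables (R : realType) (n : nat) (wr : R).
Implicit Types (q z : R) (x y : 'I_n -> R).

Lemma profileE y x q : profile wr y x q =
  \sum_j ((q <= y j)%R%:R - (q <= x j)%R%:R) + excess wr y x.
Proof.
by rewrite /profile /excess -big_split; apply: eq_bigr => j _ /=; rewrite /level; ring.
Qed.

Let crossE (a b q : R) : a <= b ->
  ((a < q) && (q <= b))%R%:R = (q <= b)%R%:R - (q <= a)%R%:R :> R.
Proof.
move=> ab; have [qa|qa] := leP q a; first by rewrite (le_trans qa)//= subrr.
by rewrite subr0.
Qed.

Lemma profile_alg_crossings y y' x q : (forall j, y' j <= y j) ->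
  profile wr y x q - (crossings y y' q)%:R =
  \sum_j ((q <= y' j)%R%:R - (q <= x j)%R%:R) + excess wr y x.
Proof.
move=> yy'; rewrite profileE /crossings natr_sum addrAC -sumrB; congr (_ + _).
by apply: eq_bigr => j _; rewrite crossE//; ring.
Qed.

Lemma profile_opt_crossings y x x' q : (forall j, x' j <= x j) ->
  profile wr y x q + (crossings x x' q)%:R =
  \sum_j ((q <= y j)%R%:R - (q <= x' j)%R%:R) + excess wr y x.
Proof.
move=> xx'; rewrite profileE /crossings natr_sum addrAC -big_split; congr (_ + _).
by apply: eq_bigr => j _ /=; rewrite crossE//; ring.
Qed.

Lemma excess_le y y' : 0 < wr -> (forall j, y' j <= y j) ->
  excess wr y y' <= (\sum_j (y j - y' j)) / wr.
Proof.
move=> wr0 yy'; rewrite mulr_suml; apply: ler_sum => j _.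
rewrite ler_pM2r ?invr_gt0//.
have d0 : 0 <= y j - y' j by rewrite subr_ge0.
have := pos_incr_le (y' j - wr) d0.
by rewrite (_ : y' j - wr + (y j - y' j) = y j - wr); [lra|ring].
Qed.

Lemma excess_gt0_ex y y' : 0 < wr -> (forall j, y' j <= y j) ->
  0 < excess wr y y' -> exists2 j, y' j < y j & wr < y j.
Proof.
move=> wr0 yy' e0.
have /existsP[j /andP[H1 H2]] : [exists j, (y' j < y j) && (wr < y j)].
  rewrite -[X in is_true X]negbK; apply/negP => /existsPn H.
  suff : excess wr y y' = 0 by move=> E; rewrite E ltxx in e0.
  apply: big1 => j _; have := H j; rewrite negb_and -!leNgt => /orP[yj|yj].
    by rewrite (le_anti (introT andP (conj (yy' j) yj))) subrr mul0r.
  by rewrite !pos_of_le0 ?subrr ?mul0r// subr_le0// (le_trans (yy' j)).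
by exists j.
Qed.

End profile_counts.

Section instance_facts.
Variables (R : realType) (I : instance R).
Hypothesis wfI : wf_instance I.
Implicit Types j : 'I_(nT I).

Lemma wsz_gt0 j : 0 < wsz j. Proof. by case: wfI. Qed.

Lemma wsz_le_wmax j : wsz j <= wmax I.
Proof. exact: le_bigmax. Qed.

Lemma wredmin_le j : ~~ ismap j -> wredmin I <= wsz j.
Proof. by move=> rj; exact: bigmin_le_cond. Qed.

Hypothesis nT_gt0 : (0 < nT I)%N.

Lemma wmax_gt0 : 0 < wmax I.
Proof. exact: lt_le_trans (wsz_gt0 (Ordinal nT_gt0)) (wsz_le_wmax _). Qed.

Lemma wredmin_gt0 : 0 < wredmin I.
Proof.
rewrite /wredmin; elim/big_ind: _ => [|a b a0 b0|j _]; first exact: wmax_gt0.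
  by rewrite lt_min a0.
exact: wsz_gt0.
Qed.

Lemma wredmin_le_wmax : wredmin I <= wmax I.
Proof. exact: bigmin_le_id. Qed.

Lemma beta_ge1 : 1 <= Defs.beta I.
Proof. by rewrite /Defs.beta ler_pdivlMr ?wredmin_gt0// mul1r wredmin_le_wmax. Qed.

Lemma nreduce_gt0 (i : 'I_(nJ I)) : (0 < nreduce i)%N.
Proof.
case: wfI => _ [_ /(_ i)[j [ji rj]]].
by rewrite /nreduce (bigD1 j)//= ji eqxx rj.
Qed.

Lemma nreduce_le_rmax (i : 'I_(nJ I)) : (nreduce i <= rmax I)%N.
Proof. exact: (leq_bigmax i). Qed.

End instance_facts.

(** * The potential and its constants *)

Section potential_definition.
Variables (R : realType) (I : instance R) (K N : nat) (alpha : R).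
Implicit Types x y : 'I_(nT I) -> R.

Definition rank_price (k : nat) : R := k%:R `^ (1 - alpha^-1).
(** Divides the rank by the number of servers: rank [k] costs [alpha * (k / K) ^ (1 - 1 / alpha)].
    The factor [alpha] clears the denominators of Young's inequality. *)
Definition price_scale : R := alpha * K%:R `^ (- (1 - alpha^-1)).
(** Chosen so that [ecoef * K = K + 2 * alpha * (K - 1)] covers the loss when all servers are busy,
    each at speed at least 1. For [2 <= K] it is at least 2, which covers free reduce tasks when a
    server idles. *)
Definition ecoef : R := 1 + 2 * alpha * (K%:R - 1) / K%:R.
(** The last factor cancels the guaranteed map speed [(r / K) ^ (1 / alpha)]. Per reduce task of a
    job with open map tasks, the rest pays [6 * K <= 12 * (K - 1)] for tasks and power, and twice
    [(alpha - 1) * beta <= 2 * (alpha - 1) * beta * (K - 1)] for the competitor's price; both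
    estimates use [2 <= K]. *)
Definition job_coef (i : 'I_(nJ I)) : R :=
  (12 + 4 * (alpha - 1) * Defs.beta I) * (K%:R - 1) * (nreduce i)%:R *
  (K%:R / (nreduce i)%:R) `^ alpha^-1.
Definition max_map y (i : 'I_(nJ I)) : R :=
  \big[Num.max/0]_(j < nT I | ismap j && (job j == i)) y j.

(* The second term pays for the time during which few tasks are free, the third
   one for the time during which reduce tasks are caged although a server idles. *)
Definition Phi y x : R :=
  2 * (price_scale * Psi N rank_price (wredmin I) y x) + ecoef * (\sum_j y j)
  + \sum_i job_coef i * max_map y i.

Hypothesis K_gt0 : (0 < K)%N.
Hypothesis alpha_gt1 : 1 < alpha.

Lemma rank_price_homo k : rank_price k <= rank_price k.+1.
Proof.
apply: ge0_ler_powR; rewrite ?nnegrE ?ler_nat// subr_ge0.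
by rewrite invf_le1 ?(lt_trans ltr01 alpha_gt1)// ltW.
Qed.

Lemma price_scale_ge0 : 0 <= price_scale.
Proof. by rewrite mulr_ge0 ?powR_ge0// (ltW (lt_trans ltr01 alpha_gt1)). Qed.

Lemma ecoef_ge0 : 0 <= ecoef.
Proof.
rewrite /ecoef addr_ge0// divr_ge0// !mulr_ge0// ?subr_ge0 ?ler1n//.
exact: ltW (lt_trans ltr01 alpha_gt1).
Qed.

Hypothesis wfI : wf_instance I.
Hypothesis nT_gt0 : (0 < nT I)%N.

Lemma job_coef_ge0 (i : 'I_(nJ I)) : 0 <= job_coef i.
Proof.
have := mulr_ge0 (_ : 0 <= alpha - 1) (le_trans ler01 (beta_ge1 wfI nT_gt0)).
rewrite subr_ge0 ltW// => /(_ isT) H.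
by rewrite /job_coef !mulr_ge0 ?powR_ge0 ?subr_ge0 ?ler1n//; lra.
Qed.

End potential_definition.

(** Linear bookkeeping over opaque quantities: [P0], [P1] are the values of [Psi] before and after,
    [hm] and [hM] the prices at [m] and [M], [sg] the useful speed of the competitor, [G] the total
    speed of the algorithm, [ks] its lower bound, [m0], [m1] the job terms. *)
Lemma drift_arith_busy (F : realFieldType)
    (C P1 P0 e Y G d m1 m0 q1 q2 hm hM sg n PA ks no a b Po a1 : F) :
  C * (P1 - P0) <= C * (- (hm * G) * d + q2 * d ^+ 2 + (hM * sg * d + q1 * d ^+ 2)) ->
  (n + PA + 2 * (C * sg * hM - C * ks * hm) - e * ks) * d <= (a1 * no + 2 * b * Po) * d ->
  e * ks * d <= e * (G * d) -> C * ks * hm * d <= C * (hm * G) * d ->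
  a1 * no * d <= a * no * d -> m1 <= m0 ->
  2 * (C * P1) + e * (Y - G * d) + m1 - (2 * (C * P0) + e * Y + m0) <=
  (a * no + 2 * b * Po - n - PA) * d + 2 * (C * (q1 + q2)) * d ^+ 2.
Proof. by lra. Qed.

Lemma drift_arith_idle (F : realFieldType)
    (C P1 P0 e Y G d m1 m0 q1 q2 hM sg n PA no a b Po Es : F) :
  C * (P1 - P0) <= C * (hM * sg * d + q1 * d ^+ 2) ->
  (n + PA + 2 * (C * sg * hM) - e * G - Es) * d <= (a * no + 2 * b * Po) * d ->
  0 <= C * q2 * d ^+ 2 -> m1 <= m0 - Es * d ->
  2 * (C * P1) + e * (Y - G * d) + m1 - (2 * (C * P0) + e * Y + m0) <=
  (a * no + 2 * b * Po - n - PA) * d + 2 * (C * (q1 + q2)) * d ^+ 2.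
Proof. by lra. Qed.

(** * Drift of the potential at a given time *)

Section snapshot.
Variables (R : realType) (I : instance R) (K : nat) (S S' : schedule I K).
Variables (A alpha t : R) (N : nat).
Local Notation mu := (@lebesgue_measure R).
Local Notation task := 'I_(nT I).
Hypothesis K_gt0 : (0 < K)%N.
Hypothesis wfI : wf_instance I.
Hypothesis nT_gt0 : (0 < nT I)%N.
Hypothesis alpha_gt1 : 1 < alpha.
Hypothesis feasS : feasible S.
Hypothesis feasS' : feasible S'.
Hypothesis A_le_rel : forall i : 'I_(nJ I), A <= Defs.rel i.
Hypothesis int_rate : forall j T, mu.-integrable `[A, T] (EFin \o rate S j).
Hypothesis int_rate' : forall j T, mu.-integrable `[A, T] (EFin \o rate S' j).
Hypothesis At : A <= t.
Hypothesis alg : alg_rule S alpha t.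
Hypothesis N_large : Defs.beta I * (nT I)%:R < N%:R.

Local Notation beta := (Defs.beta I).
Local Notation wr := (wredmin I).
Let y j := remw S A j t.
Let x j := remw S' A j t.
Let unf (j : task) := unfinished S j t.
Let unf' (j : task) := unfinished S' j t.
Let prc (j : task) := `[< processed S j t >].
Let n : R := (n_unf S t)%:R.
Let no : R := (n_unf S' t)%:R.
Let yd d j := pos (y j - rate S j t * d).
Let xd d j := pos (x j - rate S' j t * d).
(** [M] bounds the profile on all levels of []0, wr]] from above. [m] bounds it from below on the
    levels where the algorithm works: at most [K] tasks are served, one of which is recovered, and
    the competitor has at most [no] tasks there. *)
Let M := n + excess wr y x.
Let m := M - (K%:R - 1) - no.
Let p := 1 - alpha^-1.
Let f (k : nat) : R := k%:R `^ p.
Let lam := beta `^ (- alpha^-1).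
(** Speed spent on finished tasks is left out, so that at most [no] servers contribute. *)
Let sigma := \sum_j (if 0 < x j then rate S' j t else 0).

Let wr0 : 0 < wr. Proof. exact: wredmin_gt0. Qed.
Let b1 : 1 <= beta. Proof. exact: beta_ge1. Qed.
Let b0 : 0 < beta. Proof. exact: lt_le_trans ltr01 b1. Qed.
Let a0 : 0 < alpha. Proof. exact: lt_trans ltr01 alpha_gt1. Qed.
Let p_gt0 : 0 < p. Proof. by rewrite subr_gt0 invf_lt1. Qed.
Let f0 : f 0%N = 0. Proof. by rewrite /f powR0// gt_eqF. Qed.
Let f_homo k : f k <= f k.+1.
Proof. by apply: ge0_ler_powR; rewrite ?nnegrE ?ler_nat ?(ltW p_gt0). Qed.
Let y_ge0 j : 0 <= y j. Proof. exact: remw_ge0. Qed.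
Let x_ge0 j : 0 <= x j. Proof. exact: remw_ge0. Qed.
Let unfE j : unf j = (Defs.rel (job j) <= t) && (0 < y j).
Proof. exact: unfinishedE. Qed.
Let unf'E j : unf' j = (Defs.rel (job j) <= t) && (0 < x j).
Proof. exact: unfinishedE. Qed.
Let y_le j : y j <= wmax I.
Proof. by apply: le_trans (wsz_le_wmax j); apply: remw_le => //; exact: wsz_gt0. Qed.
Let x_le j : x j <= wmax I.
Proof. by apply: le_trans (wsz_le_wmax j); apply: remw_le => //; exact: wsz_gt0. Qed.
Let wmaxE : wmax I = beta * wr. Proof. by rewrite /Defs.beta divfK// gt_eqF. Qed.

Let nE : n = \sum_j (unf j)%:R. Proof. by rewrite /n /n_unf natr_sum. Qed.
Let noE : no = \sum_j (unf' j)%:R. Proof. by rewrite /no /n_unf natr_sum. Qed.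

Let unreleased j : ~~ (Defs.rel (job j) <= t) -> y j = x j.
Proof.
rewrite -ltNge => tr.
by rewrite /y /x !(remw_unreleased _ _ _ tr)//; exact: wsz_gt0.
Qed.

Let rate_prc j : ~~ prc j -> rate S j t = 0.
Proof. by move/asboolP => np; apply/eqP; apply: contraPT np => /rate_gt0_processed np; apply. Qed.

Let yd_le d j : 0 <= d -> 0 <= yd d j <= y j.
Proof.
move=> d0; rewrite pos_ge0/= -[leRHS]pos_of_ge0//; apply: le_pos.
by rewrite gerBl mulr_ge0// rate_ge0.
Qed.

Let xd_le d j : 0 <= d -> 0 <= xd d j <= x j.
Proof.
move=> d0; rewrite pos_ge0/= -[leRHS]pos_of_ge0//; apply: le_pos.
by rewrite gerBl mulr_ge0// rate_ge0.
Qed.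

Let yd_np d j : ~~ prc j -> yd d j = y j.
Proof. by move=> /rate_prc H; rewrite /yd H mul0r subr0 pos_of_ge0. Qed.

Let prc_unf j : prc j -> unf j /\ Defs.free S j t.
Proof. by move/asboolP; case: alg => + _ => /(_ j). Qed.

(** A remaining work of at most [beta * wr] exceeds [wr] by at most [beta - 1] units of [wr]; this
    is the origin of [beta] in the ratio. *)
Let excess_part_le (z : task -> R) j : 0 <= z j <= wmax I ->
  pos (z j - wr) / wr <= (0 < z j)%R%:R * (beta - 1).
Proof.
move=> /andP[z0 zw]; have [zp|zp] := ltP 0 (z j); last first.
  have -> : pos (z j - wr) = 0 by apply: pos_of_le0; have := wr0; lra.
  by rewrite !mul0r.
rewrite mul1r ler_pdivrMr// mulrBl mul1r -wmaxE.
have [H|H] := leP 0 (z j - wr); first by rewrite pos_of_ge0//; have := wr0; lra.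
by rewrite pos_of_le0 ?(ltW H)// subr_ge0 wredmin_le_wmax.
Qed.

Let excess_ub : excess wr y x <= (beta - 1) * n.
Proof.
rewrite nE mulr_sumr; apply: ler_sum => j _; rewrite unfE.
have [r|nr] := boolP (Defs.rel (job j) <= t); last first.
  by rewrite (unreleased nr) subrr mul0r mulr0.
rewrite /= mulrBl lerBlDr (le_trans (excess_part_le _))//; first by rewrite y_ge0 y_le.
by rewrite mulrC lerDl divr_ge0 ?pos_ge0// ltW.
Qed.

Let excess_lb : - ((beta - 1) * no) <= excess wr y x.
Proof.
rewrite noE mulr_sumr -sumrN; apply: ler_sum => j _; rewrite unf'E.
have [r|nr] := boolP (Defs.rel (job j) <= t); last first.
  by rewrite (unreleased nr) subrr mul0r mulr0 oppr0.
rewrite /= lerNl mulrBl opprB lerBlDr (le_trans (excess_part_le _))//.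
  by rewrite x_ge0 x_le.
by rewrite mulrC lerDl divr_ge0 ?pos_ge0// ltW.
Qed.

Let M_le : M <= beta * n.
Proof. by have := excess_ub; rewrite /M; lra. Qed.

Let m_ge : n - (K%:R - 1) - beta * no <= m.
Proof. by have := excess_lb; rewrite /m /M; lra. Qed.

Let n_le : n <= (nT I)%:R.
Proof.
rewrite /n ler_nat /n_unf -[leqRHS]card_ord -sum1_card; apply: leq_sum => j _.
by case: unfinished.
Qed.

Let M_lt : M < N%:R.
Proof. by apply: le_lt_trans N_large; apply: le_trans M_le _; rewrite ler_pM2l. Qed.

Let no_ge0 : 0 <= no. Proof. by []. Qed.

(** A free task left waiting is no shorter than a served one; a caged one is an untouched reduce
    task, of size at least [wr]. Hence up to level [wr] serving the shortest free tasks acts like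
    serving the shortest tasks. *)
Let prc_small j0 j : prc j0 -> unf j -> ~~ prc j -> Num.min (y j0) wr <= y j.
Proof.
move=> p0 uj /asboolP pj; rewrite ge_min.
have [fj|fj] := pselect (Defs.free S j t).
  have [u0 _] := prc_unf p0.
  case: alg => _ [_ [+ _]] => /(_ j0 j) H; move/asboolP : p0 => p0.
  by have := H p0 uj fj pj; rewrite !(remainingE feasS A_le_rel int_rate)// lee_fin -/(y j0) -/(y j) => ->.
apply/orP; right; rewrite /y (remw_caged _ _ _ _ At fj)//; last exact: wsz_gt0.
by apply: wredmin_le; apply/negP => mj; apply: fj; left.
Qed.

Let rate_lt d j : yd d j != y j -> prc j.
Proof. by apply: contraNT => /yd_np->. Qed.

(** The flag [b] marks a served task that still counts at level [q]. An unreleased task contributes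
    equally to both sides of the profile. *)
Let alg_term d q j (b : bool) : 0 < q -> (unf j -> ~~ prc j -> q <= y j) ->
  (b -> unf j /\ prc j /\ q <= yd d j) ->
  (unf j)%:R - (prc j)%:R - (unf' j)%:R + b%:R <= (q <= yd d j)%R%:R - (q <= x j)%R%:R :> R.
Proof.
move=> q0 Hq Hb.
have [r|nr] := boolP (Defs.rel (job j) <= t); last first.
  have nu : unf j = false by rewrite unfE (negbTE nr).
  have np : ~~ prc j by apply/negP => /prc_unf[]; rewrite nu.
  have nb : b = false by apply/negbTE/negP => /Hb[]; rewrite nu.
  by rewrite nu unf'E (negbTE nr) (negbTE np) nb (yd_np d np) (unreleased nr); lra.
have H1 : (q <= x j)%R%:R <= (unf' j)%:R :> R.
  rewrite unf'E r /= ler_nat; have [qx|//] := boolP (q <= x j).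
  by rewrite (lt_le_trans q0 qx).
have H2 : (unf j)%:R - (prc j)%:R + b%:R <= (q <= yd d j)%R%:R :> R.
  case: b Hb => [/(_ isT)[-> [-> ->]]|_]; first by rewrite /=; lra.
  have [uj|_] := boolP (unf j); last by case: (prc j); rewrite /=; case: (q <= yd d j); rewrite /=; lra.
  have [pj|pj] := boolP (prc j); first by case: (q <= yd d j); rewrite /=; lra.
  by rewrite (yd_np d pj) (Hq uj pj) /=; lra.
by lra.
Qed.

Let prc_countR : (K <= n_free S t)%N -> \sum_j (prc j)%:R = K%:R :> R.
Proof.
move=> KF; case: alg => _ [+ _]; rewrite (minn_idPr KF) => H.
by rewrite -[in RHS]H natr_sum.
Qed.

Let alg_step d : (K <= n_free S t)%N -> 0 < d ->
  Psi N f wr (yd d) x - Psi N f wr y x <=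
  - dhinge N f (m - excess wr y (yd d)) * \sum_j (y j - yd d j).
Proof.
move=> KF d0; have ydl j := yd_le j (ltW d0).
have ydy j : yd d j <= y j by have /andP[] := ydl j.
have sumE (b : task -> bool) :
    \sum_j ((unf j)%:R - (prc j)%:R - (unf' j)%:R + (b j)%:R) =
    n - K%:R - no + \sum_j (b j)%:R.
  by rewrite big_split/= !sumrB -nE -noE prc_countR.
apply: Psi_alg_step => //.
- move=> q /andP[q0 qwr] cr.
  have [j0 /andP[j1 j2]] : exists j0, (yd d j0 < q) && (q <= y j0).
    apply/existsP; rewrite -[X in is_true X]negbK; apply/negP => /existsPn H.
    by move: cr; rewrite /crossings big1// => j _; rewrite (negbTE (H j)).
  have p0 : prc j0 by apply: (@rate_lt d); rewrite lt_eqF// (lt_le_trans j1).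
  rewrite profile_alg_crossings// -lerBlDr.
  have -> : m - 1 = \sum_j ((unf j)%:R - (prc j)%:R - (unf' j)%:R + false%:R) + excess wr y x.
    have -> := sumE (fun=> false).
    have -> : \sum_(j < nT I) false%:R = 0 :> R by rewrite big1.
    by rewrite /m /M; ring.
  rewrite lerD2r; apply: ler_sum => j _; apply: alg_term => // uj pj.
  by apply: le_trans (prc_small p0 uj pj); rewrite le_min j2.
(* Excess is worked off only on a served task above [wr]; that task counts on every level, which
   recovers one of the [K] served tasks. *)
- move=> e0 q /andP[q0 qwr].
  have [j0 j1 j2] := excess_gt0_ex wr0 ydy e0.
  have p0 : prc j0 by apply: (@rate_lt d); rewrite lt_eqF.
  have [u0 _] := prc_unf p0.
  rewrite profileE.
  have -> : m = \sum_j ((unf j)%:R - (prc j)%:R - (unf' j)%:R + (j == j0)%:R) + excess wr y x.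
    rewrite sumE.
    have -> : \sum_j (j == j0)%:R = 1 :> R.
      by rewrite (bigD1 j0)//= eqxx big1 ?addr0// => j /negbTE->.
    by rewrite /m /M; ring.
  rewrite lerD2r; apply: ler_sum => j _.
  (* Extrapolation by length 0 makes [alg_term] speak about [y] itself. *)
  have yd0 : yd 0 j = y j by rewrite /yd mulr0 subr0 pos_of_ge0.
  rewrite -yd0; apply: alg_term => //.
    move=> uj pj; apply: le_trans (prc_small p0 uj pj).
    by rewrite le_min qwr (le_trans qwr)// ltW.
  by move=> /eqP->; split=> //; split=> //; rewrite /yd mulr0 subr0 pos_of_ge0// (le_trans qwr)// ltW.
Qed.

Let rate'_released j : rate S' j t != 0 -> Defs.rel (job j) <= t.
Proof. by move=> /(rate_gt0_processed)/(processed_released feasS'). Qed.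

Let opt_term d q j (b : bool) : 0 < q -> (b -> Defs.rel (job j) <= t /\ q <= xd d j) ->
  (q <= y j)%R%:R - (q <= xd d j)%R%:R <= (unf j)%:R - b%:R :> R.
Proof.
move=> q0 Hb.
have [r|nr] := boolP (Defs.rel (job j) <= t); last first.
  have nb : b = false by apply/negbTE/negP => /Hb[]; rewrite (negbTE nr).
  have nrate : rate S' j t = 0 by apply/eqP; apply: contraNT nr => /rate'_released.
  rewrite nb unfE (negbTE nr) /xd nrate mul0r subr0 pos_of_ge0// (unreleased nr) /=; lra.
have H1 : (q <= y j)%R%:R <= (unf j)%:R :> R.
  rewrite unfE r /= ler_nat; have [qx|//] := boolP (q <= y j).
  by rewrite (lt_le_trans q0 qx).
have H2 : b%:R <= (q <= xd d j)%R%:R :> R by case: b Hb => [/(_ isT)[_ ->]|].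
by lra.
Qed.

Let opt_step d : 0 < d ->
  Psi N f wr y (xd d) - Psi N f wr y x <=
  dhinge N f (M + excess wr x (xd d)) * \sum_j (x j - xd d j).
Proof.
move=> d0; have xdl j := xd_le j (ltW d0).
have xdx j : xd d j <= x j by have /andP[] := xdl j.
apply: Psi_opt_step => //.
- move=> q /andP[q0 qwr]; rewrite profile_opt_crossings// lerD2r nE.
  by apply: ler_sum => j _; have := @opt_term d q j false q0; rewrite subr0; apply.
- move=> e0 q /andP[q0 qwr].
  have [j0 j1 j2] := excess_gt0_ex wr0 xdx e0.
  have r0 : Defs.rel (job j0) <= t.
    apply: rate'_released; apply: contraTneq j1 => H.
    by rewrite /xd H mul0r subr0 pos_of_ge0// ltxx.
  rewrite profileE -lerBrDr.
  have -> : M - 1 = \sum_j ((unf j)%:R - (j == j0)%:R) + excess wr y x.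
    rewrite sumrB -nE.
    have -> : \sum_j (j == j0)%:R = 1 :> R.
      by rewrite (bigD1 j0)//= eqxx big1 ?addr0// => j /negbTE->.
    by rewrite /M; ring.
  rewrite lerD2r; apply: ler_sum => j _.
  have xd0 i : xd 0 i = x i by rewrite /xd mulr0 subr0 pos_of_ge0.
  rewrite -xd0; apply: opt_term => // /eqP->; split=> //.
  by rewrite xd0 (le_trans qwr)// ltW.
Qed.

Let K0 : 0 < K%:R :> R. Proof. by rewrite ltr0n. Qed.
Let lam0 : 0 < lam. Proof. exact: powR_gt0. Qed.
Let lam1 : lam <= 1.
Proof.
by rewrite -(powRr0 beta); apply: ler_powR => //; rewrite oppr_le0 invr_ge0 ltW.
Qed.

Let C := alpha * K%:R `^ (- p).
Let Po := \sum_(k < K) powR (speed S' t k) alpha.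
Let PA := \sum_(k < K) powR (speed S t k) alpha.
Let act k := if assign S' t k is Some j then 0 < x j else false.

Let C_gt0 : 0 < C. Proof. by rewrite mulr_gt0// powR_gt0. Qed.

Let sigmaE : sigma = \sum_k (if act k then speed S' t k else 0).
Proof.
have -> : sigma = \sum_j \sum_k (if (0 < x j) && (assign S' t k == Some j) then speed S' t k else 0).
  by apply: eq_bigr => j _; case: (0 < x j) => //; rewrite big1.
rewrite exchange_big; apply: eq_bigr => k _; rewrite /act.
case E : (assign S' t k) => [j0|]; last by apply: big1 => j _; rewrite andbF.
rewrite (bigD1 j0)//= eqxx andbT big1 ?addr0// => j jj0.
by rewrite (_ : Some j0 == Some j = false) ?andbF//; apply/negbTE; rewrite eq_sym in jj0.
Qed.

Let sum_le1 (P : pred 'I_K) (b : bool) : (forall k1 k2, P k1 -> P k2 -> k1 = k2) ->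
  (forall k, P k -> b) -> (\sum_k P k <= b)%N.
Proof.
move=> Puniq Pb; have [/existsP[k0 Pk0]|/existsPn nP] := boolP [exists k, P k].
  rewrite (bigD1 k0)//= Pk0 (Pb _ Pk0) big1 ?addn0// => k kk0.
  by apply/eqP; rewrite eqb0; apply: contraNN kk0 => Pk; rewrite (Puniq _ _ Pk Pk0).
by rewrite big1// => k _; rewrite (negbTE (nP k)).
Qed.

(** No task runs on two servers, so the servers doing useful work are no more than the unfinished
    tasks; shown by exchanging the sums. *)
Let act_le_no : (\sum_k act k <= n_unf S' t)%N.
Proof.
have -> : (\sum_k act k = \sum_k \sum_(j < nT I) ((assign S' t k == Some j) && (0 < x j)%R))%N.
  apply: eq_bigr => k _; rewrite /act; case E : (assign S' t k) => [j0|]; last by rewrite big1.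
  rewrite (bigD1 j0)//= eqxx big1 ?addn0// => j jj0.
  by rewrite (_ : Some j0 == Some j = false)//; apply/negbTE; rewrite eq_sym in jj0.
rewrite exchange_big; apply: leq_sum => j _; rewrite -/(unf' j).
apply: (@sum_le1 (fun k => (assign S' t k == Some j) && (0 < x j))).
  move=> k1 k2 /andP[/eqP H1 _] /andP[/eqP H2 _].
  by case: feasS' => _ [_ [_ [H _]]]; exact: H H1 H2.
move=> k /andP[/eqP Hk xj]; rewrite unf'E xj andbT.
by apply: (processed_released feasS'); exists k.
Qed.

Let act_min : (\sum_k (act k)%:R : R) <= Num.min no K%:R.
Proof.
rewrite le_min -natr_sum /no !ler_nat act_le_no /=.
rewrite -[leqRHS]card_ord -sum1_card; apply: leq_sum => k _.
by case: (act k).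
Qed.

Let speed'_ge0 k : 0 <= speed S' t k. Proof. by case: feasS'. Qed.

(** [opt_price], interpolated to the real rank [M], is summed over the servers doing useful work;
    their number [Num.min no K] multiplies the rank term. *)
Let opt_price_sum : C * sigma * dhinge N f M <=
  beta * Po + (alpha - 1) * lam / K%:R * pos M * Num.min no K%:R.
Proof.
have cst0 : 0 <= (alpha - 1) * lam / K%:R * pos M.
  by rewrite mulr_ge0 ?pos_ge0// divr_ge0// mulr_ge0 ?(ltW lam0)// subr_ge0 ltW.
apply: (@le_trans _ _ (\sum_k (beta * speed S' t k `^ alpha +
   (act k)%:R * ((alpha - 1) * lam / K%:R * pos M)))).
  rewrite sigmaE mulr_sumr mulr_suml; apply: ler_sum => k _.
  case: (act k); last first.
    by rewrite mulr0 !mul0r addr0 mulr_ge0 ?powR_ge0// ltW.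
  rewrite mul1r; have [M0|M0] := leP 0 M; last first.
    rewrite dhinge_le0 ?(ltW M0)// mulr0 addr_ge0//.
    by rewrite mulr_ge0 ?powR_ge0// ltW.
  rewrite (pos_of_ge0 M0); apply: dhinge_le_affine => //; last by rewrite M0 M_lt.
  by move=> k'; apply: opt_price.
rewrite big_split/= -mulr_sumr -mulr_suml lerD2l mulrC.
by apply: ler_wpM2l => //; exact: act_min.
Qed.

Let sA := powR ((n_unf S t + 1)%:R / K%:R) alpha^-1.

Let n1E : (n_unf S t + 1)%:R = n + 1 :> R. Proof. by rewrite natrD. Qed.

Let sA_ge1 : (K <= n_free S t)%N -> 1 <= sA.
Proof.
move=> KF; rewrite /sA -[leLHS](powRr0 ((n_unf S t + 1)%:R / K%:R)).
apply: ler_powR; last by rewrite invr_ge0 ltW.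
rewrite ler_pdivlMr// mul1r ler_nat (leq_trans KF)// addn1 ltnW// ltnS.
by apply: leq_sum => j _; case: (unfinished S j t) => //=; exact: leq_b1.
Qed.

(** The exponents of [K] add up to 0: this is why [price_scale] has the exponent it has. *)
Let CKsA : C * (K%:R * sA) = alpha * (n_unf S t).+1%:R `^ alpha^-1.
Proof.
rewrite /C /sA addn1 powRM ?invr_ge0// -(powR_inv1 (ltW K0)) -powRrM mulN1r.
set X := _.+1%:R `^ _.
have -> : K%:R = K%:R `^ 1 :> R by rewrite powRr1.
rewrite -!powRrM !mul1r.
have -> : alpha * K%:R `^ (- p) * (K%:R `^ 1 * (X * K%:R `^ (- alpha^-1))) =
   alpha * X * (K%:R `^ (- p) * (K%:R `^ 1 * K%:R `^ (- alpha^-1))) by ring.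
rewrite -!powRD ?(gt_eqF K0) ?implybT//.
by rewrite (_ : - p + (1 - alpha^-1) = 0) ?powRr0 ?mulr1// /p; ring.
Qed.

Let alg_price_m : 0 <= m ->
  Num.min m (n + 1) + (alpha - 1) * lam * m <= C * (K%:R * sA) * dhinge N f m.
Proof.
move=> m0; rewrite CKsA -n1E addn1.
have mM : m <= M by rewrite /m; have : 1 <= K%:R :> R; [rewrite ler1n|have := no_ge0; lra].
apply: (@dhinge_ge_capped _ _ _ _ _ (beta * (n_unf S t).+1%:R)) => //.
- by move=> k kB; apply: alg_price.
- by rewrite m0 (le_lt_trans mM).
(* The rank bound holds up to [m + 1] because [m <= beta * n] and [1 <= beta]. *)
- rewrite -natr1 mulrDr mulr1; apply: lerD => //.
  exact: le_trans mM M_le.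
Qed.

Let PA_busy : (K <= n_free S t)%N -> PA = n + 1.
Proof.
move=> KF; case: alg => _ [_ [_ [/(_ KF) H _]]].
rewrite /PA (eq_bigr (fun=> (n_unf S t + 1)%:R / K%:R)); last first.
  by move=> k _; rewrite H -powRrM mulVf ?gt_eqF// powRr1// divr_ge0.
by rewrite sumr_const card_ord -[LHS]mulr_natr divfK ?gt_eqF.
Qed.

Let rate_sum_busy : (K <= n_free S t)%N -> K%:R * sA <= \sum_j rate S j t.
Proof.
move=> KF; case: (alg) => _ [_ [_ [/(_ KF) H _]]].
rewrite -(prc_countR KF) mulr_suml; apply: ler_sum => j _.
have [/asboolP[k Hk]|_] := boolP (prc j); last by rewrite mul0r rate_ge0.
rewrite mul1r /rate (bigD1 k)//= Hk eqxx H -/sA lerDl.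
by apply: sumr_ge0 => k' _; case: ifP => // _; case: feasS.
Qed.

(** The cost [2 * n + 1] meets [2 * Num.min m (n + 1)] with [m >= n - (K - 1) - beta * no]. The rank
    terms at [M] and [m] have equal slope and leave [2 * (alpha - 1) * (K - 1 + no)]. Altogether the
    loss is [2 * alpha * (K - 1) + 1] apart from the terms in [no] and [Po], and [ecoef] pays it. *)
Let busy_rate : (K <= n_free S t)%N ->
  n + PA + 2 * (C * sigma * dhinge N f M - C * (K%:R * sA) * dhinge N f m)
    - ecoef K alpha * (K%:R * sA) <= (2 * beta + 2 * alpha - 2) * no + 2 * beta * Po.
Proof.
move=> KF; rewrite PA_busy//.
have K1 : 1 <= K%:R :> R by rewrite ler1n.
have e0 : K%:R + 2 * alpha * (K%:R - 1) <= ecoef K alpha * (K%:R * sA).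
  apply: (@le_trans _ _ (ecoef K alpha * K%:R)).
    have -> // : ecoef K alpha * K%:R = K%:R + 2 * alpha * (K%:R - 1).
    by rewrite /ecoef; field; rewrite gt_eqF.
  rewrite mulrA ler_pMr ?sA_ge1// mulr_gt0// /ecoef ltr_pwDl// divr_ge0//.
  by rewrite !mulr_ge0 ?(ltW a0)// subr_ge0.
have H1 := opt_price_sum.
have am : 0 <= alpha - 1 by rewrite subr_ge0 ltW.
have H2 : (alpha - 1) * lam / K%:R * pos M * Num.min no K%:R <= (alpha - 1) * lam * pos M.
  have -> : (alpha - 1) * lam * pos M = (alpha - 1) * lam / K%:R * pos M * K%:R.
    by field; rewrite gt_eqF.
  apply: ler_wpM2l; last by rewrite ge_min lexx orbT.
  by rewrite mulr_ge0 ?pos_ge0// divr_ge0// mulr_ge0 ?(ltW lam0).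
have hm0 : 0 <= dhinge N f m by exact: (dhinge_ge0 N f_homo).
have CK0 : 0 <= C * (K%:R * sA) * dhinge N f m.
  by rewrite mulr_ge0// mulr_ge0 ?(ltW C_gt0)// mulr_ge0// powR_ge0.
have mg := m_ge.
have nob : no <= beta * no by rewrite ler_peMl.
have lamK : (alpha - 1) * lam * (K%:R - 1 + no) <= (alpha - 1) * (K%:R - 1 + no).
  apply: ler_wpM2r; first by have := no_ge0; lra.
  by apply: ler_piMr.
have alno : 0 <= (alpha - 1) * no by rewrite mulr_ge0.
have ME : M = m + (K%:R - 1 + no) by rewrite /m; ring.
have [m0|m0] := leP 0 m.
  have M0 : 0 <= M by rewrite ME; have := no_ge0; lra.
  have H3 := alg_price_m m0.
  have H4 : (alpha - 1) * lam * pos M = (alpha - 1) * lam * m + (alpha - 1) * lam * (K%:R - 1 + no).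
    by rewrite (pos_of_ge0 M0) {1}ME mulrDr.
  have no0 := no_ge0.
  by move: H3; have [mn|mn] := leP m (n + 1) => H3; lra.
(* For [m < 0] no gain from the price is used: [m_ge] gives [n < K - 1 + beta * no], which bounds
   the cost directly. *)
have H4 : (alpha - 1) * lam * pos M <= (alpha - 1) * lam * (K%:R - 1 + no).
  apply: ler_wpM2l; first by rewrite mulr_ge0 ?(ltW lam0).
  have -> : K%:R - 1 + no = pos (K%:R - 1 + no) by rewrite pos_of_ge0//; have := no_ge0; lra.
  by apply: le_pos; lra.
lra.
Qed.

(** * Times with an idle server: counting by jobs *)

Let active (i : 'I_(nJ I)) := [exists j : task, [&& ismap j, job j == i & unf j]].
Let rr (i : 'I_(nJ I)) : R := (nreduce i)%:R.
Let rr1 i : 1 <= rr i. Proof. by rewrite ler1n nreduce_gt0. Qed.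
Let nfr : R := \sum_j (~~ ismap j && prc j)%:R.

Let prc_count : (n_free S t < K)%N -> (\sum_j prc j = n_free S t)%N.
Proof.
move=> KF; case: alg => _ [+ _]; rewrite (minn_idPl (ltnW KF)); apply: etrans.
by apply: eq_bigr.
Qed.

(** Served tasks are free and unfinished and there are [n_free] of them, so none is left out. *)
Let idle_prc j : (n_free S t < K)%N -> unf j -> Defs.free S j t -> prc j.
Proof.
move=> KF uj fj; apply/negPn/negP => npj.
have := prc_count KF; rewrite /n_free (bigD1 j)//= [RHS](bigD1 j)//= -/(unf j) uj.
rewrite (negbTE npj) (_ : `[< Defs.free S j t >] = true) /=; last exact/asboolP.
move=> H; suff : (\sum_(i | i != j) prc i <= \sum_(i < nT I | i != j) (unfinished S i t && `[< Defs.free S i t >]))%N.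
  by rewrite add0n in H; rewrite H add1n ltnn.
apply: leq_sum => i _; have [/prc_unf[ui fi]|//] := boolP (prc i).
by rewrite -/(unf i) ui (_ : `[< Defs.free S i t >] = true)//; exact/asboolP.
Qed.

Let by_job (P : pred task) (g : 'I_(nJ I) -> R) :
  \sum_(j < nT I) (P j)%:R * g (job j) =
  \sum_i g i * (\sum_(j < nT I) ((job j == i) && P j))%:R.
Proof.
have -> : \sum_i g i * (\sum_(j < nT I) ((job j == i) && P j))%:R =
    \sum_i \sum_(j < nT I) ((job j == i) && P j)%:R * g i.
  by apply: eq_bigr => i _; rewrite natr_sum mulr_sumr; apply: eq_bigr => j _; rewrite mulrC.
rewrite exchange_big; apply: eq_bigr => j _.
rewrite (bigD1 (job j))//= eqxx big1 ?addr0// => i ij.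
by rewrite eq_sym (negbTE ij) mul0r.
Qed.

(** An unfinished task that is not served is caged, hence one of the reduce tasks of a job with an
    open map task. *)
Let n_le_active : (n_free S t < K)%N -> n <= (n_free S t)%:R + \sum_(i | active i) rr i.
Proof.
move=> KF; rewrite -(prc_count KF) natr_sum.
have -> : \sum_(i | active i) rr i = \sum_(j < nT I) (~~ ismap j && active (job j))%:R.
  rewrite (eq_bigr (fun j => (~~ ismap j && active (job j))%:R * 1)); last by move=> j _; rewrite mulr1.
  rewrite (by_job _ (fun=> 1)) big_mkcond; apply: eq_bigr => i _; rewrite mul1r.
  case: ifPn => ai; last first.
    by rewrite big1// => j _; case: eqP => // ->; rewrite (negbTE ai) !andbF.
  by congr (_%:R); apply: eq_bigr => j _; case: eqP => // ->; rewrite ai andbT.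
rewrite nE -big_split; apply: ler_sum => j _ /=.
have [uj|_] := boolP (unf j); last by rewrite addr_ge0.
have [pj|pj] := boolP (prc j); first by rewrite lerDl.
have nf : ~ Defs.free S j t by move=> fj; rewrite (idle_prc KF uj fj) in pj.
have rj : ~~ ismap j by apply/negP => mj; apply: nf; left.
suff -> : active (job j) by rewrite rj add0r.
apply: contraPT (nf) => /existsPn na; apply: contrapT => _; apply: nf; right => j' jj' mj'.
have := na j'; rewrite mj' jj' eqxx /= => nu'.
apply: contrapT => nfin; move/negP: nu'; apply; apply/asboolP; split=> //.
by move: uj; rewrite unfE /released jj' => /andP[].
Qed.

(** Served map tasks belong to active jobs, and fewer than [K] tasks are served in all, so [K] per
    job is a safe count. *)
Let prc_map_le (g : 'I_(nJ I) -> R) : (n_free S t < K)%N -> (forall i, 0 <= g i) ->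
  \sum_(j < nT I) (ismap j && prc j)%:R * g (job j) <= \sum_(i | active i) K%:R * g i.
Proof.
move=> KF g0; rewrite (by_job (fun j => ismap j && prc j)) [leRHS]big_mkcond/=.
apply: ler_sum => i _; case: ifPn => ai.
  rewrite mulrC; apply: ler_wpM2r => //; rewrite ler_nat.
  apply: leq_trans (ltnW KF); rewrite -(prc_count KF); apply: leq_sum => j _.
  by case: (job j == i) => //=; case: (ismap j).
rewrite big1 ?mulr0// => j _; case: eqP => // ji /=.
apply/eqP; rewrite eqb0; apply: contraNN ai => /andP[mj /prc_unf[uj _]].
by apply/existsP; exists j; rewrite mj ji eqxx.
Qed.

Let n_free_split : (n_free S t < K)%N ->
  (n_free S t)%:R <= nfr + \sum_(i | active i) K%:R * rr i :> R.
Proof.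
move=> KF; rewrite -(prc_count KF) natr_sum.
have := @prc_map_le rr KF (fun i => le_trans ler01 (rr1 i)).
have : \sum_j (prc j)%:R <= nfr + \sum_(j < nT I) (ismap j && prc j)%:R * rr (job j).
  rewrite /nfr -big_split; apply: ler_sum => j _ /=.
  case: (ismap j) => /=; last by rewrite mul0r addr0.
  by rewrite add0r ler_peMr.
lra.
Qed.

Let bh j := minn (bmap S j t) K.

Let bh_gt0 j : prc j -> ismap j -> (0 < bh j)%N.
Proof.
move=> /prc_unf[uj _] mj; rewrite leq_min K_gt0 andbT /bmap (bigD1 j)//= eqxx mj.
by rewrite -/(unf j) uj.
Qed.

Let pw j : R := if ismap j then ((nreduce (job j)).+1 + bh j + 1)%:R / (bh j)%:R else 1.

Let pw_ge0 j : 0 <= pw j.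
Proof. by rewrite /pw; case: ifP => // _; rewrite divr_ge0. Qed.

Let idle_speed j k : (n_free S t < K)%N -> assign S t k = Some j ->
  speed S t k = pw j `^ alpha^-1.
Proof.
move=> KF Hk; case: alg => _ [_ [_ [_ /(_ KF)[_ /(_ k j Hk) ->]]]].
by rewrite /pw; case: ifP.
Qed.

Let PA_le : (n_free S t < K)%N -> PA <= nfr + \sum_(i | active i) 4 * K%:R * rr i.
Proof.
move=> KF.
have -> : PA = \sum_k \sum_j (assign S t k == Some j)%:R * pw j.
  apply: eq_bigr => k _; case E : (assign S t k) => [j0|]; last first.
    rewrite big1; last by move=> j _; rewrite mul0r.
    case: alg => _ [_ [_ [_ /(_ KF)[/(_ k E) -> _]]]].
    by rewrite powR0// gt_eqF.
  rewrite (idle_speed KF E) -powRrM mulVf ?gt_eqF// powRr1//.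
  rewrite (bigD1 j0)//= eqxx mul1r big1 ?addr0// => j jj0.
  by rewrite (_ : Some j0 == Some j = false) ?mul0r//; apply/negbTE; rewrite eq_sym in jj0.
rewrite exchange_big.
apply: (@le_trans _ _ (\sum_j (prc j)%:R * pw j)).
  apply: ler_sum => j _; rewrite -mulr_suml; apply: ler_wpM2r => //.
  rewrite -natr_sum ler_nat; apply: (@sum_le1 (fun k => assign S t k == Some j)).
    move=> k1 k2 /eqP H1 /eqP H2.
    by case: feasS => _ [_ [_ [H _]]]; exact: H H1 H2.
  by move=> k /eqP Hk; apply/asboolP; exists k.
have H4 := @prc_map_le (fun i => 4 * rr i) KF (fun i => mulr_ge0 (ler0n _ _) (le_trans ler01 (rr1 i))).
have : \sum_j (prc j)%:R * pw j <= nfr + \sum_(j < nT I) (ismap j && prc j)%:R * (4 * rr (job j)).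
  rewrite /nfr -big_split; apply: ler_sum => j _ /=.
  have [pj|pj] := boolP (prc j); last by rewrite !andbF !mul0r addr0.
  rewrite /pw !andbT mul1r; have [mj|mj] := boolP (ismap j); last by rewrite /= mul0r addr0.
  rewrite /= add0r mul1r.
  have b0' : 0 < (bh j)%:R :> R by rewrite ltr0n bh_gt0.
  have b1' : 1 <= (bh j)%:R :> R by rewrite ler1n bh_gt0.
  (* With [r >= 1] reduce tasks and [b >= 1] map tasks counted, the power [(r + 2) / b + 1] is at
     most [r + 3 <= 4 * r]. *)
  rewrite ler_pdivrMr// !natrD -natr1 -/(rr (job j)).
  by have := rr1 (job j); nra.
move=> H5; apply: le_trans H5 _; rewrite lerD2l; apply: le_trans H4 _.
by rewrite le_eqVlt; apply/orP; left; apply/eqP; apply: eq_bigr => i _; ring.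
Qed.

Let nfr_le : (n_free S t < K)%N -> nfr <= \sum_j rate S j t.
Proof.
move=> KF; apply: ler_sum => j _.
have [/andP[rj /asboolP[k Hk]]|_] := boolP (_ && _); last exact: rate_ge0.
rewrite /rate (bigD1 k)//= Hk eqxx (idle_speed KF Hk) /pw (negbTE rj) powR1 lerDl.
by apply: sumr_ge0 => k' _; case: ifP => // _; case: feasS.
Qed.

Let idle_map_rate j : (n_free S t < K)%N -> prc j -> ismap j ->
  (rr (job j) / K%:R) `^ alpha^-1 <= rate S j t.
Proof.
move=> KF pj mj; have /asboolP[k Hk] := pj.
have b0' : 0 < (bh j)%:R :> R by rewrite ltr0n bh_gt0.
apply: (@le_trans _ _ (speed S t k)).
  rewrite (idle_speed KF Hk) /pw mj.
  have rK0 : 0 <= rr (job j) / K%:R by rewrite divr_ge0.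
  apply: ge0_ler_powR; rewrite ?nnegrE ?invr_ge0 ?(ltW a0)// ?divr_ge0//.
  rewrite ler_pdivlMr// mulrAC ler_pdivrMr//.
  apply: ler_pM => //; last by rewrite ler_nat geq_minr.
  by rewrite ler_nat addSn addSn leqW// -addnA leq_addr.
rewrite /rate (bigD1 k)//= Hk eqxx lerDl.
by apply: sumr_ge0 => k' _; case: ifP => // _; case: feasS.
Qed.

Let Ev i : R := (12 + 4 * (alpha - 1) * beta) * (K%:R - 1) * rr i.

Let idle_rate a : (n_free S t < K)%N -> 0 <= a -> ((1 < K)%N -> 2 * (alpha - 1) * beta <= a) ->
  n + PA + 2 * (C * sigma * dhinge N f M) - ecoef K alpha * (\sum_j rate S j t)
    - \sum_(i | active i) Ev i <= a * no + 2 * beta * Po.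
Proof.
move=> KF a_ge0 a_large.
have am : 0 <= alpha - 1 by rewrite subr_ge0 ltW.
have Po0 : 0 <= beta * Po by rewrite mulr_ge0 ?(ltW b0)// sumr_ge0// => k _; exact: powR_ge0.
have ano : 0 <= a * no by rewrite mulr_ge0.
(* A single idle server means that no task is free; then no map task is open, no reduce task is
   caged, and [n = 0]. *)
have [K1|K1] := leqP K 1.
  have KE : K%:R = 1 :> R by rewrite (_ : K = 1%N)//; apply/eqP; rewrite eqn_leq K1.
  have nf0 : n_free S t = 0%N by apply/eqP; rewrite -leqn0 -ltnS (leq_trans KF).
  have act0 i : active i = false.
    apply/negbTE/negP => /existsP[j /and3P[mj ji uj]].
    have /asboolP pj : prc j by apply: idle_prc => //; left.
    have := prc_count KF; rewrite nf0 (bigD1 j)//= /prc.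
    by rewrite (_ : `[< processed S j t >] = true)//; exact/asboolP.
  have sum0 (g : 'I_(nJ I) -> R) : \sum_(i | active i) g i = 0 by apply: big_pred0.
  have n0 : n <= 0 by have := n_le_active KF; rewrite nf0 sum0 addr0.
  have nfr0 : nfr <= 0.
    rewrite -[leRHS](_ : (n_free S t)%:R = 0) ?nf0// -[in leRHS]nf0 -(prc_count KF) natr_sum.
    by apply: ler_sum => j _; case: (ismap j) => //=; rewrite mul0r.
  have := PA_le KF; rewrite !sum0 addr0 => HP.
  rewrite dhinge_le0; last by apply: le_trans M_le _; rewrite pmulr_rle0.
  have e0 : 0 <= ecoef K alpha * \sum_j rate S j t.
    rewrite mulr_ge0//; last by apply: sumr_ge0 => j _; exact: rate_ge0.
    by rewrite /ecoef KE subrr mulr0 mul0r addr0.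
  by lra.
pose Rs := \sum_(i | active i) rr i.
have Rs0 : 0 <= Rs by apply: sumr_ge0 => i _; apply: le_trans (rr1 i).
have K2 : 2 <= K%:R :> R by rewrite (ler_nat _ 2 K).
have Hn : n <= (n_free S t)%:R + Rs by exact: n_le_active.
have Hf : (n_free S t)%:R <= nfr + K%:R * Rs by rewrite mulr_sumr; exact: n_free_split.
have HP : PA <= nfr + 4 * K%:R * Rs by rewrite mulr_sumr; exact: PA_le.
have HK : (n_free S t)%:R <= K%:R :> R by rewrite ler_nat ltnW.
have HE : \sum_(i | active i) Ev i = (12 + 4 * (alpha - 1) * beta) * (K%:R - 1) * Rs by rewrite mulr_sumr.
have Hr := nfr_le KF.
have nfr0 : 0 <= nfr by apply: sumr_ge0.
(* Each free reduce task is charged once in [n] and once in the power, and runs at speed 1. *)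
have He : 2 * nfr <= ecoef K alpha * \sum_j rate S j t.
  apply: ler_pM => //; rewrite /ecoef -lerBlDl ler_pdivlMr//.
  by have := alpha_gt1; nra.
have KRs : Rs <= K%:R * Rs by rewrite ler_peMl//; lra.
have KRs2 : K%:R * Rs <= 2 * (K%:R - 1) * Rs by apply: ler_wpM2r => //; lra.
have H1 := opt_price_sum.
(* Fewer than [K] free tasks give [n <= K + Rs]; in the product with [Num.min no K] the minimum is
   bounded by [no] against [K] and by [K] against [Rs]. *)
have H2 : (alpha - 1) * lam / K%:R * pos M * Num.min no K%:R <= (alpha - 1) * beta * (no + Rs).
  have nn0 : 0 <= n by [].
  have posM : pos M <= beta * n.
    have bn0 : 0 <= beta * n by rewrite mulr_ge0 ?(ltW b0).
    by rewrite -(pos_of_ge0 bn0); apply: le_pos; exact: M_le.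
  have mn0 : 0 <= Num.min no K%:R by rewrite le_min no_ge0 ltW.
  apply: (@le_trans _ _ ((alpha - 1) * (beta * (n / K%:R * Num.min no K%:R)))).
    have lM : lam * pos M <= beta * n.
      by apply: le_trans posM; apply: ler_piMl => //; exact: pos_ge0.
    have -> : (alpha - 1) * lam / K%:R * pos M * Num.min no K%:R =
      lam * pos M * ((alpha - 1) / K%:R * Num.min no K%:R) by ring.
    have -> : (alpha - 1) * (beta * (n / K%:R * Num.min no K%:R)) =
      beta * n * ((alpha - 1) / K%:R * Num.min no K%:R) by ring.
    by apply: ler_wpM2r => //; rewrite mulr_ge0// divr_ge0// ltW.
  rewrite -[leRHS]mulrA; apply: ler_wpM2l => //; apply: ler_wpM2l; first exact: (ltW b0).
  rewrite mulrAC ler_pdivrMr//.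
  have mno : Num.min no K%:R <= no by rewrite ge_min lexx.
  have mK : Num.min no K%:R <= K%:R by rewrite ge_min lexx orbT.
  have E1 : n * Num.min no K%:R <= (K%:R + Rs) * Num.min no K%:R by apply: ler_wpM2r => //; lra.
  have E2 : K%:R * Num.min no K%:R <= K%:R * no by apply: ler_wpM2l => //; exact: ltW.
  have E3 : Rs * Num.min no K%:R <= Rs * K%:R by apply: ler_wpM2l.
  by lra.
have H3 : 2 * (alpha - 1) * beta * no <= a * no by apply: ler_wpM2r => //; exact: a_large.
have H5 : (alpha - 1) * beta * Rs <= (alpha - 1) * beta * (2 * (K%:R - 1) * Rs).
  by apply: ler_wpM2l; [rewrite mulr_ge0 ?(ltW b0)|exact: le_trans KRs KRs2].
lra.
Qed.

(** * Drift of the whole potential *)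

Let mx (i : 'I_(nJ I)) := max_map y i.

Let coef_ge0 (i : 'I_(nJ I)) : 0 <= job_coef K alpha i.
Proof. exact: job_coef_ge0. Qed.

Let v i := (rr i / K%:R) `^ alpha^-1.

Let job_coef_v (i : 'I_(nJ I)) : job_coef K alpha i * v i = Ev i.
Proof.
have r0 : 0 < rr i by exact: lt_le_trans (rr1 i).
rewrite /job_coef /v -mulrA -powRM ?divr_ge0//.
rewrite (_ : K%:R / (nreduce i)%:R * (rr i / K%:R) = 1); first by rewrite powR1 mulr1.
by rewrite -/(rr i) mulrA divfK ?(gt_eqF r0)// divff ?(gt_eqF K0).
Qed.

Let max_map_le d (i : 'I_(nJ I)) : 0 <= d -> max_map (yd d) i <= mx i.
Proof.
move=> d0; apply: le_bigmax2 => j _.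
by have /andP[] := yd_le j d0.
Qed.

Let linear d : Prop := forall j, rate S j t * d <= y j.

Let ex_linear : exists2 eta : R, 0 < eta & forall d, 0 < d < eta -> linear d.
Proof.
apply: (@ex_common_eta R _ (fun j d => rate S j t * d <= y j)) => j.
have [pj|pj] := boolP (prc j); last first.
  by exists 1 => // d _; rewrite (rate_prc pj) mul0r y_ge0.
have yj0 : 0 < y j by have [+ _] := prc_unf pj; rewrite unfE => /andP[].
have r1 : 0 < rate S j t + 1 by rewrite ltr_wpDl// rate_ge0.
exists (y j / (rate S j t + 1)); first by rewrite divr_gt0.
move=> d /andP[d0]; rewrite ltr_pdivlMr// => H; apply: ltW; apply: le_lt_trans H.
by rewrite mulrDr mulr1 mulrC lerDl ltW.
Qed.

(** Map tasks are always free, so with an idle server every open map task of the job is served, each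
    at speed at least [v i]; hence their maximum falls at this rate. *)
Let max_map_decr : (n_free S t < K)%N -> exists2 eta : R, 0 < eta & forall d, 0 < d < eta ->
  forall i, active i -> max_map (yd d) i <= mx i - v i * d.
Proof.
move=> KF; have [eta1 eta1_gt0 H1] := ex_linear.
(* The maximum has default value 0, so the bound [mx i - v i * d] must stay nonnegative. *)
have [eta2 eta2_gt0 H2] : exists2 eta : R, 0 < eta & forall d, 0 < d < eta ->
    forall i, active i -> v i * d <= mx i.
  apply: (@ex_common_eta R _ (fun i d => active i -> v i * d <= mx i)) => i.
  have [ai|ai] := boolP (active i); last by exists 1.
  have mx0 : 0 < mx i.
    have /existsP[j /and3P[mj ji uj]] := ai.
    have yj0 : 0 < y j by move: uj; rewrite unfE => /andP[].
    by apply: lt_le_trans yj0 _; apply: (@le_bigmax_cond _ _ _ _ j (fun j => ismap j && (job j == i))); rewrite mj.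
  have v1 : 0 < v i + 1 by rewrite ltr_wpDl// powR_ge0.
  exists (mx i / (v i + 1)); first by rewrite divr_gt0.
  move=> d /andP[d0]; rewrite ltr_pdivlMr// => H _; apply: ltW; apply: le_lt_trans H.
  by rewrite mulrDr mulr1 mulrC lerDl ltW.
exists (Num.min eta1 eta2); first by rewrite lt_min eta1_gt0.
move=> d; rewrite lt_min => /and3P[d0 d1 d2] i ai.
have lin : linear d by apply: H1; rewrite d0.
have vd : v i * d <= mx i by apply: H2 => //; rewrite d0.
apply: bigmax_le; first by rewrite subr_ge0.
move=> j /andP[mj /eqP ji].
have ymx : y j <= mx i.
  by apply: (@le_bigmax_cond _ _ _ _ j (fun j => ismap j && (job j == i))); rewrite mj ji eqxx.
rewrite /yd pos_of_ge0 ?subr_ge0//.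
have [yj0|yj0] := ltP 0 (y j); last first.
  have -> : y j = 0 by apply/eqP; rewrite eq_le yj0 y_ge0.
  rewrite sub0r (@le_trans _ _ 0)// ?subr_ge0// oppr_le0 mulr_ge0 ?(ltW d0)//.
  exact: rate_ge0.
have uj : unf j.
  rewrite unfE yj0 andbT ji.
  by have /existsP[j' /and3P[_ /eqP<- uj']] := ai; move: uj'; rewrite unfE => /andP[].
have pj : prc j by apply: idle_prc => //; left.
apply: lerB => //; rewrite ler_pM2r//.
by have := idle_map_rate KF pj mj; rewrite ji.
Qed.

Let G := \sum_j rate S j t.

Let sum_yd d : 0 < d -> linear d -> \sum_j (y j - yd d j) = G * d.
Proof.
move=> d0 lin; rewrite mulr_suml; apply: eq_bigr => j _.
by rewrite /yd pos_of_ge0 ?subr_ge0//; ring.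
Qed.

Let sum_xd d : 0 < d -> 0 <= \sum_j (x j - xd d j) <= sigma * d.
Proof.
move=> d0; apply/andP; split.
  by apply: sumr_ge0 => j _; rewrite subr_ge0; have /andP[] := xd_le j (ltW d0).
rewrite mulr_suml; apply: ler_sum => j _; rewrite /xd.
have r0 : 0 <= rate S' j t * d by rewrite mulr_ge0 ?(ltW d0)// rate_ge0.
case: ifPn => xj0; first by have := pos_gez (x j - rate S' j t * d); lra.
have -> : x j = 0 by apply/eqP; rewrite eq_le x_ge0 leNgt xj0.
by rewrite mul0r sub0r oppr_le0 pos_ge0.
Qed.

Let L := slopes N f.

Let Psi_opt_drift d : 0 < d -> Psi N f wr y (xd d) - Psi N f wr y x <=
  (dhinge N f M * sigma) * d + (L / wr * sigma ^+ 2) * d ^+ 2.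
Proof.
move=> d0; have /andP[s0 s1] := sum_xd d0.
apply: le_trans (opt_step d0) _.
have xdx j : xd d j <= x j by have /andP[] := xd_le j (ltW d0).
have u0 := excess_ge0 wr0 xdx.
have L0 : 0 <= L by exact: (slopes_ge0 N f_homo).
have u1 : excess wr x (xd d) <= sigma * d / wr.
  by apply: le_trans (excess_le wr0 xdx) _; rewrite ler_pM2r ?invr_gt0.
apply: (@le_trans _ _ ((dhinge N f M + L * (sigma * d / wr)) * (sigma * d))); last first.
  by rewrite le_eqVlt; apply/orP; left; apply/eqP; ring.
apply: ler_pM => //; first exact: (dhinge_ge0 N f_homo).
apply: le_trans (dhinge_lipschitz N f_homo M u0) _.
by rewrite lerD2l; apply: ler_wpM2l.
Qed.

Let Psi_alg_drift d : (K <= n_free S t)%N -> 0 < d -> linear d ->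
  Psi N f wr (yd d) x - Psi N f wr y x <=
  - (dhinge N f m * G) * d + (L / wr * G ^+ 2) * d ^+ 2.
Proof.
move=> KF d0 lin.
apply: le_trans (alg_step KF d0) _.
have ydy j : yd d j <= y j by have /andP[] := yd_le j (ltW d0).
have u0 := excess_ge0 wr0 ydy.
have L0 : 0 <= L by exact: (slopes_ge0 N f_homo).
have := excess_le wr0 ydy; rewrite sum_yd// => u1.
have G0 : 0 <= G * d by rewrite mulr_ge0 ?(ltW d0)// sumr_ge0// => j _; exact: rate_ge0.
have := dhinge_lipschitz N f_homo (m - excess wr y (yd d)) u0; rewrite subrK => H.
have H2 : dhinge N f m - L * (G * d / wr) <= dhinge N f (m - excess wr y (yd d)).
  have : L * excess wr y (yd d) <= L * (G * d / wr) by apply: ler_wpM2l.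
  rewrite -/L in H; lra.
have H3 := ler_wpM2r G0 H2.
rewrite mulNr; move: H3.
have -> : (dhinge N f m - L * (G * d / wr)) * (G * d) =
   dhinge N f m * G * d - L / wr * G ^+ 2 * d ^+ 2 by ring.
rewrite mulNr; lra.
Qed.

Lemma Phi_drift a : 2 * beta + 2 * alpha - 2 <= a ->
  ((1 < K)%N -> 2 * (alpha - 1) * beta <= a) ->
  exists2 Q : R, 0 <= Q & exists2 eta : R, 0 < eta & forall d, 0 < d < eta ->
    Phi K N alpha (yd d) (xd d) - Phi K N alpha y x <=
    (a * no + 2 * beta * Po - n - PA) * d + Q * d ^+ 2.
Proof.
move=> a1 a2.
have a_ge0 : 0 <= a by have := b1; have := alpha_gt1; lra.
have L0 : 0 <= L by exact: (slopes_ge0 N f_homo).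
have C0 := ltW C_gt0.
(* During a step of length [d] the excess moves by at most [sigma * d / wr] or [G * d / wr], which
   shifts the price by at most [L] times as much; multiplied by the work done this gives the
   quadratic error. *)
exists (2 * (C * (L / wr * sigma ^+ 2 + L / wr * G ^+ 2))).
  have Lw : 0 <= L / wr by rewrite divr_ge0// (ltW wr0).
  by do 2 apply: mulr_ge0 => //; apply: addr_ge0; apply: mulr_ge0 => //; exact: sqr_ge0.
have PhiE (z w : task -> R) : Phi K N alpha z w = 2 * (C * Psi N f wr z w) + ecoef K alpha * (\sum_j z j) +
   \sum_(i < nJ I) job_coef K alpha i * max_map z i by [].
have [eta1 eta1_gt0 H1] := ex_linear.
have sumE d : \sum_j yd d j = \sum_j y j - \sum_j (y j - yd d j) by rewrite sumrB; ring.
have Psi_diff d : 0 < d -> Psi N f wr (yd d) (xd d) - Psi N f wr y x <=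
    (Psi N f wr (yd d) x - Psi N f wr y x) +
    ((dhinge N f M * sigma) * d + (L / wr * sigma ^+ 2) * d ^+ 2).
  move=> d0.
  have ydy j : yd d j <= y j by have /andP[] := yd_le j (ltW d0).
  have xdx j : xd d j <= x j by have /andP[] := xd_le j (ltW d0).
  have HS := le_trans (Psi_submodular N f_homo wr0 ydy xdx) (Psi_opt_drift d0).
  by rewrite -lerBlDl opprB addrA subrK.
have G0 : 0 <= G by apply: sumr_ge0 => j _; exact: rate_ge0.
have [KF|KF] := leqP K (n_free S t).
  exists eta1 => // d /andP[d0 d1].
  have lin : linear d by apply: H1; rewrite d0.
  rewrite !PhiE sumE sum_yd//.
  have Hm : \sum_(i < nJ I) job_coef K alpha i * max_map (yd d) i <= \sum_(i < nJ I) job_coef K alpha i * max_map y i.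
    by apply: ler_sum => i _; apply: ler_wpM2l => //; exact: max_map_le (ltW d0).
  have HP := Psi_diff d d0.
  have HA := Psi_alg_drift KF d0 lin.
  have HR := busy_rate KF.
  have HG := rate_sum_busy KF.
  have HPC : C * (Psi N f wr (yd d) (xd d) - Psi N f wr y x) <=
     C * (- (dhinge N f m * G) * d + (L / wr * G ^+ 2) * d ^+ 2 +
     ((dhinge N f M * sigma) * d + (L / wr * sigma ^+ 2) * d ^+ 2)).
    by apply: ler_wpM2l => //; apply: le_trans HP _; rewrite lerD2r.
  have HRd := ler_wpM2r (ltW d0) HR.
  have e0 : 0 <= ecoef K alpha by exact: ecoef_ge0.
  have HGe : (ecoef K alpha * (K%:R * sA)) * d <= ecoef K alpha * (G * d).
    by rewrite -mulrA; apply: ler_wpM2l => //; apply: ler_wpM2r => //; exact: ltW.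
  have HGC : (C * (K%:R * sA) * dhinge N f m) * d <= C * (dhinge N f m * G) * d.
    apply: ler_wpM2r; first exact: ltW.
    rewrite -mulrA; apply: ler_wpM2l => //; rewrite mulrC; apply: ler_wpM2l => //.
    exact: (dhinge_ge0 N f_homo).
  have Hano : (2 * beta + 2 * alpha - 2) * no * d <= a * no * d.
    apply: ler_wpM2r; first exact: ltW.
    by apply: ler_wpM2r.
  exact: drift_arith_busy HPC HRd HGe HGC Hano Hm.
(* With an idle server the algorithm's own work is only known not to raise [Psi]; the other two
   terms of the potential pay instead. *)
have [eta2 eta2_gt0 H2] := max_map_decr KF.
exists (Num.min eta1 eta2); first by rewrite lt_min eta1_gt0.
move=> d; rewrite lt_min => /and3P[d0 d1 d2].
have lin : linear d by apply: H1; rewrite d0.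
rewrite !PhiE sumE sum_yd//.
have Hm : \sum_(i < nJ I) job_coef K alpha i * max_map (yd d) i <=
    \sum_(i < nJ I) job_coef K alpha i * max_map y i - (\sum_(i | active i) Ev i) * d.
  rewrite mulr_suml [X in _ - X]big_mkcond -sumrB; apply: ler_sum => i _.
  case: ifPn => ai; last by rewrite subr0; apply: ler_wpM2l => //; exact: max_map_le (ltW d0).
  rewrite -job_coef_v -mulrA -mulrBr; apply: ler_wpM2l => //.
  by apply: H2 => //; rewrite d0.
have HP := Psi_diff d d0.
have HA : Psi N f wr (yd d) x <= Psi N f wr y x.
  by apply: le_Psi => // j; have /andP[] := yd_le j (ltW d0).
have HRd := ler_wpM2r (ltW d0) (idle_rate KF a_ge0 a2).
have HPC : C * (Psi N f wr (yd d) (xd d) - Psi N f wr y x) <=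
   C * ((dhinge N f M * sigma) * d + (L / wr * sigma ^+ 2) * d ^+ 2).
  by apply: ler_wpM2l => //; apply: le_trans HP _; rewrite gerDr subr_le0.
have Gd : 0 <= C * (L / wr * G ^+ 2) * d ^+ 2.
  apply: mulr_ge0; last exact: sqr_ge0.
  by do 2 apply: mulr_ge0 => //; [rewrite divr_ge0// (ltW wr0)|exact: sqr_ge0].
exact: drift_arith_idle HPC HRd Gd Hm.
Qed.

(** Each server doing useful work has speed [s <= 1 + s ^ alpha], and at most [no] servers do. *)
Lemma opt_drain d : 0 < d -> \sum_j (x j - xd d j) <= (no + Po) * d.
Proof.
move=> d0; have /andP[_ s1] := sum_xd d0; apply: le_trans s1 _.
rewrite ler_pM2r//; apply: (@le_trans _ _ (\sum_k (act k)%:R + Po)); last first.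
  by rewrite lerD2r; apply: le_trans act_min _; rewrite ge_min lexx.
rewrite sigmaE -big_split; apply: ler_sum => k _ /=.
have pw0 := powR_ge0 (speed S' t k) alpha.
case: (act k) => /=; last by rewrite add0r.
have [s1'|s1'] := leP (speed S' t k) 1; first by rewrite (le_trans s1')// lerDl.
have sp : speed S' t k <= speed S' t k `^ alpha := le1r_powR (ltW s1') (ltW alpha_gt1).
by rewrite (le_trans sp)// lerDr.
Qed.

End snapshot.

(** * Integration along the schedules *)

Section measurability.
Variables (R : realType) (I : instance R) (K : nat) (S : schedule I K) (alpha : R).
Local Notation mu := (@lebesgue_measure R).
Local Notation task := 'I_(nT I).
Hypothesis feasS : feasible S.
Hypothesis alpha_gt1 : 1 < alpha.

Definition power t : R := \sum_(k < K) powR (speed S t k) alpha.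
Definition unfinished_count t : R := (n_unf S t)%:R.

Lemma power_ge0 t : 0 <= power t.
Proof. by apply: sumr_ge0 => k _; exact: powR_ge0. Qed.

Lemma measurable_power : measurable_fun setT power.
Proof.
apply: measurable_sum => k; case: feasS => _ [+ _] => /(_ k) mk.
exact: measurableT_comp (measurable_powR alpha) mk.
Qed.

Lemma measurable_rate (j : task) : measurable_fun setT (rate S j).
Proof.
apply: measurable_sum => k; case: feasS => _ [+ [+ _]] => /(_ k) mk /(_ k j) ma.
have -> : (fun t => if assign S t k == Some j then speed S t k else 0) =
    (fun t => \1_[set t | assign S t k = Some j] t * speed S t k).
  apply/funext => t; rewrite indicE; case: ifPn => [/eqP H|/eqP H].
    by rewrite mem_set// mul1r.
  by rewrite memNset// mul0r.
exact: measurable_funM (measurable_indic ma) mk.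
Qed.

Lemma rate_le_power (j : task) t : rate S j t <= K%:R + power t.
Proof.
have -> : K%:R + power t = \sum_(k < K) (1 + speed S t k `^ alpha).
  by rewrite big_split/= sumr_const card_ord.
apply: ler_sum => k _.
have s0 : 0 <= speed S t k by case: feasS.
have p0 := powR_ge0 (speed S t k) alpha.
case: ifP => _; last by rewrite addr_ge0.
have [s1|s1] := leP (speed S t k) 1; first by rewrite (le_trans s1)// lerDl.
have sp : speed S t k <= speed S t k `^ alpha := le1r_powR (ltW s1) (ltW alpha_gt1).
by rewrite (le_trans sp)// lerDr.
Qed.

Lemma integrable_rate A T (j : task) : mu.-integrable `[A, T] (EFin \o power) ->
  mu.-integrable `[A, T] (EFin \o rate S j).
Proof.
move=> intp.
have intK : mu.-integrable `[A, T] (EFin \o (fun=> K%:R : R)).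
  by apply: (@integrable_bounded _ _ A T K%:R) => // x; rewrite ger0_norm.
have intg : mu.-integrable `[A, T] (EFin \o (fun t => K%:R + power t)).
  exact: integrable_EFinD.
apply: le_integrable intg => //.
  by apply/measurable_EFinP; apply: measurable_funTS; exact: measurable_rate.
move=> x _ /=; rewrite lee_fin !ger0_norm ?rate_ge0 ?addr_ge0 ?power_ge0//.
exact: rate_le_power.
Qed.

(** The times at which a task is unfinished form an interval, because a finished task stays
    finished. *)
Lemma measurable_unfinished_count A : (forall i : 'I_(nJ I), A <= Defs.rel i) ->
  (forall j T, mu.-integrable `[A, T] (EFin \o rate S j)) ->
  measurable_fun setT unfinished_count.
Proof.
move=> Arel intr.
have -> : unfinished_count = fun t => \sum_(j < nT I) \1_[set t | unfinished S j t] t.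
  apply/funext => t; rewrite /unfinished_count /n_unf natr_sum.
  apply: eq_bigr => j _; rewrite indicE; congr (nat_of_bool _)%:R.
  by apply/idP/idP => [|]; rewrite inE.
apply: measurable_sum => j; apply: measurable_indic; apply: is_interval_measurable.
move=> a b /= ua ub c /andP[ac cb].
move: ua ub => /asboolP[ra _] /asboolP[rb nfb]; apply/asboolP; split.
  by rewrite /released (le_trans ra).
move=> fc; apply: nfb; apply: (@finished_le _ _ _ _ A) fc => //.
by rewrite (le_trans (Arel (job j)))// (le_trans ra).
Qed.

Lemma unfinished_count_le t : unfinished_count t <= (nT I)%:R.
Proof.
rewrite ler_nat /n_unf -[leqRHS]card_ord -sum1_card; apply: leq_sum => j _.
by case: unfinished.
Qed.

Lemma integrable_unfinished_count A T : (forall i : 'I_(nJ I), A <= Defs.rel i) ->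
  (forall j T, mu.-integrable `[A, T] (EFin \o rate S j)) ->
  mu.-integrable `[A, T] (EFin \o unfinished_count).
Proof.
move=> Arel intr; apply: (@integrable_bounded _ _ A T (nT I)%:R).
  exact: measurable_unfinished_count Arel intr.
by move=> t; rewrite ger0_norm ?unfinished_count_le.
Qed.

Lemma costE : cost S alpha = (\int[mu]_(t in setT) (unfinished_count t)%:E +
  \int[mu]_(t in setT) (power t)%:E)%E.
Proof. by []. Qed.

End measurability.

Section algorithm_power.
Variables (R : realType) (I : instance R) (K : nat) (S : schedule I K) (alpha : R).
Local Notation mu := (@lebesgue_measure R).
Hypothesis feasS : feasible S.
Hypothesis alpha_gt1 : 1 < alpha.

Let divn_le (m n : nat) : m%:R / n%:R <= m%:R :> R.
Proof.
case: n => [|n]; first by rewrite invr0 mulr0.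
by rewrite ler_pdivrMr// ler_peMr// ler1n.
Qed.

(** Finiteness of the algorithm's cost belongs to the conclusion, so the integrability of its speeds
    on bounded intervals is drawn from the speed rule itself. *)
Lemma alg_power_bounded t : alg_rule S alpha t ->
  power S alpha t <= K%:R * (nT I + K + 3)%:R.
Proof.
move=> [_ [_ [_ [busy idle]]]]; have a0 := lt_trans ltr01 alpha_gt1.
apply: (@le_trans _ _ (\sum_(k < K) (nT I + K + 3)%:R)); last first.
  by rewrite sumr_const card_ord -[leLHS]mulr_natl.
have pK (z : R) : 0 <= z -> (z `^ alpha^-1) `^ alpha = z.
  by move=> z0; rewrite -powRrM mulVf ?gt_eqF// powRr1.
apply: ler_sum => k _; have [KF|KF] := leqP K (n_free S t).
  rewrite (busy KF) pK ?divr_ge0//; apply: le_trans (divn_le _ _) _.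
  have := unfinished_count_le S t; rewrite /unfinished_count !ler_nat; lia.
have [none some] := idle KF.
case E : (assign S t k) => [j|]; last by rewrite (none _ E) powR0// gt_eqF.
rewrite (some _ _ E); case: ifP => _; rewrite pK ?divr_ge0//.
  apply: le_trans (divn_le _ _) _; rewrite ler_nat.
  have : (nreduce (job j) <= nT I)%N.
    rewrite /nreduce -[leqRHS]card_ord -sum1_card; apply: leq_sum => i _.
    by case: (_ && _).
  have := geq_minr (bmap S j t) K; lia.
by rewrite ler1n; lia.
Qed.

Lemma integrable_alg_power A T : follows_alg S alpha ->
  mu.-integrable `[A, T] (EFin \o power S alpha).
Proof.
move=> alg; have mp := measurable_power alpha feasS.
apply/integrableP; split; first by apply/measurable_EFinP; exact: measurable_funTS.
apply: (@le_lt_trans _ _ (\int[mu]_(t in `[A, T]) (cst (K%:R * (nT I + K + 3)%:R)%:E t))%E).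
  apply: ae_ge0_le_integral => //.
  - by apply/measurableT_comp => //; apply/measurable_EFinP; exact: measurable_funTS.
  - by move=> t _; rewrite lee_fin mulr_ge0.
  - apply: (ae_mp alg) => t /alg_power_bounded H _.
    by rewrite /= lee_fin ger0_norm ?power_ge0.
rewrite integral_cst//= ltey_eq fin_numM//.
by rewrite ge0_fin_numE ?lebesgue_measure_itvcc.
Qed.

End algorithm_power.

(** * Lipschitz dependence of the potential on the work vectors *)

Section potential_lipschitz.
Variables (R : realType) (I : instance R) (K N : nat) (alpha : R).
Hypothesis K_gt0 : (0 < K)%N.
Hypothesis wfI : wf_instance I.
Hypothesis nT_gt0 : (0 < nT I)%N.
Hypothesis alpha_gt1 : 1 < alpha.
Implicit Types x y : 'I_(nT I) -> R.

Definition Phi_lip : R := 2 * (price_scale K alpha * slopes N (rank_price alpha)) +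
  ecoef K alpha + \sum_(i < nJ I) job_coef K alpha i.

Lemma Phi_lip_ge0 : 0 <= Phi_lip.
Proof.
apply: addr_ge0; last by apply: sumr_ge0 => i _; exact: job_coef_ge0.
apply: addr_ge0; last exact: ecoef_ge0.
by do 2?apply: mulr_ge0 => //; [exact: price_scale_ge0|exact: (slopes_ge0 N (rank_price_homo alpha_gt1))].
Qed.

Lemma max_map_lipschitz y y' (i : 'I_(nJ I)) :
  max_map y i <= max_map y' i + \sum_j `|y j - y' j|.
Proof.
apply: bigmax_le.
  by rewrite addr_ge0 ?bigmax_ge_id//; apply: sumr_ge0.
move=> j Pj; have H : y' j <= max_map y' i by exact: le_bigmax_cond.
have : `|y j - y' j| <= \sum_j `|y j - y' j| by rewrite (bigD1 j)//= lerDl sumr_ge0.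
have := ler_norm (y j - y' j); lra.
Qed.

Lemma Phi_lipschitz y x y' x' :
  (forall j, 0 <= y j) -> (forall j, 0 <= y' j) -> (forall j, 0 <= x j) -> (forall j, 0 <= x' j) ->
  Phi K N alpha y x - Phi K N alpha y' x' <=
  Phi_lip * \sum_j (`|y j - y' j| + `|x j - x' j|).
Proof.
move=> y0 y'0 x0 x'0; set Sm := \sum_j _.
have H1 : price_scale K alpha * (Psi N (rank_price alpha) (wredmin I) y x -
    Psi N (rank_price alpha) (wredmin I) y' x') <=
    price_scale K alpha * (slopes N (rank_price alpha) * Sm).
  apply: ler_wpM2l; first exact: price_scale_ge0.
  by apply: Psi_lipschitz => //; [exact: rank_price_homo|exact: wredmin_gt0].
have yS : \sum_j `|y j - y' j| <= Sm by apply: ler_sum => j _; rewrite lerDl.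
have H2 : ecoef K alpha * (\sum_j y j - \sum_j y' j) <= ecoef K alpha * Sm.
  apply: ler_wpM2l; first exact: ecoef_ge0.
  rewrite -sumrB; apply: le_trans yS; apply: ler_sum => j _; exact: ler_norm.
have H3 : \sum_i job_coef K alpha i * max_map y i - \sum_i job_coef K alpha i * max_map y' i <=
    (\sum_(i < nJ I) job_coef K alpha i) * Sm.
  rewrite -sumrB mulr_suml; apply: ler_sum => i _; rewrite -mulrBr.
  apply: ler_wpM2l; first exact: job_coef_ge0.
  by have := max_map_lipschitz y y' i; lra.
rewrite /Phi /Phi_lip; move: H1 H2 H3.
set Z1 := Psi _ _ _ _ _; set Z2 := Psi _ _ _ _ _; set E1 := \sum_i _; set E2 := \sum_i _.
set E3 := \sum_(i < nJ I) _; set E4 := \sum_j y j; set E5 := \sum_j y' j.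
by lra.
Qed.

Lemma Phi_ge0 y x : (forall j, 0 <= y j) -> 0 <= Phi K N alpha y x.
Proof.
move=> y0; apply: addr_ge0; last first.
  by apply: sumr_ge0 => i _; rewrite mulr_ge0 ?job_coef_ge0 ?bigmax_ge_id.
apply: addr_ge0; last by rewrite mulr_ge0 ?ecoef_ge0 ?sumr_ge0.
by do 2?apply: mulr_ge0 => //; [exact: price_scale_ge0|apply: Psi_ge0; exact: rank_price_homo].
Qed.

End potential_lipschitz.

(** * Integrating the drift over a time interval *)

Section trajectory.
Variables (R : realType) (I : instance R) (K : nat) (S S' : schedule I K) (A T alpha : R).
Local Notation mu := (@lebesgue_measure R).
Local Notation task := 'I_(nT I).
Local Notation beta := (Defs.beta I).
Hypothesis K_gt0 : (0 < K)%N.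
Hypothesis wfI : wf_instance I.
Hypothesis nT_gt0 : (0 < nT I)%N.
Hypothesis alpha_gt1 : 1 < alpha.
Hypothesis feasS : feasible S.
Hypothesis feasS' : feasible S'.
Hypothesis A_le_rel : forall i : 'I_(nJ I), A <= Defs.rel i.
Hypothesis AT : A <= T.
Hypothesis algS : follows_alg S alpha.
Hypothesis int_power' : mu.-integrable setT (EFin \o power S' alpha).

Let y t (j : task) := remw S A j t.
Let x t (j : task) := remw S' A j t.

Let int_power : forall T, mu.-integrable `[A, T] (EFin \o power S alpha).
Proof. by move=> T'; apply: integrable_alg_power. Qed.

Let int_power'_itv : forall T, mu.-integrable `[A, T] (EFin \o power S' alpha).
Proof. by move=> T'; apply: integrableS int_power'. Qed.

Let int_rate : forall j T, mu.-integrable `[A, T] (EFin \o rate S j).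
Proof. by move=> j T'; apply: (integrable_rate feasS alpha_gt1). Qed.

Let int_rate' : forall j T, mu.-integrable `[A, T] (EFin \o rate S' j).
Proof. by move=> j T'; apply: (integrable_rate feasS' alpha_gt1). Qed.

Let int_n : mu.-integrable `[A, T] (EFin \o unfinished_count S).
Proof. exact: integrable_unfinished_count. Qed.

Let int_no : mu.-integrable `[A, T] (EFin \o unfinished_count S').
Proof. exact: integrable_unfinished_count. Qed.

(** Times at which the rule holds and all remaining works of both schedules agree to first order
    with their linear extrapolations; the tolerance [eta] is common to all tasks. *)
Let good_at t := alg_rule S alpha t /\ (A < t < T -> forall e, 0 < e ->
  exists2 eta, 0 < eta & forall d, 0 < d < eta -> forall j : task,
    `|y (t + d) j - pos (y t j - rate S j t * d)| <= e * d /\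
    `|x (t + d) j - pos (x t j - rate S' j t * d)| <= e * d).

Let ae_good : {ae mu, forall t, good_at t}.
Proof.
have aeS := ae_forall (fun j => ae_right_derivative (int_rate j T)).
have aeS' := ae_forall (fun j => ae_right_derivative (int_rate' j T)).
apply: (ae_mp (ae_and algS (ae_and aeS aeS'))) => t [al [dS dS']]; split=> // AtT e e0.
have At : A <= t by case/andP : AtT => /ltW.
have [eta1 eta1_gt0 H1] := ex_common_eta (fun j => dS j AtT e e0).
have [eta2 eta2_gt0 H2] := ex_common_eta (fun j => dS' j AtT e e0).
exists (Num.min eta1 eta2); first by rewrite lt_min eta1_gt0.
move=> d; rewrite lt_min => /and3P[d0 d1 d2] j; split.
  apply: le_trans (dist_remw_linear _ _ _ _ _) (H1 d _ j) => //; rewrite ?d0 ?d1//.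
  exact: ltW.
apply: le_trans (dist_remw_linear _ _ _ _ _) (H2 d _ j) => //; rewrite ?d0 ?d2//.
exact: ltW.
Qed.

Let rate_total t := \sum_(j < nT I) (rate S j t + rate S' j t).

Let int_total : mu.-integrable `[A, T] (EFin \o rate_total).
Proof. by apply: integrable_EFin_sum => // j; apply: integrable_EFinD. Qed.

Let rate_total_ge0 t : 0 <= rate_total t.
Proof. by apply: sumr_ge0 => j _; rewrite addr_ge0 ?rate_ge0. Qed.

Let dist_total a b : A <= a -> a <= b -> b <= T ->
  \sum_j (`|y b j - y a j| + `|x b j - x a j|) <= \int[mu]_(s in `]a, b]) rate_total s.
Proof.
move=> Aa ab bT.
have sub (g : R -> R) : mu.-integrable `[A, T] (EFin \o g) -> mu.-integrable `]a, b] (EFin \o g).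
  move=> ig; apply: integrableS ig => //.
  by apply: subset_itv; rewrite bnd_simp.
rewrite Rintegral_sum//; last by move=> j; apply: sub; apply: integrable_EFinD.
apply: ler_sum => j _; rewrite RintegralD//; [|exact: sub|exact: sub].
by apply: lerD; apply: dist_remw_le.
Qed.

Let y_ge0 t j : 0 <= y t j. Proof. exact: remw_ge0. Qed.
Let x_ge0 t j : 0 <= x t j. Proof. exact: remw_ge0. Qed.

Let at_start j : y A j = wsz j /\ x A j = wsz j.
Proof.
have w0 := wsz_gt0 wfI j.
by rewrite /y /x /remw /done set_itv1 !Rintegral_set1 subr0 pos_of_ge0// ltW.
Qed.

(** The derivative criterion is applied to minus the competitor's remaining work, which by
    [opt_drain] grows no faster than the cost accrues. *)
Lemma total_size_le : (forall j, x T j = 0) ->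
  total_size I <= \int[mu]_(t in `[A, T]) (unfinished_count S' t + power S' alpha t).
Proof.
move=> xT.
pose negV t := - \sum_j x t j.
have <- : negV T - negV A = total_size I.
  rewrite /negV [X in - X]big1 ?oppr0 ?add0r ?opprK//.
  by apply: eq_bigr => j _; have [_ ->] := at_start j.
apply: (le_integral_of_ae_dini (Phi := negV) (h := rate_total)) => //.
- by apply: integrable_EFinD.
- move=> a b Aa ab bT; apply: le_trans (dist_total Aa ab bT).
  rewrite /negV opprK addrC -sumrB; apply: ler_sum => j _.
  by have := ler_norm (x a j - x b j); rewrite distrC; have := normr_ge0 (y b j - y a j); lra.
- apply: (ae_mp ae_good) => t [al lin] AtT e e0.
  have At : A <= t by case/andP : AtT => /ltW.
  pose nn : R := (nT I)%:R.
  have nn0 : 0 <= nn by [].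
  have e1 : 0 < e / (nn + 1) by rewrite divr_gt0// ltr_wpDl.
  have [eta eta0 H] := lin AtT _ e1.
  exists eta => // d Hd; have /andP[d0 _] := Hd.
  have D : \sum_j (x t j - pos (x t j - rate S' j t * d)) <=
      (unfinished_count S' t + power S' alpha t) * d by apply: opt_drain.
  have E : \sum_j (pos (x t j - rate S' j t * d) - x (t + d) j) <= e * d.
    apply: (@le_trans _ _ (\sum_(j < nT I) e / (nn + 1) * d)).
      apply: ler_sum => j _; have [_ Hj] := H d Hd j.
      by apply: le_trans (ler_norm _) _; rewrite distrC.
    rewrite sumr_const card_ord -[leLHS]mulr_natl -/nn mulrA ler_pM2r//.
    rewrite mulrA ler_pdivrMr ?ltr_wpDl// mulrC; nra.
  rewrite /negV opprK addrC -sumrB mulrDl.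
  have -> : \sum_j (x t j - x (t + d) j) =
      \sum_j (x t j - pos (x t j - rate S' j t * d)) +
      \sum_j (pos (x t j - rate S' j t * d) - x (t + d) j).
    by rewrite -big_split; apply: eq_bigr => j _ /=; ring.
  exact: lerD.
Qed.

(** The potential is nonnegative at the end, so the algorithm's cost exceeds the integrated
    competitor's share by at most the initial potential. The error [e] of the criterion is split
    between the extrapolation and the quadratic term of [Phi_drift]. *)
Lemma alg_cost_itv a : 2 * beta + 2 * alpha - 2 <= a ->
  ((1 < K)%N -> 2 * (alpha - 1) * beta <= a) ->
  \int[mu]_(t in `[A, T]) (unfinished_count S t + power S alpha t) <=
  ecoef K alpha * total_size I + \sum_(i < nJ I) job_coef K alpha i * wmax I +
  a * \int[mu]_(t in `[A, T]) (unfinished_count S' t + power S' alpha t).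
Proof.
move=> a1 a2.
have b1 := beta_ge1 wfI nT_gt0.
have a_ge0 : 0 <= a by have := alpha_gt1; lra.
have [N HN] : exists N : nat, beta * (nT I)%:R < N%:R.
  by exists (Num.trunc (beta * (nT I)%:R)).+1; rewrite truncnS_gt.
pose phi t := Phi K N alpha (y t) (x t).
pose r t := (a * unfinished_count S' t + 2 * beta * power S' alpha t) -
            (unfinished_count S t + power S alpha t).
have int1 : mu.-integrable `[A, T] (EFin \o (fun t => unfinished_count S t + power S alpha t)).
  exact: integrable_EFinD.
have int2 : mu.-integrable `[A, T] (EFin \o (fun t => a * unfinished_count S' t + 2 * beta * power S' alpha t)).
  by apply: integrable_EFinD => //; apply: integrable_EFinZ.
have int2' : mu.-integrable `[A, T] (EFin \o (fun t => unfinished_count S' t + power S' alpha t)).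
  exact: integrable_EFinD.
have int3 : mu.-integrable `[A, T] (EFin \o r).
  rewrite (_ : _ \o _ = EFin \o (fun t => (a * unfinished_count S' t + 2 * beta * power S' alpha t) +
            (-1) * (unfinished_count S t + power S alpha t))).
    by apply: integrable_EFinD => //; apply: integrable_EFinZ.
  by apply/funext => t /=; rewrite mulN1r.
pose L := Phi_lip I K N alpha.
have L0 : 0 <= L by exact: Phi_lip_ge0.
have main : phi T - phi A <= \int[mu]_(t in `[A, T]) r t.
  apply: (le_integral_of_ae_dini (Phi := phi) (h := fun t => L * rate_total t)) => //.
  - by move=> t; rewrite mulr_ge0.
  - by apply: integrable_EFinZ.
  - move=> u v Au uv vT.
    have -> : \int[mu]_(s in `]u, v]) (L * rate_total s) = L * \int[mu]_(s in `]u, v]) rate_total s.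
      apply: RintegralZl => //; apply: integrableS int_total => //.
      by apply: subset_itv; rewrite bnd_simp.
    apply: le_trans (Phi_lipschitz _ _ _ _ _ _ _ _ _) _ => //.
    by apply: ler_wpM2l => //; exact: dist_total.
  - apply: (ae_mp ae_good) => t [al lin] AtT e e0.
    have At : A <= t by case/andP : AtT => /ltW.
    have [Q Q0 [eta1 eta1_gt0 H1]] :=
      Phi_drift K_gt0 wfI nT_gt0 alpha_gt1 feasS feasS' A_le_rel int_rate int_rate' At al HN a1 a2.
    pose nn : R := (nT I)%:R.
    have nn0 : 0 <= nn by [].
    have Ln0 : 0 <= L * (2 * nn) by rewrite !mulr_ge0.
    pose e1 := e / 2 / (L * (2 * nn) + 1).
    have e1_gt0 : 0 < e1 by rewrite !divr_gt0// ltr_wpDl.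
    have [eta2 eta2_gt0 H2] := lin AtT _ e1_gt0.
    pose eta3 := e / 2 / (Q + 1).
    have eta3_gt0 : 0 < eta3 by rewrite !divr_gt0// ltr_wpDl.
    exists (Num.min eta1 (Num.min eta2 eta3)); first by rewrite !lt_min eta1_gt0 eta2_gt0.
    move=> d; rewrite !lt_min => /and4P[d0 d1 d2 d3].
    have Hd1 : 0 < d < eta1 by rewrite d0.
    have Hd2 : 0 < d < eta2 by rewrite d0.
    have := H1 d Hd1.
    set z := fun j => pos (_ - rate S j t * d); set w := fun j => pos (_ - rate S' j t * d).
    move=> D.
    have E : phi (t + d) - Phi K N alpha z w <= e / 2 * d.
      apply: le_trans (Phi_lipschitz _ _ _ _ _ _ _ _ _) _ => //.
      - by move=> j; exact: pos_ge0.
      - by move=> j; exact: pos_ge0.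
      apply: (@le_trans _ _ (L * \sum_(j < nT I) (e1 * d + e1 * d))).
        apply: ler_wpM2l => //; apply: ler_sum => j _.
        by have [Hj1 Hj2] := H2 d Hd2 j; exact: lerD.
      rewrite sumr_const card_ord -[X in L * X]mulr_natl -/nn.
      have -> : L * (nn * (e1 * d + e1 * d)) = L * (2 * nn) * e1 * d by ring.
      rewrite ler_pM2r// /e1 mulrA ler_pdivrMr ?ltr_wpDl// mulrC ler_pM2l ?divr_gt0//.
      by rewrite lerDl.
    have Qd : Q * d ^+ 2 <= e / 2 * d.
      rewrite expr2 mulrA ler_pM2r//.
      have : (Q + 1) * d <= e / 2 by rewrite mulrC -ler_pdivlMr ?ltr_wpDl// ltW.
      by rewrite mulrDl mul1r; lra.
    have rE : r t = a * (n_unf S' t)%:R + 2 * beta * (\sum_(k < K) powR (speed S' t k) alpha) -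
       (n_unf S t)%:R - \sum_(k < K) powR (speed S t k) alpha.
      by rewrite /r opprD addrA.
    rewrite -rE in D.
    have -> : (r t + e) * d = r t * d + e / 2 * d + e / 2 * d by field.
    move: D E; rewrite -/(phi t); set P1 := Phi _ _ _ _ _.
    by move: (phi (t + d)) (phi t) => p1 p0; lra.
have phiT : 0 <= phi T by apply: Phi_ge0.
have phiA : phi A <= ecoef K alpha * total_size I + \sum_(i < nJ I) job_coef K alpha i * wmax I.
  (* Both vectors start at the full sizes, so the [Psi] term vanishes and only the other two terms
     remain. *)
  have yA : y A = wsz (i := I) by apply/funext => j; have [] := at_start j.
  have xA : x A = wsz (i := I) by apply/funext => j; have [] := at_start j.
  rewrite /phi yA xA /Phi Psi_diag mulr0 mulr0 add0r lerD2l; apply: ler_sum => i _.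
  apply: ler_wpM2l; first exact: job_coef_ge0.
  by apply: bigmax_le => [|j _]; [exact: ltW (wmax_gt0 wfI nT_gt0)|exact: wsz_le_wmax].
have H : \int[mu]_(t in `[A, T]) (a * unfinished_count S' t + 2 * beta * power S' alpha t) <=
    a * \int[mu]_(t in `[A, T]) (unfinished_count S' t + power S' alpha t).
  rewrite -RintegralZl//; apply: le_Rintegral => //; first exact: integrable_EFinZ.
  move=> t _; rewrite mulrDr lerD2l; apply: ler_wpM2r; first exact: power_ge0.
  by have := alpha_gt1; lra.
move: main; rewrite [X in _ <= X -> _]RintegralB//.
set X1 := Rintegral _ _ _ in H *; set X2 := Rintegral _ _ (fun t => _ + _).
lra.
Qed.

End trajectory.

(** * Comparison of the costs *)

Section constants.
Variable R : realType.
Implicit Types alpha beta : R.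

(** Share of the ratio reserved for the job terms of the initial potential; these vanish for [K = 1]
    by the factor [K - 1]. *)
Definition slack (K : nat) beta : R := if (1 < K)%N then beta else 0.

Lemma ratio_budget (K : nat) alpha beta : (0 < K)%N -> 1 < alpha -> 1 <= beta ->
  exists a : R, [/\ 2 * beta + 2 * alpha - 2 <= a, ((1 < K)%N -> 2 * (alpha - 1) * beta <= a) &
    a + ecoef K alpha + slack K beta <=
    powR (2 - (K%:R)^-1) alpha * (2 * beta + 2 + 2 * (alpha - 1))].
Proof.
move=> K0 a1 b1; have [K2|K1] := ltnP 1 K; last first.
  have -> : K = 1%N by apply/eqP; rewrite eqn_leq K1.
  exists (2 * beta + 2 * alpha - 2); split=> //.
  rewrite /slack /ecoef /= invr1 (_ : 2 - 1 = 1 :> R); last by lra.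
  by rewrite powR1 subrr mulr0 mul0r; lra.
exists (Num.max (2 * beta + 2 * alpha - 2) (2 * (alpha - 1) * beta)).
rewrite !le_max !lexx orbT; split=> //.
have K2' : 2 <= K%:R :> R by rewrite (ler_nat _ 2 K).
have K0' : 0 < K%:R :> R by lra.
have Ki : K%:R^-1 <= 2^-1 :> R by rewrite lef_pV2 ?posrE.
have e1 : ecoef K alpha <= 1 + 2 * alpha.
  rewrite /ecoef lerD2l ler_pdivrMr//.
  by apply: ler_wpM2l; lra.
(* [X >= alpha] serves the case in which [2 * (alpha - 1) * beta] is the larger candidate for [a],
   and [X >= 1 + alpha / 2] the other one, where the margin is
   [(alpha - 1) ^ 2 + (alpha - 1) * beta]. *)
pose X := (3 / 2) `^ alpha : R.
have XX : X <= powR (2 - (K%:R)^-1) alpha.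
  by apply: ge0_ler_powR; rewrite ?nnegrE; lra.
have X1 : alpha <= X by exact: powR_three_halves.
have X2 : 1 + alpha / 2 <= X.
  have := @powR_bernoulli _ alpha (3 / 2) a1; rewrite divr_ge0// => /(_ isT).
  by rewrite -/X; lra.
have rE : 2 * beta + 2 + 2 * (alpha - 1) = 2 * beta + 2 * alpha by ring.
rewrite rE /slack K2.
have ab : 0 <= 2 * beta + 2 * alpha by lra.
have Y := ler_wpM2r ab XX.
have Y1 := ler_wpM2r ab X1.
have Y2 := ler_wpM2r ab X2.
have [H|H] := leP (2 * beta + 2 * alpha - 2) (2 * (alpha - 1) * beta).
  have : 0 <= (alpha - 1) * alpha by apply: mulr_ge0; lra.
  lra.
have : 0 <= (alpha - 1) * (alpha - 1) by apply: mulr_ge0; lra.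
have : 0 <= (alpha - 1) * beta by apply: mulr_ge0; lra.
lra.
Qed.

(** Each [job_coef] is at most [12 * alpha * beta] times [K ^ 2 * rmax ^ (1 - 1 / alpha)]; summed
    over the jobs with weight [wmax] this is [12 * alpha * beta * scaleQ], and the threshold on
    [scaleQ] leaves [beta * total_size]. *)
Lemma job_coef_sum (I : instance R) (K : nat) alpha : (0 < K)%N -> 1 < alpha ->
  wf_instance I -> (0 < nT I)%N ->
  scaleQ I K alpha <= (12 * alpha)^-1 * total_size I ->
  \sum_(i < nJ I) job_coef K alpha i * wmax I <= slack K (Defs.beta I) * total_size I.
Proof.
move=> K0 a1 wfI nT0 sc.
have b1 := beta_ge1 wfI nT0; set beta := Defs.beta I in b1 *.
have w0 := wmax_gt0 wfI nT0.
rewrite /slack; have [K2|K1] := ltnP 1 K; last first.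
  have KE : K%:R = 1 :> R by rewrite (_ : K = 1%N)//; apply/eqP; rewrite eqn_leq K1.
  by rewrite mul0r big1// => i _; rewrite /job_coef KE subrr mulr0 !mul0r.
have a0 : 0 < alpha by lra.
have ai0 : 0 < alpha^-1 by rewrite invr_gt0.
have ai1 : alpha^-1 < 1 by rewrite invf_lt1.
have K1' : 1 <= K%:R :> R by rewrite ler1n.
have K0' : 0 < K%:R :> R by lra.
apply: (@le_trans _ _ (12 * alpha * beta * scaleQ I K alpha)); last first.
  have -> : beta * total_size I = 12 * alpha * beta * ((12 * alpha)^-1 * total_size I).
    by field; lra.
  apply: ler_wpM2l => //; apply: mulr_ge0; last exact: le_trans ler01 b1.
  by apply: mulr_ge0 => //; exact: ltW.
pose rp := (rmax I)%:R `^ (1 - alpha^-1) : R.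
have rp0 : 0 <= rp by exact: powR_ge0.
have H (i : 'I_(nJ I)) : job_coef K alpha i <= 12 * alpha * beta * (K%:R ^+ 2 * rp).
  have r1 : 1 <= (nreduce i)%:R :> R by rewrite ler1n nreduce_gt0.
  have r0 : 0 < (nreduce i)%:R :> R by lra.
  rewrite /job_coef -/beta.
  have E : (nreduce i)%:R * (K%:R / (nreduce i)%:R) `^ alpha^-1 <= K%:R * rp.
    have -> : (nreduce i)%:R * (K%:R / (nreduce i)%:R) `^ alpha^-1 =
        K%:R `^ alpha^-1 * (nreduce i)%:R `^ (1 - alpha^-1) :> R.
      rewrite powRM ?invr_ge0 ?(ltW r0) ?(ltW K0')// powRD ?(gt_eqF r0) ?implybT//.
      rewrite powRr1 ?(ltW r0)// -(powR_inv1 (ltW r0)) -powRrM mulN1r; ring.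
    apply: ler_pM; rewrite ?powR_ge0//.
      by apply: ler1_powR => //; exact: ltW.
    apply: ge0_ler_powR; rewrite ?nnegrE ?subr_ge0 ?(ltW ai1)//.
    by rewrite ler_nat nreduce_le_rmax.
  have E1 : 12 + 4 * (alpha - 1) * beta <= 12 * alpha * beta.
    have : 1 <= alpha * beta by rewrite mulr_ege1// ltW.
    by lra.
  have E0 : 0 <= 12 + 4 * (alpha - 1) * beta.
    have : 0 <= (alpha - 1) * beta by apply: mulr_ge0; lra.
    by lra.
  have -> : (12 + 4 * (alpha - 1) * beta) * (K%:R - 1) * (nreduce i)%:R *
      (K%:R / (nreduce i)%:R) `^ alpha^-1 =
      (12 + 4 * (alpha - 1) * beta) * ((K%:R - 1) * ((nreduce i)%:R *
      (K%:R / (nreduce i)%:R) `^ alpha^-1)) by ring.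
  have q0 : 0 <= (nreduce i)%:R * (K%:R / (nreduce i)%:R) `^ alpha^-1 by rewrite mulr_ge0 ?powR_ge0.
  have Km : 0 <= K%:R - 1 :> R by rewrite subr_ge0.
  apply: ler_pM => //; first exact: mulr_ge0.
  rewrite expr2 -mulrA; apply: ler_pM => //.
  by rewrite gerBl.
apply: (@le_trans _ _ (\sum_(i < nJ I) 12 * alpha * beta * (K%:R ^+ 2 * rp) * wmax I)).
  by apply: ler_sum => i _; apply: ler_wpM2r => //; exact: ltW.
rewrite sumr_const card_ord -[leLHS]mulr_natl /scaleQ -/rp.
by rewrite le_eqVlt; apply/orP; left; apply/eqP; ring.
Qed.

End constants.

(** * From bounded intervals to the whole time axis *)

Section competitive.
Variables (R : realType) (I : instance R) (K : nat) (S S' : schedule I K) (alpha : R).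
Local Notation mu := (@lebesgue_measure R).
Hypothesis K_gt0 : (0 < K)%N.
Hypothesis wfI : wf_instance I.
Hypothesis nT_gt0 : (0 < nT I)%N.
Hypothesis alpha_gt1 : 1 < alpha.
Hypothesis feasS : feasible S.
Hypothesis feasS' : feasible S'.
Hypothesis algS : follows_alg S alpha.
Hypothesis cost_fin : (cost S' alpha < +oo)%E.

Let ex_start : exists N0 : nat, forall N, (N0 <= N)%N ->
  forall i : 'I_(nJ I), - N%:R <= Defs.rel i.
Proof.
exists (Num.trunc (\sum_(i < nJ I) `|Defs.rel i|)).+1 => N NN i.
have H : `|Defs.rel i| <= \sum_(i < nJ I) `|Defs.rel i|.
  by rewrite (bigD1 i)//= lerDl sumr_ge0.
have H2 := truncnS_gt (\sum_(i < nJ I) `|Defs.rel i|).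
have H3 : (Num.trunc (\sum_(i < nJ I) `|Defs.rel i|)).+1%:R <= N%:R :> R by rewrite ler_nat.
have := ler_norm (- Defs.rel i); rewrite normrN; lra.
Qed.

Let n' := unfinished_count S'.
Let p' := power S' alpha.

Let n'_ge0 t : (0 <= (n' t)%:E)%E. Proof. by rewrite lee_fin. Qed.
Let p'_ge0 t : (0 <= (p' t)%:E)%E. Proof. by rewrite lee_fin power_ge0. Qed.

Let int_n_fin : (\int[mu]_(t in setT) (n' t)%:E < +oo)%E.
Proof.
apply: le_lt_trans cost_fin; rewrite costE leeDl//.
by apply: integral_ge0 => t _; exact: p'_ge0.
Qed.

Let int_p_fin : (\int[mu]_(t in setT) (p' t)%:E < +oo)%E.
Proof.
apply: le_lt_trans cost_fin; rewrite costE leeDr//.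
by apply: integral_ge0 => t _; exact: n'_ge0.
Qed.

Let integrable_p' : mu.-integrable setT (EFin \o p').
Proof.
apply/integrableP; split; first by apply/measurable_EFinP; exact: measurable_power.
move: int_p_fin; congr (_ < _)%E; apply: eq_integral => t _.
by apply/esym/gee0_abs; exact: p'_ge0.
Qed.

Let int_rate' A j T : mu.-integrable `[A, T] (EFin \o rate S' j).
Proof.
apply: (integrable_rate feasS' alpha_gt1).
by apply: integrableS integrable_p'.
Qed.

Let int_rate A j T : mu.-integrable `[A, T] (EFin \o rate S j).
Proof. by apply: (integrable_rate feasS alpha_gt1); apply: integrable_alg_power. Qed.

Let measurable_n' : measurable_fun setT n'.
Proof.
have [N0 HN0] := ex_start.
exact: (measurable_unfinished_count feasS' (HN0 N0 (leqnn _)) (int_rate' _)).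
Qed.

Let measurable_n : measurable_fun setT (unfinished_count S).
Proof.
have [N0 HN0] := ex_start.
exact: (measurable_unfinished_count feasS (HN0 N0 (leqnn _)) (int_rate _)).
Qed.

Let integrable_n' : mu.-integrable setT (EFin \o n').
Proof.
apply/integrableP; split; first exact/measurable_EFinP.
move: int_n_fin; congr (_ < _)%E; apply: eq_integral => t _.
by apply/esym/gee0_abs; exact: n'_ge0.
Qed.

Let g' t := n' t + p' t.
Let integrable_g' : mu.-integrable setT (EFin \o g').
Proof. exact: integrable_EFinD. Qed.

Let c' := \int[mu]_(t in setT) g' t.

Let cost'E : cost S' alpha = c'%:E.
Proof.
rewrite costE -ge0_integralD//; [|exact/measurable_EFinP|by apply/measurable_EFinP; exact: measurable_power].
by rewrite /c' /Rintegral fineK//; apply: integrable_fin_num.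
Qed.

Let g'_ge0 t : 0 <= g' t. Proof. by rewrite addr_ge0// power_ge0. Qed.

Let sub_c' A T : \int[mu]_(t in `[A, T]) g' t <= c'.
Proof.
rewrite /c' /Rintegral fine_le//.
- apply: integrable_fin_num => //; exact: integrableS integrable_g'.
- exact: integrable_fin_num.
- apply: ge0_subset_integral => //; first by apply/measurable_EFinP; exact: measurable_funD measurable_n' (measurable_power alpha feasS').
  by move=> t _; rewrite lee_fin.
Qed.

(** Otherwise the task counts as unfinished on a half-line and the competitor's cost is infinite. *)
Let eventually_finished A j : (forall i : 'I_(nJ I), A <= Defs.rel i) ->
  exists2 T, A <= T & remw S' A j T = 0.
Proof.
move=> Arel; apply: contrapT => nfin.
suff : (\int[mu]_(t in setT) (n' t)%:E = +oo)%E by move=> H; move: int_n_fin; rewrite H ltxx.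
apply/eqP; rewrite eq_le leey /=.
have -> : (+oo = \int[mu]_(t in `[Defs.rel (job j), +oo[) (cst 1%E t) :> \bar R)%E.
  by rewrite integral_cst//= lebesgue_measure_itv/= ltry mul1e.
apply: (@le_trans _ _ (\int[mu]_(t in `[Defs.rel (job j), +oo[) (n' t)%:E)%E).
  apply: ge0_le_integral => //; first by apply/measurable_EFinP; exact: measurable_funTS.
  move=> t /=; rewrite in_itv/= andbT => rt; rewrite lee_fin ler1n /n_unf (bigD1 j)//=.
  suff -> : unfinished S' j t by [].
  have At : A <= t by exact: le_trans (Arel _) rt.
  apply/asboolP; split=> // fin; apply: nfin; exists t => //.
  by apply/(finishedE feasS' Arel (int_rate' A)).
by apply: ge0_subset_integral => //; exact/measurable_EFinP.
Qed.

Let total_size_le_c' : total_size I <= c'.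
Proof.
have [N0 HN0] := ex_start.
have Arel := HN0 N0 (leqnn _).
have [T AT xT] : exists2 T, - N0%:R <= T & forall j, remw S' (- N0%:R) j T = 0.
  have [T AT xT] : exists2 T, - N0%:R <= T & forall j, j \in enum 'I_(nT I) -> remw S' (- N0%:R) j T = 0.
    elim: (enum 'I_(nT I)) => [|j s [T AT IH]]; first by exists (- N0%:R).
    have [T' AT' Hj] := eventually_finished j Arel.
    exists (Num.max T T'); first by rewrite le_max AT.
    have mono i T1 T2 : - N0%:R <= T1 -> T1 <= T2 -> remw S' (- N0%:R) i T1 = 0 ->
        remw S' (- N0%:R) i T2 = 0.
      move=> AT1 T12 H; apply/eqP; rewrite eq_le remw_ge0 andbT -H.
      exact: (le_remw feasS' (int_rate' _)).
    move=> i; rewrite inE => /orP[/eqP->|si].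
      by apply: mono Hj => //; rewrite le_max lexx orbT.
    by apply: mono (IH _ si) => //; rewrite le_max lexx.
  by exists T => // j; apply: xT; rewrite mem_enum.
apply: le_trans (sub_c' (- N0%:R) T).
exact: (@total_size_le R I K S S' (- N0%:R) T alpha).
Qed.

Lemma competitive : scaleQ I K alpha <= (12 * alpha)^-1 * total_size I ->
  (cost S alpha <= (ratio_bound I K alpha)%:E * cost S' alpha)%E.
Proof.
move=> sc; have b1 := beta_ge1 wfI nT_gt0.
have [a [a1 a2 budget]] := ratio_budget K_gt0 alpha_gt1 b1.
have a_ge0 : 0 <= a by have := alpha_gt1; lra.
rewrite cost'E -EFinM.
pose g t := unfinished_count S t + power S alpha t.
have mg : measurable_fun setT g by exact: measurable_funD measurable_n (measurable_power alpha feasS).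
have g_ge0 t : 0 <= g t by rewrite addr_ge0// power_ge0.
have -> : cost S alpha = (\int[mu]_(t in setT) (g t)%:E)%E.
  rewrite costE -ge0_integralD//.
  - by move=> t _; rewrite lee_fin.
  - exact/measurable_EFinP.
  - by move=> t _; rewrite lee_fin power_ge0.
  - by apply/measurable_EFinP; exact: measurable_power.
have [N0 HN0] := ex_start.
(* Windows that begin before all releases from [N0] on and exhaust the line. The bound on them does
   not depend on [N], so it passes to the monotone limit. *)
pose J (N : nat) : set R := `[- N%:R, N%:R].
have mJ N : measurable (J N) by rewrite /J.
have bound N : (N0 <= N)%N ->
    (\int[mu]_(t in J N) (g t)%:E <= (ratio_bound I K alpha * c')%:E)%E.
  move=> NN; have Arel := HN0 N NN.
  have AT : - N%:R <= N%:R :> R by rewrite lerNl (@le_trans _ _ 0)// oppr_le0.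
  have H := @alg_cost_itv R I K S S' (- N%:R) N%:R alpha K_gt0 wfI nT_gt0 alpha_gt1 feasS feasS'
    Arel AT algS integrable_p' a a1 a2.
  have -> : (\int[mu]_(t in J N) (g t)%:E =
      (\int[mu]_(t in J N) g t)%:E)%E.
    rewrite /Rintegral fineK//; apply: integrable_fin_num; rewrite /J//.
    apply: integrable_EFinD => //; last exact: integrable_alg_power.
    exact: (integrable_unfinished_count feasS _ Arel (int_rate _)).
  rewrite lee_fin; apply: le_trans H _.
  have Hjob := job_coef_sum K_gt0 alpha_gt1 wfI nT_gt0 sc.
  have W := total_size_le_c'.
  have ac : a * \int[mu]_(t in J N) (unfinished_count S' t + power S' alpha t) <= a * c'.
    by apply: ler_wpM2l => //; exact: sub_c'.
  have c0 : 0 <= c' by apply: Rintegral_ge0.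
  have e0 := ecoef_ge0 K_gt0 alpha_gt1.
  have s0 : 0 <= slack K (Defs.beta I) by rewrite /slack; case: ifP => // _; lra.
  have eW := ler_wpM2l e0 W.
  have sW := ler_wpM2l s0 W.
  have B := ler_wpM2r c0 budget.
  rewrite /ratio_bound; apply: le_trans B.
  have -> : (a + ecoef K alpha + slack K (Defs.beta I)) * c' =
      ecoef K alpha * c' + slack K (Defs.beta I) * c' + a * c' by ring.
  apply: lerD; last exact: ac.
  by apply: lerD => //; exact: le_trans sW.
have cvg : (\int[mu]_(t in J N) (g t)%:E)%E @[N --> \oo] -->
    (\int[mu]_(t in setT) (g t)%:E)%E.
  have -> : [set: R] = \bigcup_N J N.
    apply/seteqP; split=> // t _; exists (Num.trunc `|t|).+1 => //=.
    rewrite /J/= in_itv/= -ler_norml; apply: ltW; exact: truncnS_gt.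
  apply: ge0_nondecreasing_set_cvg_integral => //.
  - move=> k l kl; apply/subsetPset => t; rewrite /J/= !in_itv/= => /andP[H1 H2].
    have kl' : k%:R <= l%:R :> R by rewrite ler_nat.
    by apply/andP; split; lra.
  - by move=> i; apply/measurable_EFinP; exact: measurable_funTS.
  - by move=> i t _; rewrite lee_fin.
rewrite -(cvg_lim _ cvg)//; apply: lime_le; first by apply/cvg_ex; eexists; exact: cvg.
by exists N0 => // N /= NN; exact: bound.
Qed.

End competitive.

Theorem theorem2 (R : realType) (alpha : R) (halpha : 1 < alpha)
    (eps : R) (heps : 0 < eps) :
  exists delta : R, 0 < delta /\
  exists N : nat,
  forall (K : nat) (I : instance R),
    (0 < K)%N -> wf_instance I -> (N <= nT I)%N ->
    scaleQ I K alpha <= delta * total_size I ->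
    forall S : schedule I K, feasible S -> follows_alg S alpha ->
    (cost S alpha <= (ratio_bound I K alpha + eps)%:E * OPT I K alpha)%E.
Proof.
have a0 : 0 < alpha by lra.
(* This [delta] is the threshold of [job_coef_sum]; the bound 1 on the number of tasks provides a
   task, which makes [wmax] and [wredmin] positive. *)
exists (12 * alpha)^-1; split; first by rewrite invr_gt0 mulr_gt0.
exists 1%N => K I K0 wfI nT0 sc S feasS algS.
have r0 : 0 <= ratio_bound I K alpha.
  by rewrite mulr_ge0 ?powR_ge0//; have := beta_ge1 wfI nT0; lra.
have re0 : 0 < ratio_bound I K alpha + eps by lra.
(* [OPT] is an infimum that may not be attained; dividing by the positive ratio reduces the claim to
   each feasible schedule, which is trivial when its cost is infinite. *)
rewrite -lee_pdivrMl// /OPT; apply: le_ereal_inf_tmp => _ [S' [feasS' ->]].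
rewrite lee_pdivrMl//.
have c0 : (0 <= cost S' alpha)%E.
  by rewrite costE adde_ge0// integral_ge0// => t _; rewrite lee_fin ?power_ge0.
have [cy|] := eqVneq (cost S' alpha) +oo%E.
  by rewrite cy gt0_muley ?lte_fin// leey.
rewrite -ltey => cfin.
apply: le_trans (competitive K0 wfI nT0 halpha feasS feasS' algS cfin sc) _.
by apply: lee_wpmul2r => //; rewrite lee_fin lerDl ltW.
Qed.
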